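(* Let $z,z',w,w'\in\mathbb C$ satisfy $(z+k)(z'+k)>0$ and $(w+k)(w'+k)>0$ for all $k\in\mathbb Z$, and $z+z'+w+w'>-1$. For any $N\ge1$, the matrix $\mathbf D^{(N)}$ of transition rates on the set $\mathbb{GT}^{(N)}$ of Gelfand–Tsetlin schemes of length $N$ is regular, and the corresponding Markov semigroup $(P^{(N)}(t))_{t\ge0}$ is central. The Markov semigroup induced by it on $\mathbb{GT}_N$ coincides with the semigroup $(P_N(t))_{t\ge0}$ with matrix of transition rates $\mathcal D^{(N)}$.
   Context: **Signatures and schemes.** $\mathbb{GT}_k$ is the set of signatures $\lambda=(\lambda_1\ge\dots\ge\lambda_k)\in\mathbb Z^k$; $\mathrm{Dim}_k\lambda=\prod_{1\le i<j\le k}(\lambda_i-i-\lambda_j+j)/\prod_{i=1}^{k-1}i!$; for $\nu\in\mathbb{GT}_k,\lambda\in\mathbb{GT}_{k+1}$, $\nu\prec\lambda$ means $\lambda_{i+1}\le\nu_i\le\lambda_i$ for $1\le i\le k$. $\Lambda^{k+1}_k(\lambda,\nu)=\mathrm{Dim}_k\nu/\mathrm{Dim}_{k+1}\lambda$ if $\nu\prec\lambda$ and $0$ otherwise. $\mathbb{GT}^{(N)}$ is the set of sequences $\underline\lambda=(\lambda^{(1)}\prec\lambda^{(2)}\prec\dots\prec\lambda^{(N)})$, $\lambda^{(k)}\in\mathbb{GT}_k$. **The matrix $\mathbf D^{(N)}$** is the matrix of transition rates on $\mathbb{GT}^{(N)}$ of the following dynamics. From a scheme $\{\lambda_i^{(k)}\}_{1\le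 i\le k\le N}$: - each coordinate $\lambda_i^{(k)}$ tries to jump to the right by $1$ with rate $(\lambda_i^{(k)}-i-z+1)(\lambda_i^{(k)}-i-z'+1)$ and to the left by $1$ with rate $(\lambda_i^{(k)}+k-i+w)(\lambda_i^{(k)}+k-i+w')$, independently of the others; - a right jump attempt of $\lambda_i^{(k)}$ is blocked if $\lambda_i^{(k)}=\lambda_{i-1}^{(k-1)}$; a left jump attempt is blocked if $\lambda_i^{(k)}=\lambda_i^{(k-1)}$ (when these coordinates exist); - if an attempted right jump of $\lambda_i^{(k)}$ is not blocked, take the greatest $l$, $k\le l\le N$, with $\lambda_i^{(j)}=\lambda_i^{(k)}$ for $j=k,\dots,l$, and increase all $\lambda_i^{(j)}$, $k\le j\le l$, by $1$; - if an attempted left jump of $\lambda_i^{(k)}$ is not blocked, take the greatest $l$, $k\le l\le N$, with $\lambda_{i+j-k}^{(j)}=\lambda_i^{(k)}$ for $j=k,\dots,l$, and decrease all $\lambda_{i+j-k}^{(j)}$, $k\le j\le l$, by $1$. Thus the off-diagonal entry $\mathbf D^{(N)}(\underline\lambda,\underline\nu)$ is the rate of the move taking $\underline\lambda$ to $\underline\nu$ ($0$ if there is none), and diagonal entries make row sums zero. **Regularity.** A matrix of transition rates $Q$ on a countable set (nonnegative off-diagonal entries, zero row sums, finite diagonal) is regular if the minimal nonnegative solution of $\frac d{dt}P(t)=QP(t)$, $P(0)=\mathrm{Id}$, is stochastic for all $t\ge 0$; this solution is then the corresponding Markov semigroup. **Centrality.** A probability measure $\mu^{(N)}$ on $\mathbb{GT}^{(N)}$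 is central if there is a probability measure $\mu_N$ on $\mathbb{GT}_N$ with $\mu^{(N)}(\lambda^{(1)},\dots,\lambda^{(N)})=\mu_N(\lambda^{(N)})\Lambda^N_{N-1}(\lambda^{(N)},\lambda^{(N-1)})\cdots\Lambda^2_1(\lambda^{(2)},\lambda^{(1)})$; this gives a bijection $\mu_N\leftrightarrow\mu^{(N)}$. A Markov semigroup on $\mathbb{GT}^{(N)}$ is central if it maps central measures to central measures; it then induces a Markov semigroup on $\mathbb{GT}_N$ via this bijection ($\mu_N\mapsto\mu^{(N)}\mapsto\mu^{(N)}P^{(N)}(t)\mapsto$ the corresponding measure on $\mathbb{GT}_N$). **The semigroup $P_N(t)$** is the Markov semigroup with the (regular) matrix of transition rates $\mathcal D^{(N)}$ on $\mathbb{GT}_N$ whose nonzero off-diagonal entries are, with $l_j=\lambda_j+N-j$ and $e_i$ the $i$-th standard basis vector, $$\mathcal D^{(N)}(\lambda,\lambda+e_i)=(l_i-z-N+1)(l_i-z'-N+1)\prod_{j\ne i}\frac{l_i+1-l_j}{l_i-l_j},\qquad \mathcal D^{(N)}(\lambda,\lambda-e_i)=(l_i+w)(l_i+w')\prod_{j\ne i}\frac{l_i-1-l_j}{l_i-l_j}$$ (when $\lambda\pm e_i\in\mathbb{GT}_N$), with diagonal entries making row sums zero. *)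

(* Defs.v *)
From HB Require Import structures.
From mathcomp Require Import all_boot all_order all_algebra.
From mathcomp Require Import complex.
From mathcomp Require Import all_classical all_reals all_analysis.

Set Implicit Arguments.
Unset Strict Implicit.
Unset Printing Implicit Defensive.

Import Order.TTheory GRing.Theory Num.Theory.
Import numFieldNormedType.Exports.

Local Open Scope classical_set_scope.
Local Open Scope ring_scope.

Section CountableMarkov.
Variables (R : realType) (T : countType).
Implicit Types (mu : T -> R) (q Q p : T -> T -> R) (P : R -> T -> T -> R).

Definition prob_measure mu : Prop :=
  (forall a, 0 <= mu a) /\ \esum_(a in [set: T]) (mu a)%:E = 1%E.

Definition stochastic p : Prop := forall a, prob_measure (p a).

(* The product of the row vector mu with the matrix p. *)
Definition act mu p : T -> R :=
  fun b => fine (\esum_(a in [set: T]) (mu a * p a b)%:E).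

(* Matrix with the off-diagonal entries of q and the diagonal entries that
   make row sums zero. *)
Definition with_zero_row_sums q : T -> T -> R := fun a b =>
  if a == b then - fine (\esum_(c in [set c | c != a]) (q a c)%:E) else q a b.

Definition rate_matrix Q : Prop :=
  (forall a b, a != b -> 0 <= Q a b) /\
  (forall a, \esum_(c in [set c | c != a]) (Q a c)%:E = (- Q a a)%:E).

(* P'(t) = Q P(t), P(0) = Id, P(t) >= 0, for t in [0, +oo[. The derivative is
   taken relative to [0, +oo[, hence it is one-sided at t = 0. In an entry of
   Q P(t) the only negative summand is the diagonal one, which is split off
   because \esum is meant for nonnegative families; the equation also asserts
   that the series converges. *)
Definition backward_solution Q P : Prop :=
  [/\ forall (t : R) a b, 0 <= t -> 0 <= P t a b,
      forall a b, P 0 a b = (a == b)%:R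
    & forall (t : R) a b, 0 <= t -> exists2 d : R,
        (P s a b - P t a b) / (s - t) @[s --> within `[0, +oo[ t^'] --> d
      & d%:E = ((Q a a * P t a b)%:E +
                \esum_(c in [set c | c != a]) (Q a c * P t c b)%:E)%E].

Definition minimal_solution Q P : Prop :=
  backward_solution Q P /\
  forall P', backward_solution Q P' ->
    forall (t : R) a b, 0 <= t -> P t a b <= P' t a b.

Definition markov_semigroup_of Q P : Prop :=
  minimal_solution Q P /\ forall t : R, 0 <= t -> stochastic (P t).

Definition regular Q : Prop :=
  rate_matrix Q /\ exists P, markov_semigroup_of Q P.

End CountableMarkov.

Record signature (k : nat) := Signature {
  parts : k.-tuple int;
  _ : sorted (fun a b : int => b <= a) parts }.

HB.instance Definition _ k := [isSub for @parts k].
HB.instance Definition _ k := [Countable of signature k by <:].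

Fact sorted_nseq0 k :
  sorted (fun a b : int => b <= a) (nseq_tuple k (0 : int)).
Proof. by case: k => [|k] //=; elim: k. Qed.

Definition zero_signature k : signature k := Signature (sorted_nseq0 k).

(* Coordinates are numbered from 1, as in the formulas below. *)
Definition part k (x : signature k) (i : nat) : int := nth 0 (parts x) i.-1.

Definition interlace k (nu : signature k) (lam : signature k.+1) : bool :=
  [forall i : 'I_k, (part lam i.+2 <= part nu i.+1) &&
                    (part nu i.+1 <= part lam i.+1)].

Definition rows (N : nat) : Type :=
  {dffun forall k : 'I_N, signature k.+1}.

(* The row lambda^(k), for 1 <= k <= N; zero_signature is a junk value. *)
Definition row_level N (s : rows N) (k : nat) : signature k :=
  match k with
  | 0 => zero_signature 0
  | k'.+1 => match decP (@idP (k' < N)%N) with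
             | left lt_k'N => s (Ordinal lt_k'N)
             | right _ => zero_signature k'.+1
             end
  end.

Record scheme (N : nat) := Scheme {
  scheme_rows : rows N;
  _ : [forall k : 'I_N, (0 < k)%N ==>
        interlace (row_level scheme_rows k) (row_level scheme_rows k.+1)] }.

HB.instance Definition _ N := [isSub for @scheme_rows N].
HB.instance Definition _ N := [Countable of scheme N by <:].

Definition level N (s : scheme N) (k : nat) : signature k :=
  row_level (scheme_rows s) k.

(* lambda_i^(k), meaningful for 1 <= i <= k <= N *)
Definition entry N (s : scheme N) (k i : nat) : int := part (level s k) i.

Section Links.
Variable R : realType.

Definition Dim k (x : signature k) : R :=
  (\prod_(1 <= i < k.+1) \prod_(i.+1 <= j < k.+1)
     (part x i - i%:Z - part x j + j%:Z)%:~R) /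
  \prod_(1 <= i < k) (i`!)%:R.

Definition Link k (lam : signature k.+1) (nu : signature k) : R :=
  if interlace nu lam then Dim nu / Dim lam else 0.

(* The measure mu^(N) on schemes attached to the measure mu_N = mu. *)
Definition central_lift N (mu : signature N -> R) : scheme N -> R := fun s =>
  mu (level s N) * \prod_(1 <= k < N) Link (level s k.+1) (level s k).

Definition central_measure N (M : scheme N -> R) : Prop :=
  prob_measure M /\
  exists2 mu : signature N -> R, prob_measure mu & M = central_lift mu.

Definition central_semigroup N (P : R -> scheme N -> scheme N -> R) : Prop :=
  forall t : R, 0 <= t -> forall M, central_measure M -> central_measure (act M (P t)).

(* PN is induced by P: mu PN(t) is the probability measure on signatures that
   corresponds to mu^(N) P(t). *)
Definition induced_semigroup N (P : R -> scheme N -> scheme N -> R)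
    (PN : R -> signature N -> signature N -> R) : Prop :=
  forall t : R, 0 <= t -> forall mu, prob_measure mu ->
    prob_measure (act mu (PN t)) /\
    central_lift (act mu (PN t)) = act (central_lift mu) (P t).

End Links.

Section Rates.
Variables (R : realType) (z z' w w' : R[i]) (N : nat).

(* The products of complex numbers below are real under the assumptions made on
   the parameters; complex.Re only casts them to R. *)

Definition right_rate (s : scheme N) (k i : nat) : R :=
  let x := entry s k i in
  complex.Re (((x - i%:Z + 1)%:~R - z) * ((x - i%:Z + 1)%:~R - z')).

Definition left_rate (s : scheme N) (k i : nat) : R :=
  let x := entry s k i in
  complex.Re (((x + k%:Z - i%:Z)%:~R + w) * ((x + k%:Z - i%:Z)%:~R + w')).

Definition right_blocked (s : scheme N) (k i : nat) : bool :=
  (1 < i)%N && (entry s k i == entry s k.-1 i.-1).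

Definition left_blocked (s : scheme N) (k i : nat) : bool :=
  (i < k)%N && (entry s k i == entry s k.-1 i).

Definition right_reach (s : scheme N) (k i : nat) : nat :=
  \max_(k <= l < N.+1 |
        all (fun j => entry s j i == entry s k i) (index_iota k l.+1)) l.

Definition left_reach (s : scheme N) (k i : nat) : nat :=
  \max_(k <= l < N.+1 |
        all (fun j => entry s j (i + j - k)%N == entry s k i)
            (index_iota k l.+1)) l.

(* The right jump attempt of lambda_i^(k) takes s to s'. *)
Definition right_move (s : scheme N) (k i : nat) (s' : scheme N) : bool :=
  ~~ right_blocked s k i &&
  all (fun j => all (fun m => entry s' j m == entry s j m +
           if (k <= j <= right_reach s k i)%N && (m == i) then 1 else 0)
         (iota 1 j)) (iota 1 N).

Definition left_move (s : scheme N) (k i : nat) (s' : scheme N) : bool :=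
  ~~ left_blocked s k i &&
  all (fun j => all (fun m => entry s' j m == entry s j m -
           if (k <= j <= left_reach s k i)%N && (m == i + j - k)%N then 1 else 0)
         (iota 1 j)) (iota 1 N).

(* The matrix D^(N) on schemes; a given pair s != s' is realized by at most one
   move, so the sum has at most one nonzero term. *)
Definition scheme_rates : scheme N -> scheme N -> R :=
  with_zero_row_sums (fun s s' =>
    \sum_(1 <= k < N.+1) \sum_(1 <= i < k.+1)
      ((if right_move s k i s' then right_rate s k i else 0) +
       (if left_move s k i s' then left_rate s k i else 0))).

Definition lcoord (x : signature N) (i : nat) : int :=
  part x i + N%:Z - i%:Z.

Definition plus_e (x : signature N) (i : nat) (y : signature N) : bool :=
  all (fun j => part y j == part x j + if j == i then 1 else 0) (iota 1 N).

Definition up_rate (x : signature N) (i : nat) : R :=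
  let l := lcoord x in
  complex.Re (((l i - N%:Z + 1)%:~R - z) * ((l i - N%:Z + 1)%:~R - z')) *
  \prod_(1 <= j < N.+1 | j != i) ((l i + 1 - l j)%:~R / (l i - l j)%:~R).

Definition down_rate (x : signature N) (i : nat) : R :=
  let l := lcoord x in
  complex.Re (((l i)%:~R + w) * ((l i)%:~R + w')) *
  \prod_(1 <= j < N.+1 | j != i) ((l i - 1 - l j)%:~R / (l i - l j)%:~R).

(* The matrix (calligraphic D)^(N) on signatures; plus_e y i x says that
   y = x - e_i. *)
Definition signature_rates : signature N -> signature N -> R :=
  with_zero_row_sums (fun x y =>
    \sum_(1 <= i < N.+1)
      ((if plus_e x i y then up_rate x i else 0) +
       (if plus_e y i x then down_rate x i else 0))).

End Rates.

Arguments scheme_rates {R} z z' w w' N _ _.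
Arguments signature_rates {R} z z' w w' N _ _.

(* Main.v *)
Require Import Defs.
From mathcomp Require Import all_boot all_order all_algebra.
From mathcomp Require Import complex finmap.
From mathcomp Require Import all_classical all_reals all_analysis.
From mathcomp Require Import zify ring lra.

Set Implicit Arguments.
Unset Strict Implicit.
Unset Printing Implicit Defensive.

Import Order.TTheory GRing.Theory Num.Theory.
Import numFieldNormedType.Exports.

Local Open Scope classical_set_scope.
Local Open Scope ring_scope.

(** Both matrices come from finitely many moves: at a state [a], move [m] leads
    to [tgt a m] at rate [r a m], and a backward solution is a function [u]
    with [u' = gen u], where
    [gen f a = \sum_m r a m * (f (tgt a m) - f a)].

    Regularity comes from a function [V >= 1] with finite sublevel sets and
    [gen V <= c V]. It yields a maximum principle (max_principle), hence
    comparison and uniqueness of bounded solutions. Solving on the sublevel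
    sets of [V] and letting them grow gives the minimal solution
    (truncated_solution, exists_solution). Its row sums form a bounded solution
    with initial value 1, so they are 1 by uniqueness (solution_stochastic).

    On signatures, [V] is 1 plus the sum of squares of the shifted coordinates:
    the products in the rates are Lagrange weights, so the drift of [V] is a
    divided difference of polynomials of low degree (divdiff_shift,
    sig_drift_le). On schemes, coordinate [x] of level [k] contributes
    [(1 + x ^+ 2) ^+ (N - k + 1)]. Blocking and pushing destroy the cancellation
    between left and right jumps, and the loss is one factor [1 + x ^+ 2]; but
    the blocking or pushing coordinate has the same value and sits on a lower
    level, where the exponent is larger (scheme_drift_le).

    Centrality rests on an intertwining. The product of links telescopes, so a
    central measure is constant on each fibre, the set of schemes with a given
    top row [x], with weights [mu x / Dim x] (central_liftE). Write
    [fibre_mean f x] for the sum of [f] over the fibre of [x], divided by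
    [Dim x]. The identity to prove is
    [fibre_mean (gen f) = gen (fibre_mean f)], with the generator of schemes on
    the left and that of signatures on the right (fibre_mean_gen). Sum the
    right moves over a fibre and sort them by the scheme at which they arrive:
    a scheme has at most one right predecessor for each index and last pushed
    level (right_inflow). A jump that is blocked by the coordinate one level
    below has exactly the rate of the incoming move which that coordinate
    prevents, so the constraints cancel (right_flux); what remains are the
    moves of the top row and a potential that telescopes over the levels.
    Negating all coordinates turns left moves into right moves. The sum of both
    potentials depends on the top row only, because both rates are monic
    quadratic polynomials (potential_sum), and it is minus the total exit rate
    of the dynamics on signatures (exit_rate).

    Finally the fibre mean of the transition function of schemes and the
    transition function of signatures divided by [Dim] solve the same equation
    with the same initial value, so they agree (fibre_mean_semigroup). Summing
    against a measure gives the theorem (induced_central_lift). *)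

(** * Derivatives on the half-line *)

Section RightDerivative.
Variable R : realType.
Implicit Types (u v : R -> R) (s t d e : R).

(** The derivative relative to [0, +oo[, one-sided at 0, written with an
    explicit remainder: this form has no quotient, and it passes to sums
    and to limits that are uniform in the remainder. *)
Definition has_deriv u t d := forall e, 0 < e -> exists2 dl : R, 0 < dl &
  forall s, 0 <= s -> `|s - t| < dl ->
    `|u s - u t - d * (s - t)| <= e * `|s - t|.

Lemma has_derivP u t d :
  has_deriv u t d <->
  (u s - u t) / (s - t) @[s --> within `[0, +oo[ t^'] --> d.
Proof.
split=> [H|H e e0].
- apply/cvgrPdist_le => e e0; have [dl dl0 Hd] := H e e0.
  apply/nbhs_ballP; exists dl => //= s.
  rewrite /ball/= distrC => ds; rewrite /= => ns; rewrite in_itv/= andbT => s0.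
  have := Hd s s0 ds.
  have st0 : s - t != 0 by rewrite subr_eq0.
  rewrite -ler_pdivrMr ?normr_gt0// -normfV -normrM mulrBl mulfK// => h.
  by rewrite distrC.
- move/cvgrPdist_le : H => /(_ e e0) /nbhs_ballP[dl /= dl0 Hd].
  exists dl => // s s0 ds.
  have [->|ns] := eqVneq s t; first by rewrite !subrr mulr0 subrr normr0 mulr0.
  have st0 : s - t != 0 by rewrite subr_eq0.
  have := Hd s; rewrite /ball/= distrC => /(_ ds ns); rewrite in_itv/= andbT => /(_ s0).
  rewrite -[X in _ -> X <= _ ](_ : `|(u s - u t) / (s - t) - d| * `|s - t| = _); last first.
    by rewrite -normrM mulrBl divfK.
  by rewrite distrC => ?; rewrite ler_wpM2r.
Qed.

Lemma has_derivD u v t d e : has_deriv u t d -> has_deriv v t e -> has_deriv (fun s => u s + v s) t (d + e).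
Proof.
move=> hu hv x x0; have x20 : 0 < x / 2 by rewrite divr_gt0.
have [a a0 ha] := hu _ x20; have [b b0 hb] := hv _ x20.
exists (Num.min a b); first by rewrite lt_min a0.
move=> s s0; rewrite lt_min => /andP[sa sb].
rewrite (_ : _ - _ - _ = (u s - u t - d * (s - t)) + (v s - v t - e * (s - t))); last by ring.
rewrite (le_trans (ler_normD _ _))// [in leRHS](splitr x) mulrDl lerD//; [exact: ha|exact: hb].
Qed.

Lemma has_deriv_cst c t : has_deriv (fun=> c) t 0.
Proof. by move=> e e0; exists 1 => // s _ _; rewrite subrr mul0r subrr normr0 mulr_ge0// ltW. Qed.

Lemma has_derivZ c u t d : has_deriv u t d -> has_deriv (fun s => c * u s) t (c * d).
Proof.
move=> hu x x0.
have c0 : 0 < `|c| + 1 by rewrite ltr_wpDl.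
have [a a0 ha] := hu _ (divr_gt0 x0 c0).
exists a => // s s0 sa.
rewrite -mulrBr -mulrA -mulrBr normrM.
apply: (le_trans (ler_wpM2l _ (ha s s0 sa))) => //.
rewrite mulrA ler_wpM2r// mulrCA ler_piMr ?ltW//.
by rewrite ltr_pdivrMr// mul1r ltrDl.
Qed.

Lemma has_deriv_sum (I : Type) (r : seq I) (P : pred I) (f : I -> R -> R) (d : I -> R) t :
  (forall i, P i -> has_deriv (f i) t (d i)) ->
  has_deriv (fun s => \sum_(i <- r | P i) f i s) t (\sum_(i <- r | P i) d i).
Proof.
move=> h; elim: r => [|i r IH].
  under eq_fun do rewrite big_nil.
  by rewrite big_nil; exact: has_deriv_cst.
under eq_fun do rewrite big_cons.
rewrite big_cons; case: ifPn => // Pi.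
by apply: has_derivD => //; exact: h.
Qed.

Lemma is_derive_has_deriv u t d : is_derive t 1 u d -> has_deriv u t d.
Proof.
move=> [du <-] e e0.
have /cvgrPdist_le/(_ e e0) := (du : cvg _).
rewrite -/(derive u t 1) => /nbhs_ballP[dl /= dl0 Hd].
exists dl => // s s0 ds.
have [->|ns] := eqVneq s t; first by rewrite !subrr mulr0 subrr normr0 mulr0.
have st0 : s - t != 0 by rewrite subr_eq0.
have := Hd (s - t); rewrite /ball/= sub0r normrN => /(_ ds st0).
rewrite /= [_%:A]mulr1 subrK distrC => h.
rewrite (_ : u s - u t - _ = ((s - t)^-1 * (u s - u t) - 'D_1 u t) * (s - t)).
  by rewrite normrM ler_wpM2r.
by rewrite mulrBl mulrAC mulVf// mul1r.
Qed.

Lemma is_derive_expRM k t : is_derive t 1 (fun s => expR (k * s)) (k * expR (k * t)).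
Proof.
rewrite mulrC; apply: (@is_derive1_comp _ expR (fun s => k * s)).
by have := @is_deriveZ _ _ _ id k t 1 1 (is_derive_id _ _); rewrite -[k *: 1]/(k * 1) mulr1.
Qed.

Lemma has_deriv_expR k t : has_deriv (fun s => expR (k * s)) t (k * expR (k * t)).
Proof. exact/is_derive_has_deriv/is_derive_expRM. Qed.

Lemma has_deriv_is_derive u t d : 0 < t -> has_deriv u t d -> is_derive t 1 u d.
Proof.
move=> t0 H.
suff h : h^-1 *: ((u \o shift t) (h *: 1) - u t) @[h --> 0^'] --> d.
  have du : derivable u t 1 by apply/cvg_ex; exists d.
  by apply: DeriveDef => //; apply: cvg_lim.
apply/cvgrPdist_le => e e0; have [dl dl0 Hd] := H e e0.
apply/nbhs_ballP; exists (Num.min dl t) => /=.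
  by rewrite lt_min dl0.
move=> h; rewrite /ball/= sub0r normrN lt_min => /andP[hdl ht] h0.
have := Hd (h + t); rewrite addrK [_%:A]mulr1 hdl => /(_ _ isT).
move: ht; rewrite ltr_norml => /andP[ht _].
rewrite -lerBlDr sub0r => /(_ (ltW ht)) h1.
rewrite distrC -(ler_pM2r (_ : 0 < `|h|)) ?normr_gt0//; apply: le_trans h1.
rewrite -normrM mulrBl -[_ *: _]/(_ * _) mulrAC mulVf// mul1r//.
Qed.

Lemma has_deriv_continuous u (d : R -> R) a b : 0 <= a ->
  (forall t, 0 <= t -> has_deriv u t (d t)) -> {within `[a, b], continuous u}.
Proof.
move=> a0 H; apply/subspace_continuousP => t; rewrite /= in_itv/= => /andP[at_ tb].
have t0 := le_trans a0 at_.
apply/cvgrPdist_le => e e0.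
have [dl dl0 Hd] := H t t0 1 ltr01.
pose c := 1 + `|d t|; have c0 : 0 < c by rewrite ltr_wpDr.
apply/nbhs_ballP; exists (Num.min dl (e / c)) => /=.
  by rewrite lt_min dl0 divr_gt0.
move=> s; rewrite /ball/= lt_min distrC => /andP[sd se].
rewrite in_itv/= => /andP[as_ sb].
have h := Hd s (le_trans a0 as_) sd.
rewrite distrC (_ : u s - u t = (u s - u t - d t * (s - t)) + d t * (s - t)); last by rewrite subrK.
rewrite (le_trans (ler_normD _ _))// (le_trans (lerD h (lexx _)))// normrM -mulrDl -/c.
by rewrite mulrC -ler_pdivlMr// ltW.
Qed.

Lemma has_deriv_mean_value u (d : R -> R) a b C : 0 <= a -> a <= b ->
  (forall t, 0 <= t -> has_deriv u t (d t)) ->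
  (forall t, a <= t <= b -> `|d t| <= C) -> `|u b - u a| <= C * (b - a).
Proof.
move=> a0 ab H dC; move: ab; rewrite le_eqVlt => /predU1P[<-|ab].
  by rewrite !subrr normr0 mulr0.
have [|c] := @MVT _ u d a b ab _ (has_deriv_continuous a0 H).
  move=> x; rewrite in_itv/= => /andP[ax xb]; apply: has_deriv_is_derive.
    exact: le_lt_trans ax.
  by apply: H; rewrite (le_trans a0)// ltW.
rewrite in_itv/= => /andP[ac cb ->]; rewrite normrM (gtr0_norm (_ : 0 < b - a)) ?subr_gt0//.
by rewrite ler_wpM2r ?subr_ge0 ?(ltW ab)// dC// !ltW.
Qed.

(** Mean value inequality without an order between the end points, as the
    remainder in has_deriv requires. *)
Lemma has_deriv_mean_value_norm u (d : R -> R) a b C : 0 <= a -> 0 <= b ->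
  (forall t, 0 <= t -> has_deriv u t (d t)) ->
  (forall t, 0 <= t -> `|t - a| <= `|b - a| -> `|d t| <= C) -> `|u b - u a| <= C * `|b - a|.
Proof.
move=> a0 b0 H dC; have [ab|ba] := leP a b.
  rewrite (ger0_norm (_ : 0 <= b - a)) ?subr_ge0//.
  apply: (has_deriv_mean_value a0 ab H) => t /andP[at_ tb]; apply: dC; first exact: le_trans at_.
  by rewrite !ger0_norm ?subr_ge0// lerD2r.
rewrite distrC (distrC b) (gtr0_norm (_ : 0 < a - b)) ?subr_gt0//.
apply: (has_deriv_mean_value b0 (ltW ba) H) => t /andP[at_ tb]; apply: dC; first exact: le_trans at_.
by rewrite !ler0_norm ?subr_le0 ?(ltW ba)// lerN2 lerD2r.
Qed.

(** Only times before [t] are compared: in the maximum principle the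
    minimum may be attained at the right end of the time interval. *)
Lemma has_deriv_min u t d : 0 < t -> has_deriv u t d ->
  (forall s, 0 <= s -> s <= t -> u t <= u s) -> d <= 0.
Proof.
move=> t0 H umin; apply/ler_addgt0Pr => e e0; rewrite add0r.
have [dl dl0 Hd] := H e e0.
pose h := Num.min (dl / 2) t.
have h0 : 0 < h by rewrite lt_min divr_gt0.
have hdl : h < dl by rewrite gt_min ltr_pdivrMr// ltr_pMr// ltr1n.
have ht : h <= t by rewrite ge_min lexx orbT.
have := Hd (t - h); rewrite subr_ge0 ht addrAC subrr add0r normrN gtr0_norm// hdl => /(_ isT isT).
rewrite ler_norml => /andP[_ h1].
have := umin (t - h); rewrite subr_ge0 ht gerBl (ltW h0) => /(_ isT isT) h2.
rewrite -(ler_pM2r h0); lra.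
Qed.

End RightDerivative.

(** * Generators and the maximum principle *)

Lemma seq_argmin (R : realDomainType) (T : eqType) (g : T -> R) (x : T) (s : seq T) :
  x \in s -> exists2 y, y \in s & forall z, z \in s -> g y <= g z.
Proof.
elim: s x => // a s IH x _; case: s IH => [_|b s IH].
  by exists a; rewrite ?mem_head// => z; rewrite inE => /eqP->.
have [y ys ymin] := IH b (mem_head _ _).
have [ay|ya] := leP (g a) (g y).
  exists a; rewrite ?mem_head// => z; rewrite inE => /predU1P[->//|/ymin].
  exact: le_trans.
exists y; first by rewrite inE ys orbT.
move=> z; rewrite inE => /predU1P[->|/ymin//].
exact: ltW.
Qed.

Section Generator.
Variables (R : realType) (T : countType) (I : Type) (ms : seq I).
Variables (r : T -> I -> R) (tgt : T -> I -> T).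

Definition gen (f : T -> R) (a : T) : R :=
  \sum_(m <- ms) r a m * (f (tgt a m) - f a).

Lemma genD f g a : gen (fun x => f x + g x) a = gen f a + gen g a.
Proof. by rewrite /gen -big_split; apply: eq_bigr => m _ /=; ring. Qed.

Lemma genZ c f a : gen (fun x => c * f x) a = c * gen f a.
Proof. by rewrite /gen mulr_sumr; apply: eq_bigr => m _ /=; ring. Qed.

Lemma gen_cst c a : gen (fun=> c) a = 0.
Proof. by rewrite /gen big1// => m _; rewrite subrr mulr0. Qed.

Lemma gen_sum (J : Type) (s : seq J) (P : pred J) (f : J -> T -> R) a :
  gen (fun x => \sum_(j <- s | P j) f j x) a = \sum_(j <- s | P j) gen (f j) a.
Proof.
rewrite /gen exchange_big/=; apply: eq_bigr => m _.
by rewrite -sumrB mulr_sumr.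
Qed.

Definition solves (u : R -> T -> R) :=
  forall t a, 0 <= t -> has_deriv (u^~ a) t (gen (u t) a).

Lemma solvesD u v : solves u -> solves v -> solves (fun t a => u t a + v t a).
Proof. by move=> hu hv t a t0; rewrite genD; apply: has_derivD; [exact: hu|exact: hv]. Qed.

Lemma solvesZ c u : solves u -> solves (fun t a => c * u t a).
Proof. by move=> hu t a t0; rewrite genZ; apply: has_derivZ; exact: hu. Qed.

Lemma solves_cst c : solves (fun _ _ => c).
Proof. by move=> t a t0; rewrite gen_cst; exact: has_deriv_cst. Qed.

Lemma solves_sum (J : Type) (s : seq J) (P : pred J) (u : J -> R -> T -> R) :
  (forall j, P j -> solves (u j)) -> solves (fun t a => \sum_(j <- s | P j) u j t a).
Proof. by move=> h t a t0; rewrite gen_sum; apply: has_deriv_sum => j Pj; exact: h. Qed.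

Hypothesis r_ge0 : forall a m, 0 <= r a m.

Section Lyapunov.
Variables (V : T -> R) (c : R).
Hypothesis V_ge1 : forall a, 1 <= V a.
Hypothesis V_gen : forall a, gen V a <= c * V a.

(** If u were negative somewhere, so would be w t a = u t a + eps V a
    e^((c+1)t) for a small eps. Since V dominates G, w can be negative only
    on a finite set of states, so it attains a negative global minimum, at
    a time t0 > 0 because u 0 >= 0. There the time derivative of w is at
    most 0 while gen w is at least 0, and the growth rate c + 1 > c of the
    barrier contradicts this. The derivative D is compared with gen u only
    where u < 0, which allows u to be a difference of truncated solutions. *)
Lemma max_principle (u D : R -> T -> R) (G : T -> R) :
  (forall K, finite_set [set a | V a <= K * G a]) ->
  (forall (t : R) a, 0 <= t -> has_deriv (u^~ a) t (D t a)) ->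
  (forall (t : R) a, 0 <= t -> u t a < 0 -> gen (u t) a <= D t a) ->
  (forall (t : R) a, 0 <= t -> - G a <= u t a) ->
  (forall a, 0 <= u 0 a) ->
  forall (t : R) a, 0 <= t -> 0 <= u t a.
Proof.
move=> V_dom uD Dgen uG u0 t1 a1 t10; rewrite leNgt; apply/negP => ua1.
have V_gt0 a : 0 < V a by rewrite (lt_le_trans ltr01).
pose k := c + 1.
(* This eps keeps w negative at (t1, a1), where it equals u / 2. *)
pose eps := - u t1 a1 / 2 / (expR (k * t1) * V a1).
have eps0 : 0 < eps by rewrite !divr_gt0 ?mulr_gt0 ?expR_gt0// oppr_gt0.
pose E t := expR (k * t).
have E0 t : 0 < E t by exact: expR_gt0.
pose w t a := u t a + eps * V a * E t.
have wa1 : w t1 a1 < 0.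
  rewrite /w /eps -/(E t1) (_ : _ * V a1 * _ = - u t1 a1 / 2); first by lra.
  by field; rewrite !gt_eqF//.
clearbody eps.
have wD t a : 0 <= t -> has_deriv (w^~ a) t (D t a + eps * V a * (k * E t)).
  move=> t0; apply: has_derivD; first exact: uD.
  by apply: has_derivZ; exact: has_deriv_expR.
(* K is a lower bound of E on [0, t1], whatever the sign of c + 1. *)
pose K := Num.min 1 (expR (k * t1)).
have K0 : 0 < K by rewrite lt_min ltr01 expR_gt0.
have KE t : 0 <= t <= t1 -> K <= E t.
  move=> /andP[t0 tt1]; rewrite /K ge_min /E.
  have [k0|k0] := leP 0 k; first by rewrite -[X in X <= _]expR0 ler_expR mulr_ge0.
  by rewrite [X in _ || X]ler_expR ler_nM2l// tt1 orbT.
clearbody K.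
pose F := [set a | V a <= (eps * K)^-1 * G a].
have Ffin : finite_set F by exact: V_dom.
have wF t a : 0 <= t <= t1 -> w t a < 0 -> F a.
  move=> tt; rewrite /w /F /= => h; have := uG t a (proj1 (andP tt)) => hG.
  rewrite mulrC ler_pdivlMr ?mulr_gt0//.
  have : eps * V a * K <= eps * V a * E t by rewrite ler_wpM2l ?KE// mulr_ge0 ?ltW.
  rewrite mulrCA mulrA; lra.
have amin a : exists2 t, 0 <= t <= t1 & forall s, 0 <= s <= t1 -> w t a <= w s a.
  have [|t] := @EVT_min _ (w^~ a) 0 t1 t10.
    by apply: has_deriv_continuous => // t t0; exact: wD.
  by rewrite in_itv/= => tt h; exists t => // s ss; apply: h; rewrite in_itv.
pose tm a := projT1 (cid2 (amin a)).
have tmE a : 0 <= tm a <= t1 by rewrite /tm; case: (cid2 _).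
have tmP a s : 0 <= s <= t1 -> w (tm a) a <= w s a by rewrite /tm; case: (cid2 _) => /= t _; apply.
have a1F : a1 \in fset_set F by rewrite in_fset_set//; apply/mem_set; apply: (wF t1); rewrite ?t10 ?lexx.
have [a0 a0F a0min] := @seq_argmin _ _ (fun a => w (tm a) a) a1 (enum_fset (fset_set F)) a1F.
set t0 := tm a0.
have wt0 : w t0 a0 < 0.
  by apply: le_lt_trans wa1; apply: (le_trans (a0min _ a1F)); apply: tmP; rewrite t10 lexx.
have glob s a : 0 <= s <= t1 -> w t0 a0 <= w s a.
  move=> ss; have [wa|] := ltP (w s a) 0; last by move=> h; exact: le_trans (ltW wt0) h.
  have aF : a \in fset_set F by rewrite in_fset_set//; apply/mem_set; exact: (wF s).
  exact: le_trans (a0min _ aF) (tmP _ _ ss).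
have /andP[t0_ge0 t0_le] := tmE a0.
have t0_gt0 : 0 < t0.
  rewrite lt_def t0_ge0 andbT; apply/eqP => t00; move: wt0; rewrite /w t00.
  rewrite ltNge addr_ge0 ?u0// !mulr_ge0// ltW//.
have D0 : D t0 a0 + eps * V a0 * (k * E t0) <= 0.
  apply: (has_deriv_min t0_gt0 (wD _ _ t0_ge0)) => s s0 st0; apply: glob.
  by rewrite s0 (le_trans st0).
have gw : 0 <= gen (w t0) a0.
  by apply: sumr_ge0 => m _; rewrite mulr_ge0// subr_ge0 glob// t0_ge0.
have gwE : gen (w t0) a0 = gen (u t0) a0 + eps * E t0 * gen V a0.
  rewrite -genZ -genD; congr (gen _ a0); apply/funext => a.
  by rewrite /w; ring.
have u_neg : u t0 a0 < 0.
  have : 0 <= eps * V a0 * E t0 by rewrite !mulr_ge0// ltW.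
  by move: wt0; rewrite /w; lra.
have := Dgen _ _ t0_ge0 u_neg.
have h1 : eps * E t0 * gen V a0 <= eps * E t0 * (c * V a0) by rewrite ler_wpM2l ?V_gen// mulr_ge0// ltW.
have h2 : 0 < eps * E t0 * V a0 by rewrite !mulr_gt0.
move: D0 gw; rewrite gwE /k; nra.
Qed.

Lemma solves_ge0 u G : (forall K, finite_set [set a | V a <= K * G a]) ->
  solves u -> (forall (t : R) a, 0 <= t -> - G a <= u t a) ->
  (forall a, 0 <= u 0 a) -> forall (t : R) a, 0 <= t -> 0 <= u t a.
Proof. by move=> hG hu hM h0; exact: (@max_principle u (fun t a => gen (u t) a) G). Qed.

(** The difference may be unbounded, provided that V dominates its bound:
    this is what the comparison of fibre means uses. *)
Lemma solves_le_dom u v G : (forall K, finite_set [set a | V a <= K * G a]) ->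
  solves u -> solves v ->
  (forall (t : R) a, 0 <= t -> - G a <= v t a - u t a) ->
  (forall a, u 0 a <= v 0 a) -> forall (t : R) a, 0 <= t -> u t a <= v t a.
Proof.
move=> hG hu hv hM h0 t a t0; rewrite -subr_ge0 -mulN1r.
apply: (@solves_ge0 (fun t a => v t a + (-1) * u t a) G) => //.
- by apply: solvesD => //; exact: solvesZ.
- by move=> s b s0; rewrite mulN1r; exact: hM.
- by move=> b; rewrite mulN1r subr_ge0.
Qed.

Lemma solves_uniq_dom u v G : (forall K, finite_set [set a | V a <= K * G a]) ->
  solves u -> solves v ->
  (forall (t : R) a, 0 <= t -> `|u t a - v t a| <= G a) ->
  (forall a, u 0 a = v 0 a) -> forall (t : R) a, 0 <= t -> u t a = v t a.
Proof.
move=> hG hu hv uv h0 t a t0; apply/eqP; rewrite eq_le.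
apply/andP; split; [apply: (@solves_le_dom u v G)|apply: (@solves_le_dom v u G)] => //.
- by move=> s b s0; have := uv s b s0; rewrite ler_norml; lra.
- by move=> b; rewrite h0.
- by move=> s b s0; have := uv s b s0; rewrite ler_norml; lra.
- by move=> b; rewrite h0.
Qed.

Hypothesis V_fin : forall M, finite_set [set a | V a <= M].

Lemma solves_le u v M : solves u -> solves v ->
  (forall (t : R) a, 0 <= t -> - M <= v t a - u t a) ->
  (forall a, u 0 a <= v 0 a) -> forall (t : R) a, 0 <= t -> u t a <= v t a.
Proof. by apply: (@solves_le_dom u v (fun=> M)) => K; exact: V_fin. Qed.

Lemma solves_uniq u v M : solves u -> solves v ->
  (forall (t : R) a, 0 <= t -> `|u t a| <= M) -> (forall (t : R) a, 0 <= t -> `|v t a| <= M) ->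
  (forall a, u 0 a = v 0 a) -> forall (t : R) a, 0 <= t -> u t a = v t a.
Proof.
move=> hu hv uM vM; apply: (@solves_uniq_dom u v (fun=> M + M)) => // t a t0.
by rewrite (le_trans (ler_normB _ _))// lerD ?uM ?vM.
Qed.

End Lyapunov.
End Generator.

(** * Limits of solutions *)

Lemma cvg_bigsum (R : realType) (I : Type) (s : seq I) (F : nat -> I -> R) (f : I -> R) :
  (forall i, F n i @[n --> \oo] --> f i) ->
  \sum_(i <- s) F n i @[n --> \oo] --> \sum_(i <- s) f i.
Proof.
move=> Ff; elim: s => [|i s IH].
  by rewrite big_nil; under eq_fun do rewrite big_nil; exact: cvg_cst.
by rewrite big_cons; under eq_fun do rewrite big_cons; exact: cvgD.
Qed.

Section ClosureLemma.
Variables (R : realType) (T : countType) (I : eqType) (ms : seq I).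
Variables (r : T -> I -> R) (tgt : T -> I -> T).
Hypothesis r_ge0 : forall a m, 0 <= r a m.
Local Notation gen := (gen ms r tgt).

Lemma cvg_gen (F : nat -> T -> R) (f : T -> R) a :
  (forall b, F n b @[n --> \oo] --> f b) -> gen (F n) a @[n --> \oo] --> gen f a.
Proof.
move=> Ff; rewrite /gen; apply: cvg_bigsum => m.
by apply: cvgMr; apply: cvgB; exact: Ff.
Qed.

Lemma norm_gen_le (f : T -> R) (L : T -> R) a :
  (forall b, `|f b| <= L b) ->
  `|gen f a| <= \sum_(m <- ms) r a m * (L (tgt a m) + L a).
Proof.
move=> fL; apply: (le_trans (ler_norm_sum _ _ _)); apply: ler_sum => m _.
rewrite normrM (ger0_norm (r_ge0 _ _)) ler_wpM2l//.
by rewrite (le_trans (ler_normB _ _))// lerD.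
Qed.

Lemma norm_gen_le_nbr (f : T -> R) (L : T -> R) a :
  (forall b, b \in a :: map (tgt a) ms -> `|f b| <= L b) ->
  `|gen f a| <= \sum_(m <- ms) r a m * (L (tgt a m) + L a).
Proof.
move=> fL; apply: (le_trans (ler_norm_sum _ _ _)).
rewrite [leLHS]big_seq [leRHS]big_seq; apply: ler_sum => m mm.
rewrite normrM (ger0_norm (r_ge0 _ _)) ler_wpM2l//.
rewrite (le_trans (ler_normB _ _))// lerD// fL ?mem_head//.
by rewrite inE map_f ?orbT.
Qed.

(** On states close to a, the rates bound the first time derivatives of U
    n, and then the second ones, uniformly in n. So the remainder of order
    one is bounded by K |s - t|^2 for all n, and this bound survives the
    limit. *)
Lemma closure_solves (U : nat -> R -> T -> R) (u : R -> T -> R) :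
  (forall n (t : R) a, 0 <= t -> `|U n t a| <= 1) ->
  (forall a, exists n0, forall n, (n0 <= n)%N -> forall t : R, 0 <= t ->
     has_deriv (U n ^~ a) t (gen (U n t) a)) ->
  (forall (t : R) a, 0 <= t -> U n t a @[n --> \oo] --> u t a) ->
  solves ms r tgt u.
Proof.
move=> U1 Ud Uu t a t0.
pose n0 b := projT1 (cid (Ud b)).
have n0P b n s : (n0 b <= n)%N -> 0 <= s -> has_deriv (U n ^~ b) s (gen (U n s) b).
  by move=> h s0; rewrite /n0 in h; case: (cid _) h => /= k hk kn; exact: hk.
pose q b := \sum_(m <- ms) r b m * (1 + 1).
have lip b n x y : (n0 b <= n)%N -> 0 <= x -> 0 <= y ->
    `|U n y b - U n x b| <= q b * `|y - x|.
  move=> bn x0 y0; apply: (@has_deriv_mean_value_norm _ (U n ^~ b) (fun s => gen (U n s) b)) => //.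
    by move=> s s0; exact: n0P.
  by move=> s s0 _; apply: (norm_gen_le (L := fun=> 1)) => c; exact: U1.
pose K := \sum_(m <- ms) r a m * (q (tgt a m) + q a).
have q0 b : 0 <= q b by apply: sumr_ge0 => m _; rewrite mulr_ge0// addr_ge0.
have K0 : 0 <= K by apply: sumr_ge0 => m _; rewrite mulr_ge0// addr_ge0.
pose nn := \max_(b <- a :: map (tgt a) ms) n0 b.
have nnP b : b \in a :: map (tgt a) ms -> (n0 b <= nn)%N.
  by move=> h; rewrite /nn; apply: leq_bigmax_seq.
have quad n s : (nn <= n)%N -> 0 <= s ->
    `|U n s a - U n t a - gen (U n t) a * (s - t)| <= K * `|s - t| * `|s - t|.
  move=> hn s0; set d := gen (U n t) a.
  rewrite (_ : _ - _ - _ = (U n s a + (- d) * s) - (U n t a + (- d) * t)); last by ring.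
  apply: (@has_deriv_mean_value_norm _ (fun x => U n x a + (- d) * x) (fun x => gen (U n x) a + (- d) * 1)) => //.
    move=> x x0; apply: has_derivD.
      by apply: n0P => //; rewrite (leq_trans _ hn)// nnP// mem_head.
    by apply: (@has_derivZ _ _ id); apply: is_derive_has_deriv.
  move=> x x0 xt; rewrite mulr1 /d.
  rewrite (_ : _ + - _ = gen (fun b => U n x b + (-1) * U n t b) a); last first.
    by rewrite genD genZ mulN1r.
  apply: (@le_trans _ _ (K * `|x - t|)); last by rewrite ler_wpM2l.
  apply: (le_trans (norm_gen_le_nbr (L := fun b => q b * `|x - t|) _)).
    move=> b hb; rewrite mulN1r; apply: lip => //.
    by rewrite (leq_trans _ hn)// nnP.
  rewrite /K mulr_suml; apply: ler_sum => m _.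
  by rewrite -mulrDl mulrA.
have quadu s : 0 <= s ->
    `|u s a - u t a - gen (u t) a * (s - t)| <= K * `|s - t| * `|s - t|.
  move=> s0.
  have h : `|U n s a - U n t a - gen (U n t) a * (s - t)| @[n --> \oo] -->
      `|u s a - u t a - gen (u t) a * (s - t)|.
    apply: cvg_norm; apply: cvgB; first by apply: cvgB; exact: Uu.
    by apply: cvgMl; apply: cvg_gen => b; exact: Uu.
  apply: (cvgr_to_le h); exists nn => // n /= hn; exact: quad.
move=> e e0; exists (e / (K + 1)); first by rewrite divr_gt0// ltr_wpDl.
move=> s s0 se; apply: (le_trans (quadu s s0)); rewrite ler_wpM2r//.
move: se; rewrite ltr_pdivlMr ?ltr_wpDl// => /ltW; apply: le_trans.
by rewrite mulrDr mulr1 mulrC lerDl.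
Qed.

End ClosureLemma.

(** * The equation truncated to a finite set *)

Section PowerSeries.
Variable R : realType.
Implicit Types (d : nat -> R) (K x t : R).

(** The exponential generating function of the iterates of a bounded
    operator is the exponential of that operator. *)
Definition exp_series d x : R := limn (pseries (fun k => d k / k`!%:R) x).

Lemma exp_series_cvg d K x : 0 <= K -> (forall k, `|d k| <= K ^+ k.+1) ->
  cvgn (pseries (fun k => d k / k`!%:R) x).
Proof.
move=> K0 dK; apply: normed_cvg.
apply: (@series_le_cvg _ _ (fun k => K * exp_coeff (K * `|x|) k)) => [k|k|k|].
- exact: normr_ge0.
- by rewrite mulr_ge0// /exp_coeff/= divr_ge0// exprn_ge0// mulr_ge0.
- rewrite /= /exp_coeff/= normrM normrM normfV (ger0_norm (_ : 0 <= k`!%:R))//.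
  rewrite normrX exprMn [leLHS]mulrAC [leRHS]mulrA ler_wpM2r ?invr_ge0//.
  by rewrite mulrA -exprS ler_wpM2r// exprn_ge0.
- by apply: is_cvg_seriesZ; exact: is_cvg_series_exp_coeff.
Qed.

Lemma exp_series_derive d K t : 0 <= K -> (forall k, `|d k| <= K ^+ k.+1) ->
  is_derive t 1 (exp_series d) (exp_series (fun k => d k.+1) t).
Proof.
move=> K0 dK.
have diffs (e : nat -> R) : pseries_diffs (fun k => e k / k`!%:R) = (fun k => e k.+1 / k`!%:R).
  apply/funext => k; rewrite /pseries_diffs factS natrM; field.
  by rewrite nat1r !pnatr_eq0 -lt0n fact_gt0.
have K1 : 0 <= K + 1 by rewrite addr_ge0.
have d0K k : `|d k| <= (K + 1) ^+ k.+1.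
  by rewrite (le_trans (dK k))// lerXn2r ?nnegrE// lerDl.
have shift (e : nat -> R) C : 1 <= C -> (forall k, `|e k| <= C ^+ k.+1) ->
    forall k, `|e k.+1| <= (C ^+ 2) ^+ k.+1.
  move=> C1 eC k; rewrite (le_trans (eC _))// -exprM ler_weXn2l//.
  by lia.
(* Each derivative shifts the coefficients; squaring the constant restores
   a geometric bound with the same index. *)
have C1 : 1 <= K + 1 by rewrite lerDr.
have C2 : 1 <= (K + 1) ^+ 2 by rewrite exprn_ege1.
pose X := `|t| + 1.
have := @pseries_snd_diffs _ (fun k => d k / k`!%:R) X t.
rewrite !diffs; apply.
- exact: exp_series_cvg K1 d0K.
- by apply: (@exp_series_cvg (fun k => d k.+1) ((K + 1) ^+ 2)); [exact: le_trans C2|exact: shift].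
- apply: (@exp_series_cvg (fun k => d k.+2) (((K + 1) ^+ 2) ^+ 2)).
    by rewrite exprn_ge0// exprn_ge0.
  by apply: (shift (fun k => d k.+1) _ C2); exact: shift.
- by rewrite /X (ger0_norm (_ : 0 <= `|t| + 1)) ?addr_ge0// ltrDl.
Qed.

Lemma exp_series0 d : exp_series d 0 = d 0.
Proof.
apply: lim_near_cst => //; exists 1%N => // -[//|n] _.
rewrite /pseries /= /series/= big_nat_recl//= expr0 mulr1 fact0 divr1 big1 ?addr0//.
by move=> i _; rewrite expr0n/= mulr0.
Qed.

End PowerSeries.

Section Truncation.
Variables (R : realType) (T : countType) (I : eqType) (ms : seq I).
Variables (r : T -> I -> R) (tgt : T -> I -> T).
Hypothesis r_ge0 : forall a m, 0 <= r a m.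
Local Notation gen := (gen ms r tgt).

Variables (F : set T) (f0 : T -> R).
Hypothesis F_fin : finite_set F.
Hypothesis f0_ge0 : forall a, 0 <= f0 a.
Hypothesis f0_le1 : forall a, f0 a <= 1.
Hypothesis f0_out : forall a, ~ F a -> f0 a = 0.

Let q a := \sum_(m <- ms) r a m.
Let K : R := 1 + \sum_(a <- fset_set F) q a.

Let q_ge0 a : 0 <= q a. Proof. exact: sumr_ge0. Qed.

Let K_ge1 : 1 <= K. Proof. by rewrite lerDl sumr_ge0. Qed.

Let K_ge a : F a -> q a <= K.
Proof.
move=> Fa; rewrite /K (bigD1_seq a) ?fset_uniq//=; last first.
  by rewrite in_fset_set//; exact/mem_set.
by rewrite addrCA lerDl addr_ge0// sumr_ge0.
Qed.

Let B (f : T -> R) a : R := if a \in F then gen f a + K * f a else 0.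

Let BE f a : a \in F -> B f a = \sum_(m <- ms) r a m * f (tgt a m) + (K - q a) * f a.
Proof.
move=> aF; rewrite /B aF mulrBl /q mulr_suml /gen.
under eq_bigr do rewrite mulrBr.
by rewrite sumrB; ring.
Qed.

Let c k := iter k B f0.

Let c_bound k a : 0 <= c k a <= K ^+ k.
Proof.
elim: k a => [|k IH] a /=; first by rewrite f0_ge0 f0_le1.
have [aF|aF] := boolP (a \in F); last first.
  by rewrite /B (negPf aF) lexx exprn_ge0// (le_trans ler01).
have Kq : 0 <= K - q a by rewrite subr_ge0 K_ge//; exact/set_mem.
rewrite BE//; apply/andP; split.
  rewrite addr_ge0//; last by rewrite mulr_ge0//; case/andP: (IH a).
  by apply: sumr_ge0 => m _; rewrite mulr_ge0//; case/andP: (IH (tgt a m)).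
apply: (@le_trans _ _ (\sum_(m <- ms) r a m * K ^+ k + (K - q a) * K ^+ k)).
  rewrite lerD//; last by rewrite ler_wpM2l//; case/andP: (IH a).
  by apply: ler_sum => m _; rewrite ler_wpM2l//; case/andP: (IH (tgt a m)).
by rewrite -mulr_suml -/(q a) -mulrDl addrCA subrr addr0 exprS.
Qed.

Let c_out k a : ~ F a -> c k a = 0.
Proof.
case: k => [|k] Fa /=; first exact: f0_out.
by rewrite /B ifF//; apply/negbTE/negP => /set_mem.
Qed.

Let K_ge0 : 0 <= K. Proof. exact: le_trans K_ge1. Qed.

Let cK a k : `|c k a| <= K ^+ k.+1.
Proof.
have /andP[c0 cK] := c_bound k a.
by rewrite ger0_norm// (le_trans cK)// ler_weXn2l.
Qed.

Let S t a := exp_series (c^~ a) t.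

Let cvgS t a : cvgn (pseries (fun k => c k a / k`!%:R) t).
Proof. exact: exp_series_cvg K_ge0 (cK a). Qed.

Let S_derive t a : a \in F -> exp_series (fun k => c k.+1 a) t = gen (S t) a + K * S t a.
Proof.
move=> aF; apply: cvg_lim => //.
have -> : pseries (fun k => c k.+1 a / k`!%:R) t =
    fun n => gen (fun b => pseries (fun k => c k b / k`!%:R) t n) a +
             K * pseries (fun k => c k a / k`!%:R) t n.
  apply/funext => n; rewrite /pseries /series/= gen_sum mulr_sumr -big_split/=.
  apply: eq_bigr => k _; have cS : c k.+1 a = gen (c k) a + K * c k a by rewrite /c /= {1}/B aF.
  rewrite -[X in X / _]/(c k.+1 a) cS.
  rewrite (_ : (fun b => _) = (fun b => (k`!%:R^-1 * t ^+ k) * c k b)); last first.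
    by apply/funext => b; rewrite mulrC mulrA mulrAC mulrC [in RHS]mulrC; ring.
  by rewrite genZ; ring.
apply: cvgD; last by apply: cvgMr; exact: cvgS.
by apply: cvg_gen => b; exact: cvgS.
Qed.

Let S_bound t a : 0 <= t -> 0 <= S t a <= expR (K * t).
Proof.
move=> t0; have h k : 0 <= c k a / k`!%:R * t ^+ k <= exp_coeff (K * t) k.
  have /andP[c0 cKk] := c_bound k a.
  rewrite mulr_ge0 ?exprn_ge0 ?divr_ge0//= /exp_coeff/= exprMn mulrAC.
  by rewrite ler_wpM2r ?invr_ge0// ler_wpM2r ?exprn_ge0.
apply/andP; split.
  apply: limr_ge; first exact: cvgS.
  by near=> n; rewrite /pseries /series/= sumr_ge0// => k _; case/andP: (h k).
rewrite /expR; apply: ler_lim; [exact: cvgS|exact: is_cvg_series_exp_coeff|].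
by near=> n; rewrite /pseries /series/=; apply: ler_sum => k _; case/andP: (h k).
Unshelve. all: by end_near. Qed.

(** Uniformization: with K above all exit rates of the finite set F, the
    operator B = gen + K, cut off outside F, is nonnegative, and e^(- K t)
    \sum_k t^k B^k f0 / k! solves the equation killed outside F. Both
    bounds on u are visible in this series: B is nonnegative and multiplies
    the supremum by at most K. *)
Lemma truncated_solution : exists u : R -> T -> R,
  [/\ forall (t : R) a, 0 <= t -> 0 <= u t a <= 1,
      forall a, u 0 a = f0 a,
      forall (t : R) a, 0 <= t -> ~ F a -> u t a = 0
    & forall (t : R) a, 0 <= t -> F a -> has_deriv (u^~ a) t (gen (u t) a)].
Proof.
exists (fun t a => expR (- K * t) * S t a); split.
- move=> t a t0; have /andP[S0 SK] := S_bound a t0.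
  rewrite mulr_ge0 ?expR_ge0//= mulNr expRN mulrC ler_pdivrMr ?expR_gt0//.
  by rewrite mul1r.
- by move=> a; rewrite mulr0 expR0 mul1r /S exp_series0.
- move=> t a t0 Fa; rewrite /S /exp_series (_ : pseries _ _ = cst 0) ?lim_cst ?mulr0//.
  apply/funext => n; rewrite /pseries /series/= big1// => k _.
  by rewrite c_out// !mul0r.
- move=> t a t0 /mem_set aF.
  have dE : is_derive t 1 (fun s => expR (- K * s)) (- K * expR (- K * t)).
    exact: is_derive_expRM.
  have dS : is_derive t 1 (S^~ a) (gen (S t) a + K * S t a).
    by rewrite -S_derive//; exact: exp_series_derive K_ge0 (cK a).
  apply: is_derive_has_deriv; apply: (is_derive_eq (is_deriveM dE dS)).
  by rewrite genZ -![_ *: _]/(_ * _); ring.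
Qed.

End Truncation.

(** * Existence and stochasticity of the minimal solution *)

Section Regularity.
Variables (R : realType) (T : countType) (I : eqType) (ms : seq I).
Variables (r : T -> I -> R) (tgt : T -> I -> T).
Hypothesis r_ge0 : forall a m, 0 <= r a m.
Local Notation gen := (gen ms r tgt).
Local Notation solves := (solves ms r tgt).

Variables (V : T -> R) (c : R).
Hypothesis V_ge1 : forall a, 1 <= V a.
Hypothesis V_fin : forall M, finite_set [set a | V a <= M].
Hypothesis V_gen : forall a, gen V a <= c * V a.

Let F n : set T := [set a | V a <= n%:R].

Let F_mono m n a : (m <= n)%N -> F m a -> F n a.
Proof. by move=> mn; rewrite /F/= => /le_trans; apply; rewrite ler_nat. Qed.

Let F_exh a : exists n0, forall n, (n0 <= n)%N -> F n a.
Proof.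
exists (Num.bound (V a)) => n hn; apply: (F_mono hn); rewrite /F/= ltW//.
by rewrite archi_boundP// (le_trans ler01).
Qed.

(** The solutions killed outside F n increase with n by the maximum
    principle and are bounded by 1, so they converge; for each state the
    equation holds from some n on, so closure_solves applies to the limit. *)
Lemma exists_solution (b : T) : exists u : R -> T -> R,
  [/\ solves u, forall (t : R) a, 0 <= t -> 0 <= u t a <= 1
    & forall a, u 0 a = (a == b)%:R].
Proof.
pose f n a : R := ((a \in F n) && (a == b))%:R.
have ex n : exists u : R -> T -> R,
  [/\ forall (t : R) a, 0 <= t -> 0 <= u t a <= 1,
      forall a, u 0 a = f n a,
      forall (t : R) a, 0 <= t -> ~ F n a -> u t a = 0
    & forall (t : R) a, 0 <= t -> F n a -> has_deriv (u^~ a) t (gen (u t) a)].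
  apply: truncated_solution => //.
  - exact: V_fin.
  - by move=> a; rewrite /f lern1 leq_b1.
  - move=> a Fa; rewrite /f (_ : a \in F n = false)//.
    by apply/negbTE/negP => /set_mem.
pose U n := projT1 (cid (ex n)).
have U01 n (t : R) a : 0 <= t -> 0 <= U n t a <= 1.
  by rewrite /U; case: (cid _) => u /= [h _ _ _]; exact: h.
have U0 n a : U n 0 a = f n a.
  by rewrite /U; case: (cid _) => u /= [_ h _ _]; exact: h.
have Uout n (t : R) a : 0 <= t -> ~ F n a -> U n t a = 0.
  by rewrite /U; case: (cid _) => u /= [_ _ h _]; exact: h.
have Ud n (t : R) a : 0 <= t -> F n a -> has_deriv (U n ^~ a) t (gen (U n t) a).
  by rewrite /U; case: (cid _) => u /= [_ _ _ h]; exact: h.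
pose D n t a := if a \in F n then gen (U n t) a else 0.
have UD n (t : R) a : 0 <= t -> has_deriv (U n ^~ a) t (D n t a).
  move=> t0; rewrite /D; case: ifPn => [/set_mem|/negP aF]; first exact: Ud.
  have nF : ~ F n a by move=> /mem_set.
  move=> e e0; exists 1 => // s s0 _.
  by rewrite !Uout// mul0r !subrr normr0 mulr_ge0// ltW.
have mono1 n (t : R) a : 0 <= t -> U n t a <= U n.+1 t a.
  move=> t0; rewrite -subr_ge0 -mulN1r.
  apply: (@max_principle _ _ _ ms r tgt r_ge0 V c V_ge1 V_gen
    (fun t a => U n.+1 t a + (-1) * U n t a) (fun t a => D n.+1 t a + (-1) * D n t a) (fun=> 1)) => //.
  - by move=> s x s0; apply: has_derivD; [exact: UD|apply: has_derivZ; exact: UD].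
  - move=> s x s0 neg.
    (* Outside F n the smaller solution vanishes, so the difference is
       nonnegative there. *)
    have Fx : F n x.
      apply: contrapT => nF; move: neg; rewrite [U n s x]Uout// mulr0 addr0 ltNge.
      by case/andP: (U01 n.+1 s x s0) => ->.
    by rewrite /D !mem_set ?genD ?genZ//; exact: F_mono Fx.
  - move=> s x s0; have := U01 n s x s0; have := U01 n.+1 s x s0; lra.
  - move=> x; rewrite mulN1r subr_ge0 !U0 /f ler_nat; case: (x == b); rewrite ?andbF// !andbT.
    have [/set_mem Fx|//] := boolP (x \in F n).
    by rewrite mem_set//; exact: F_mono Fx.
have mono (t : R) a : 0 <= t -> {homo (fun n => U n t a) : m n / (m <= n)%N >-> m <= n}.
  by move=> t0; apply: homo_leq => [//|x y z|n]; [exact: le_trans|exact: mono1].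
have cv (t : R) a : 0 <= t -> cvgn (fun n => U n t a).
  move=> t0; apply: nondecreasing_is_cvgn; first exact: mono.
  by exists 1 => _ [n _ <-]; case/andP: (U01 n t a t0).
exists (fun t a => limn (fun n => U n t a)); split.
- apply: (@closure_solves _ _ _ ms r tgt r_ge0 U) => [n t a t0|a|t a t0].
  + by have /andP[h0 h1] := U01 n t a t0; rewrite ger0_norm.
  + have [n0 h] := F_exh a; exists n0 => n hn t t0.
    by apply: Ud => //; exact: h.
  + exact: cv.
- move=> t a t0; apply/andP; split.
    by apply: limr_ge; [exact: cv|near=> n; case/andP: (U01 n t a t0)].
  by apply: limr_le; [exact: cv|near=> n; case/andP: (U01 n t a t0)].
- move=> a; apply: lim_near_cst => //; have [n0 h] := F_exh a.
  by exists n0 => // n /= hn; rewrite U0 /f mem_set//; exact: h.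
Unshelve. all: by end_near. Qed.

(** Finite partial row sums are bounded solutions with initial value at
    most 1, so they stay below the constant solution 1. *)
Lemma solution_sum_le1 (P : R -> T -> T -> R) (X : seq T) :
  (forall b, solves (fun t a => P t a b)) ->
  (forall (t : R) a b, 0 <= t -> 0 <= P t a b <= 1) ->
  (forall a b, P 0 a b = (a == b)%:R) -> uniq X ->
  forall (t : R) a, 0 <= t -> \sum_(b <- X) P t a b <= 1.
Proof.
move=> Ps P01 P0 uX; apply: (@solves_le _ _ _ ms r tgt r_ge0 V c V_ge1 V_gen V_fin
   (fun t a => \sum_(b <- X) P t a b) (fun _ _ => 1) (size X)%:R).
- by apply: solves_sum => b _.
- exact: solves_cst.
- move=> t a t0; rewrite lerBrDl.
  apply: (@le_trans _ _ 0); last exact: ler01.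
  rewrite subr_le0 (@le_trans _ _ (\sum_(b <- X) 1))//.
    by apply: ler_sum => b _; case/andP: (P01 t a b t0).
  by rewrite big_const_seq count_predT iter_addr addr0.
- move=> a; under eq_bigr do rewrite P0.
  rewrite -natr_sum lern1.
  rewrite (_ : (\sum_(b <- X) (a == b) = (a \in X))%N) ?leq_b1//.
  rewrite -(count_uniq_mem _ uX) -sum1_count [RHS]big_mkcond/=.
  by apply: eq_bigr => b _; rewrite eq_sym; case: (_ == _).
Qed.

(** The full row sum is an increasing limit of bounded solutions, hence a
    bounded solution; it is 1 at time 0, and so is the constant solution.
    No mass escapes by uniqueness. *)
Lemma solution_stochastic (P : R -> T -> T -> R) :
  (forall b, solves (fun t a => P t a b)) ->
  (forall (t : R) a b, 0 <= t -> 0 <= P t a b <= 1) ->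
  (forall a b, P 0 a b = (a == b)%:R) ->
  forall t : R, 0 <= t -> stochastic (P t).
Proof.
move=> Ps P01 P0 t t0 a; split=> [b|]; first by case/andP: (P01 t a b t0).
have P_ge0 s x b : 0 <= s -> 0 <= P s x b by move=> s0; case/andP: (P01 s x b s0).
pose S n s x := \sum_(b <- fset_set (F n)) P s x b.
have S_le1 n (s : R) x : 0 <= s -> S n s x <= 1.
  by move=> s0; apply: solution_sum_le1; rewrite ?fset_uniq.
have S_ge0 n (s : R) x : 0 <= s -> 0 <= S n s x.
  by move=> s0; apply: sumr_ge0 => b _; exact: P_ge0.
have Ffin n : finite_set (F n) by exact: V_fin.
have S_mono (s : R) x : 0 <= s -> {homo (fun n => S n s x) : m n / (m <= n)%N >-> m <= n}.
  move=> s0 m n mn; rewrite /S [leRHS](bigID (mem (fset_set (F m))))/=.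
  rewrite (_ : \sum_(b <- fset_set (F m)) _ =
    \sum_(b <- fset_set (F n) | b \in fset_set (F m)) P s x b).
    by rewrite lerDl; apply: sumr_ge0 => b _; exact: P_ge0.
  rewrite -[RHS]big_filter.
  apply: perm_big; apply: uniq_perm; rewrite ?filter_uniq ?fset_uniq// => b.
  rewrite mem_filter; apply/esym/andb_idr; rewrite !in_fset_set// => /set_mem h.
  by apply/mem_set; exact: F_mono h.
have S_cv (s : R) x : 0 <= s -> cvgn (fun n => S n s x).
  move=> s0; apply: nondecreasing_is_cvgn; first exact: S_mono.
  by exists 1 => _ [n _ <-]; exact: S_le1.
pose h s x := limn (fun n => S n s x).
have h_solves : solves h.
  apply: (@closure_solves _ _ _ ms r tgt r_ge0 S) => [n s x s0|x|s x s0].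
  - by rewrite ger0_norm ?S_ge0 ?S_le1.
  - by exists 0%N => n _ s s0;
    exact: (@solves_sum _ _ _ ms r tgt _ (fset_set (F n)) xpredT (fun b s x => P s x b) (fun b _ => Ps b) s x s0).
  - exact: S_cv.
have h01 (s : R) x : 0 <= s -> `|h s x| <= 1.
  move=> s0; rewrite ger0_norm.
    by apply: limr_le; [exact: S_cv|near=> n; exact: S_le1].
  by apply: limr_ge; [exact: S_cv|near=> n; exact: S_ge0].
have h1 : h t a = 1.
  apply: (@solves_uniq _ _ _ ms r tgt r_ge0 V c V_ge1 V_gen V_fin h (fun _ _ => 1) 1) => //.
  - exact: solves_cst.
  - by move=> *; rewrite normr1.
  - move=> x; apply: lim_near_cst => //; have [n0 hn0] := F_exh x.
    exists n0 => // n /= hn; rewrite /S (bigD1_seq x) ?fset_uniq//=; last first.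
      by rewrite in_fset_set//; apply/mem_set; exact: hn0.
    by rewrite P0 eqxx big1 ?addr0// => b bx; rewrite P0 eq_sym (negPf bx).
apply/eqP; rewrite eq_le; apply/andP; split.
  apply: ge_ereal_sup => _ [X [finX _] <-].
  rewrite fsbig_finite//= sumEFin lee_fin.
  by apply: solution_sum_le1; rewrite ?fset_uniq.
rewrite -h1.
have Se n : ((S n t a)%:E <= \esum_(b in [set: T]) (P t a b)%:E)%E.
  by apply: esum_ge; exists (F n) => //; rewrite fsbig_finite//= sumEFin.
case E : (\esum_(b in [set: T]) (P t a b)%:E)%E => [x| |].
- rewrite lee_fin; apply: limr_le; first exact: S_cv.
  by near=> n; rewrite -lee_fin -E.
- by rewrite leey.
- by have := Se 0%N; rewrite E leeNy_eq.
Unshelve. all: by end_near. Qed.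

End Regularity.

(** * From moves to rate matrices *)

Lemma esum_single (R : realType) (T : choiceType) (D : set T) (y : T) (x : T -> R) :
  (forall c, 0 <= x c) ->
  \esum_(c in D) (if y == c then x c else 0)%:E = (if y \in D then x y else 0)%:E.
Proof.
move=> x0; have [Dy|Dy] := boolP (y \in D); last first.
  rewrite esum1// => c Dc; case: eqP => // yc; move: Dy; rewrite yc => /negP.
  by case; exact/mem_set.
transitivity (\esum_(c in D `&` [set y]) (x c)%:E).
  rewrite esum_mkcondr; apply: eq_esum => c _.
  rewrite (_ : (c \in [set y]) = (y == c)); first by case: ifP.
  by apply/idP/eqP => [/set_mem ->//|->]; exact/mem_set.
rewrite (_ : D `&` [set y] = [set y]) ?esum_set1 ?lee_fin//.
by apply/seteqP; split=> [c []//|c /= ->]; split => //; exact/set_mem.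
Qed.

Section MoveSemigroup.
Variables (R : realType) (T : countType) (I : choiceType) (ms : seq I).
Variables (r : T -> I -> R) (tgt : T -> I -> T).
Hypothesis r_ge0 : forall a m, 0 <= r a m.
Local Notation gen := (gen ms r tgt).
Local Notation solves := (solves ms r tgt).

Variable q : T -> T -> R.
Hypothesis qE : forall a b, a != b ->
  q a b = \sum_(m <- ms) (if tgt a m == b then r a m else 0).

Let Q := with_zero_row_sums q.

(** A row of the matrix has finitely many nonzero entries, which come from
    the moves that change the state; grouping the moves by target turns the
    row sum into a sum over moves. *)
Lemma esum_moves (f : T -> R) a : (forall b, 0 <= f b) ->
  \esum_(b in [set b | b != a]) (q a b * f b)%:E =
  (\sum_(m <- ms) (if tgt a m != a then r a m * f (tgt a m) else 0))%:E.
Proof.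
move=> f0; transitivity (\esum_(b in [set b | b != a])
    (\sum_(m <- ms) (if tgt a m == b then r a m * f b else 0)%:E)%E).
  apply: eq_esum => b /= ba; rewrite sumEFin qE 1?eq_sym// mulr_suml.
  by congr (_%:E); apply: eq_bigr => m _; case: ifP; rewrite ?mul0r.
rewrite esum_sum => [|b m _ _]; last by rewrite lee_fin; case: ifP => // _; rewrite mulr_ge0.
rewrite -sumEFin; apply: eq_bigr => m _.
rewrite esum_single => [|b]; last by rewrite mulr_ge0.
by rewrite (_ : (tgt a m \in _) = (tgt a m != a)) //; apply/idP/idP => [/set_mem//|h]; exact/mem_set.
Qed.

Let q_off a b : a != b -> Q a b = q a b.
Proof. by rewrite /Q /with_zero_row_sums => /negbTE ->. Qed.

Let Q_diag a : Q a a = - \sum_(m <- ms) (if tgt a m != a then r a m else 0).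
Proof.
rewrite /Q /with_zero_row_sums eqxx.
have := @esum_moves (fun=> 1) a (fun=> ler01).
under eq_esum do rewrite mulr1.
by move=> ->/=; under eq_bigr do rewrite mulr1.
Qed.

Let esumQ (f : T -> R) a : (forall b, 0 <= f b) ->
  \esum_(b in [set b | b != a]) (Q a b * f b)%:E =
  (\sum_(m <- ms) (if tgt a m != a then r a m * f (tgt a m) else 0))%:E.
Proof.
move=> f0; rewrite -esum_moves//; apply: eq_esum => b /= ba.
by rewrite q_off 1?eq_sym.
Qed.

Lemma moves_rate_matrix : rate_matrix Q.
Proof.
split=> [a b ab|a].
  rewrite q_off// qE//; apply: sumr_ge0 => m _; case: ifP => // _; exact: r_ge0.
have := @esumQ (fun=> 1) a (fun=> ler01).
under eq_esum do rewrite mulr1.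
by move=> ->; rewrite Q_diag opprK; under eq_bigr do rewrite mulr1.
Qed.

(** Moves with tgt a m = a are absent from the matrix, and they contribute
    0 to gen. *)
Lemma moves_genE (f : T -> R) a : (forall b, 0 <= f b) ->
  ((Q a a * f a)%:E + \esum_(b in [set b | b != a]) (Q a b * f b)%:E)%E = (gen f a)%:E.
Proof.
move=> f0; rewrite esumQ// -EFinD Q_diag mulNr mulr_suml -sumrN -big_split/=.
congr (_%:E); apply: eq_bigr => m _; have [->|_] /= := eqVneq (tgt a m) a.
  by rewrite !(subrr, mul0r, mulr0, oppr0, addr0).
by ring.
Qed.

Lemma moves_backwardP (P : R -> T -> T -> R) :
  backward_solution Q P <->
  [/\ forall (t : R) a b, 0 <= t -> 0 <= P t a b,
      forall a b, P 0 a b = (a == b)%:R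
    & forall b, solves (fun t a => P t a b)].
Proof.
split=> -[P0 Pi Pd]; split => //.
- move=> b t a t0; have [d dP dE] := Pd t a b t0.
  move: dE; rewrite (moves_genE (f := fun c => P t c b)) => [[<-]|c]; last exact: P0.
  exact/has_derivP.
- move=> t a b t0; exists (gen (fun c => P t c b) a).
    by apply/has_derivP; exact: Pd.
  by rewrite (moves_genE (f := fun c => P t c b))// => c; exact: P0.
Qed.

Section Lyapunov.
Variables (V : T -> R) (c : R).
Hypothesis V_ge1 : forall a, 1 <= V a.
Hypothesis V_fin : forall M, finite_set [set a | V a <= M].
Hypothesis V_gen : forall a, gen V a <= c * V a.

Lemma stochastic_le1 (p : T -> T -> R) : stochastic p -> forall a b, 0 <= p a b <= 1.
Proof.
move=> sp a b; have [p0 p1] := sp a; rewrite p0/= -lee_fin -p1.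
by apply: esum_ge; exists [set b] => //; rewrite fsbig_set1.
Qed.

Lemma moves_semigroup_exists : exists P, markov_semigroup_of Q P.
Proof.
have ex b := exists_solution r_ge0 V_ge1 V_fin V_gen b.
pose P (t : R) a b := projT1 (cid (ex b)) t a.
have Ps b : solves (fun t a => P t a b).
  by rewrite /P; case: (cid _) => u /= [h _ _]; exact: h.
have P01 (t : R) a b : 0 <= t -> 0 <= P t a b <= 1.
  by rewrite /P; case: (cid _) => u /= [_ h _]; exact: h.
have P0 a b : P 0 a b = (a == b)%:R.
  by rewrite /P; case: (cid _) => u /= [_ _ h]; exact: h.
exists P; split; last first.
  exact: (solution_stochastic r_ge0 V_ge1 V_fin V_gen Ps P01 P0).
split.
  by apply/moves_backwardP; split => // t a b t0; case/andP: (P01 t a b t0).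
move=> P' /moves_backwardP[P'0 P'i P's] t a b t0.
apply: (@solves_le _ _ _ ms r tgt r_ge0 V c V_ge1 V_gen V_fin
  (fun t a => P t a b) (fun t a => P' t a b) 1) => //.
  move=> s x s0; have := P01 s x b s0; have := P'0 s x b s0; lra.
by move=> x; rewrite P0 P'i.
Qed.

Lemma moves_regular : regular Q.
Proof. by split; [exact: moves_rate_matrix|exact: moves_semigroup_exists]. Qed.

End Lyapunov.

Lemma moves_semigroupP (P : R -> T -> T -> R) : markov_semigroup_of Q P ->
  [/\ forall (t : R) a b, 0 <= t -> 0 <= P t a b <= 1,
      forall a b, P 0 a b = (a == b)%:R
    & forall b, solves (fun t a => P t a b)].
Proof.
move=> [[/moves_backwardP[P0 Pi Ps] _] Pst]; split => // t a b t0.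
exact: stochastic_le1 (Pst t t0) a b.
Qed.

End MoveSemigroup.

(** * Signatures and schemes as arrays of integers *)

Section Signatures.
Variable k : nat.
Implicit Types (x y : signature k) (e : nat -> int).

Lemma sig_ext x y : (forall i, (1 <= i <= k)%N -> part x i = part y i) -> x = y.
Proof.
move=> h; apply/val_inj/val_inj; apply: (@eq_from_nth _ 0); rewrite !size_tuple// => i ik.
exact: (h i.+1).
Qed.

Lemma part_mono x i j : (1 <= i)%N -> (i <= j)%N -> (j <= k)%N -> part x j <= part x i.
Proof.
case: x => p sp i1 ij jk; rewrite /part/=.
apply: (@sorted_leq_nth _ (fun a b : int => b <= a) _ _ 0 p sp).
- by move=> a b c /= h1 h2; exact: le_trans h2 h1.
- by move=> a /=.
- by rewrite inE size_tuple; lia.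
- by rewrite inE size_tuple; lia.
- by lia.
Qed.

(** The zero signature is a junk value, returned when e is not monotone. *)
Definition mk_signature e : signature k :=
  insubd (zero_signature k) (mktuple (fun i : 'I_k => e i.+1)).

Lemma part_mk_signature e i : (forall i, (1 <= i)%N -> (i < k)%N -> e i.+1 <= e i) ->
  (1 <= i)%N -> (i <= k)%N -> part (mk_signature e) i = e i.
Proof.
move=> he i1 ik; have nthe j : (j < k)%N -> nth 0 (mktuple (fun i : 'I_k => e i.+1)) j = e j.+1.
  by move=> jk; rewrite -[j]/(val (Ordinal jk)) -tnth_nth tnth_mktuple.
rewrite /part /mk_signature -[parts _]/(val _) insubdK.
  by case: i i1 ik => // i _ ik; rewrite nthe.
apply/(sortedP 0) => j; rewrite size_tuple => jk.
by rewrite !nthe ?he//; lia.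
Qed.

End Signatures.

Section Schemes.
Variable N : nat.
Implicit Types (s : scheme N) (e : nat -> nat -> int).

Definition interlacing e := forall k i, (1 <= i)%N -> (i <= k)%N -> (k < N)%N ->
  e k.+1 i.+1 <= e k i <= e k.+1 i.

Lemma entries_interlacing s : interlacing (entry s).
Proof.
move=> k i i1 ik kN; case: s => rw hrw; rewrite /entry /level/=.
have /implyP/(_ _)/forallP := forallP hrw (Ordinal kN).
rewrite /= => /(_ (leq_trans i1 ik)).
have ik' : (i.-1 < k)%N by lia.
move=> /(_ (Ordinal ik')) /=.
by rewrite (_ : i.-1.+2 = i.+1) 1?(_ : i.-1.+1 = i)//; lia.
Qed.

Lemma row_levelE (rw : rows N) k (kN : (k < N)%N) : row_level rw k.+1 = rw (Ordinal kN).
Proof.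
rewrite /row_level; case: decP => [h|//]; by rewrite (bool_irrelevance h kN).
Qed.

Lemma scheme_ext s s' :
  (forall k i, (1 <= i)%N -> (i <= k)%N -> (k <= N)%N -> entry s k i = entry s' k i) -> s = s'.
Proof.
move=> h; apply: val_inj; apply/ffunP => -[k kN].
apply: sig_ext => i /andP[i1 ik]; have := h k.+1 i i1 ik kN.
by rewrite /entry /level !row_levelE.
Qed.

(** The scheme s0 is a junk value, returned when e is not interlacing. *)
Definition mk_scheme (s0 : scheme N) e : scheme N :=
  insubd s0 (finfun (fun k : 'I_N => mk_signature k.+1 (e k.+1)) : rows N).

Lemma interlacing_row e k i : interlacing e -> (1 <= i)%N -> (i < k)%N -> (k <= N)%N -> e k i.+1 <= e k i.
Proof.
case: k => // k he i1 ik kN; have /andP[] := he k i i1 ik kN; exact: le_trans.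
Qed.

Lemma entry_mk_scheme s0 e k i : interlacing e -> (1 <= i)%N -> (i <= k)%N -> (k <= N)%N ->
  entry (mk_scheme s0 e) k i = e k i.
Proof.
move=> he i1 ik kN; rewrite /entry /level /mk_scheme -[scheme_rows _]/(val _).
have rowE j m : (1 <= m)%N -> (m <= j)%N -> (j <= N)%N ->
  part (row_level (finfun (fun k : 'I_N => mk_signature k.+1 (e k.+1)) : rows N) j) m = e j m.
  case: j => [|j] m1 mj jN; first by lia.
  rewrite row_levelE ffunE part_mk_signature// => a a1 aj.
  exact: interlacing_row.
rewrite insubdK ?rowE//.
apply/forallP => -[j jN]; apply/implyP => /= j0; apply/forallP => -[a aj] /=.
rewrite !rowE//; [exact: he|lia..].
Qed.

Lemma entry_col_mono s i j l : (1 <= i)%N -> (i <= j)%N -> (j <= l)%N -> (l <= N)%N ->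
  entry s j i <= entry s l i.
Proof.
move=> i1 ij; elim: l => [|l IH] jl lN; first by have -> : j = 0%N by lia.
move: jl; rewrite leq_eqVlt => /predU1P[->//|jl].
apply: le_trans (IH _ _) _; [lia|lia|].
have il : (i <= l)%N by lia.
by case/andP: (entries_interlacing s i1 il lN).
Qed.

Lemma entry_diag_mono s i j d : (1 <= i)%N -> (i <= j)%N -> (j + d <= N)%N ->
  entry s (j + d) (i + d) <= entry s j i.
Proof.
move=> i1 ij; elim: d => [|d IH] dN; first by rewrite !addn0.
apply: le_trans (IH _); last by lia.
rewrite !addnS.
have h1 : (1 <= i + d)%N by lia.
have h2 : (i + d <= j + d)%N by lia.
have h3 : (j + d < N)%N by lia.
by case/andP: (entries_interlacing s h1 h2 h3).
Qed.

Lemma level_ext s (x : signature N) :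
  (forall i, (1 <= i)%N -> (i <= N)%N -> entry s N i = part x i) -> level s N = x.
Proof. by move=> h; apply: sig_ext => i /andP[i1 iN]; exact: h. Qed.

End Schemes.

(** Bounded integer coordinates, shifted to be nonnegative, are digits, and
    there are finitely many words of bounded digits. *)
Lemma finite_set_bounded (T : choiceType) (J : finType) (f : T -> J -> int) (A : set T) (M : nat) :
  (forall x j, A x -> (`|f x j| <= M)%N) ->
  (forall x y, A x -> A y -> (forall j, f x j = f y j) -> x = y) ->
  finite_set A.
Proof.
move=> fM finj.
pose g (x : T) : {ffun J -> 'I_(M + M).+1} := [ffun j => inord (absz (f x j + M%:Z))].
have ginj : {in A &, injective g}.
  move=> x y /set_mem Ax /set_mem Ay /ffunP gxy; apply: finj => // j.
  have := congr1 val (gxy j); rewrite !ffunE /=.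
  have := fM x j Ax; have := fM y j Ay => h1 h2.
  by rewrite !inordK; lia.
by rewrite -(eq_finite_set (inj_card_eq ginj)); exact: finite_finset.
Qed.

Lemma finite_signatures N (M : nat) :
  finite_set [set x : signature N | forall i, (1 <= i)%N -> (i <= N)%N -> (`|part x i| <= M)%N].
Proof.
apply: (@finite_set_bounded _ _ (fun x (i : 'I_N) => part x i.+1) _ M) => [x i h|x y _ _ h].
  by apply: h.
apply: sig_ext => -[//|i] /andP[_ iN]; exact: h (Ordinal iN).
Qed.

Lemma finite_schemes N (M : nat) :
  finite_set [set s : scheme N | forall k i, (1 <= i)%N -> (i <= k)%N -> (k <= N)%N ->
    (`|entry s k i| <= M)%N].
Proof.
apply: (@finite_set_bounded _ _
  (fun s (p : 'I_N * 'I_N) => if (p.2 <= p.1)%N then entry s p.1.+1 p.2.+1 else 0) _ M) => [s [k i] h|s s' _ _ h] /=.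
  by case: ifP => // ik; exact: h.
apply: scheme_ext => -[|k] [|i]// i1 ik kN.
have iN : (i < N)%N by lia.
have := h (Ordinal kN, Ordinal iN) => /=.
by rewrite -ltnS ik.
Qed.

(** * Right moves *)

Lemma sum_bij (W : nmodType) (X Y : eqType) (A : seq X) (B : seq Y) (P : pred X) (Q : pred Y)
    (h : X -> Y) (F : X -> W) (G : Y -> W) : uniq A -> uniq B ->
  (forall x, x \in A -> P x -> [/\ h x \in B, Q (h x) & F x = G (h x)]) ->
  (forall x y, x \in A -> y \in A -> P x -> P y -> h x = h y -> x = y) ->
  (forall y, y \in B -> Q y -> exists x, [/\ x \in A, P x & h x = y]) ->
  \sum_(x <- A | P x) F x = \sum_(y <- B | Q y) G y.
Proof.
move=> uA uB h1 h2 h3.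
have -> : \sum_(x <- A | P x) F x = \sum_(y <- map h (seq.filter P A)) G y.
  rewrite big_map -[LHS]big_filter; apply: eq_big_seq => x.
  by rewrite mem_filter => /andP[Px xA]; have [] := h1 x xA Px.
rewrite -[RHS]big_filter; apply: perm_big; apply: uniq_perm.
- rewrite map_inj_in_uniq ?filter_uniq// => x y.
  by rewrite !mem_filter => /andP[Px xA] /andP[Py yA]; exact: h2.
- exact: filter_uniq.
move=> y; rewrite mem_filter; apply/mapP/andP => [[x]|[Qy yB]].
  by rewrite mem_filter => /andP[Px xA] ->; have [] := h1 x xA Px.
have [x [xA Px <-]] := h3 y yB Qy; exists x => //.
by rewrite mem_filter Px.
Qed.

Section RightMoves.
Variable N : nat.
Implicit Types (s : scheme N) (k i : nat).

(** Characterizes the maximum that defines right_reach: equality holds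
    along the column up to l and fails just above. *)
Lemma right_reach_eq s k i l : (k <= l)%N -> (l <= N)%N ->
  (forall j, (k <= j)%N -> (j <= l)%N -> entry s j i = entry s k i) ->
  ((l < N)%N -> entry s l.+1 i <> entry s k i) -> right_reach s k i = l.
Proof.
move=> kl lN hl hS; apply/eqP; rewrite eqn_leq; apply/andP; split.
  rewrite /right_reach big_seq_cond; apply/bigmax_leqP_seq => l' _.
  rewrite mem_index_iota => /andP[/andP[kl' l'N] /allP hall].
  rewrite leqNgt; apply/negP => ll'.
  have lN' : (l < N)%N by lia.
  apply: (hS lN'); apply/eqP; apply: hall; rewrite mem_index_iota; lia.
apply: (@leq_bigmax_seq _ _ _ (fun l => l)).
  by rewrite mem_index_iota; lia.
apply/allP => j; rewrite mem_index_iota => /andP[kj jl].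
by apply/eqP; apply: hl.
Qed.

Lemma right_reachP s k i : (k <= N)%N ->
  [/\ (k <= right_reach s k i)%N, (right_reach s k i <= N)%N,
    forall j, (k <= j)%N -> (j <= right_reach s k i)%N -> entry s j i = entry s k i
  & (right_reach s k i < N)%N -> entry s (right_reach s k i).+1 i <> entry s k i].
Proof.
move=> kN.
pose P l := [&& (k <= l)%N, (l <= N)%N &
  all (fun j => entry s j i == entry s k i) (index_iota k l.+1)].
have exP : exists l, P l.
  exists k; rewrite /P leqnn kN; apply/allP => j; rewrite mem_index_iota => h.
  by have -> : j = k by lia.
have ub l : P l -> (l <= N)%N by case/and3P.
case: (ex_maxnP exP ub) => l /and3P[kl lN /allP hall] lmax.
have hj j : (k <= j)%N -> (j <= l)%N -> entry s j i = entry s k i.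
  by move=> kj jl; apply/eqP; apply: hall; rewrite mem_index_iota kj ltnS.
have hS : (l < N)%N -> entry s l.+1 i <> entry s k i.
  move=> lN' eqS; have : P l.+1.
    rewrite /P lN' leqW//=; apply/allP => j; rewrite mem_index_iota => /andP[kj].
    rewrite ltnS leq_eqVlt ltnS => /predU1P[->|jl]; apply/eqP => //.
    exact: hj.
  by move/lmax; rewrite ltnn.
by rewrite (right_reach_eq kl lN hj hS).
Qed.

Definition right_entry s k i (j m : nat) : int :=
  entry s j m + if (k <= j <= right_reach s k i)%N && (m == i) then 1 else 0.

Definition right_target s k i : scheme N := mk_scheme s (right_entry s k i).

(** In its column the raised run stays below the entry on the next level,
    which is strictly larger because the run is maximal. In column i - 1
    the entries increase with the level, and the first of them exceeds the
    run strictly because the jump is not blocked. *)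
Lemma right_entry_interlacing s k i : (1 <= i)%N -> (i <= k)%N -> (k <= N)%N ->
  ~~ right_blocked s k i -> interlacing N (right_entry s k i).
Proof.
move=> i1 ik kN nb j m m1 mj jN; rewrite /right_entry.
have [kL LN eqL neqL] := right_reachP s i kN.
set L := right_reach s k i in kL LN eqL neqL *.
have /andP[g1 g2] := entries_interlacing s m1 mj jN.
apply/andP; split.
  case: ifP => [/andP[/andP[kj jL] /eqP mi]|_]; last first.
    by case: ifP => _; lia.
  rewrite ifF; last by apply/negbTE; rewrite negb_and; apply/orP; right; lia.
  rewrite addr0.
  have eqk : entry s j.+1 m.+1 = entry s k i by rewrite mi; apply: eqL.
  have m1k : (m <= k.-1)%N by lia.
  have h1 : entry s k.-1 m <= entry s j m by apply: entry_col_mono => //; lia.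
  have h2 : entry s k i <= entry s k.-1 m.
    have := @entries_interlacing N s k.-1 m m1 m1k; rewrite mi prednK; last by lia.
    by move=> /(_ kN)/andP[].
  move: nb; rewrite /right_blocked (_ : (1 < i)%N) /=; last by lia.
  rewrite (_ : i.-1 = m); last by lia.
  by move/eqP => h3; lia.
case: ifP => [/andP[/andP[kj jL] /eqP mi]|_]; last by case: ifP => _; lia.
case: ifP => [_|]; first by lia.
rewrite mi eqxx andbT => /negbT h.
have jL' : j = L by lia.
rewrite addr0; subst m j.
have := neqL jN; have := eqL L kL (leqnn _); lia.
Qed.

Lemma entry_right_target s k i j m : (1 <= i)%N -> (i <= k)%N -> (k <= N)%N ->
  ~~ right_blocked s k i -> (1 <= m)%N -> (m <= j)%N -> (j <= N)%N ->
  entry (right_target s k i) j m = right_entry s k i j m.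
Proof. by move=> i1 ik kN nb m1 mj jN; apply: entry_mk_scheme => //; exact: right_entry_interlacing. Qed.

Lemma right_moveP s k i s' : (1 <= k)%N -> 
  reflect (~~ right_blocked s k i /\
    forall j m, (1 <= m)%N -> (m <= j)%N -> (j <= N)%N -> entry s' j m = right_entry s k i j m)
  (right_move s k i s').
Proof.
move=> k1; apply: (iffP andP) => -[nb h]; split => //.
  move=> j m m1 mj jN.
  have hj : j \in iota 1 N by rewrite mem_iota; lia.
  have hm : m \in iota 1 j by rewrite mem_iota; lia.
  exact/eqP/(allP (allP h j hj) m hm).
apply/allP => j; rewrite mem_iota => hj; apply/allP => m; rewrite mem_iota => hm.
by apply/eqP; apply: h; lia.
Qed.

Lemma right_moveE s k i s' : (1 <= i)%N -> (i <= k)%N -> (k <= N)%N ->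
  right_move s k i s' = ~~ right_blocked s k i && (right_target s k i == s').
Proof.
move=> i1 ik kN; have k1 : (1 <= k)%N by lia.
apply/(right_moveP s i s' k1)/andP => -[nb h]; split => //.
  apply/eqP/scheme_ext => j m m1 mj jN.
  by rewrite entry_right_target// h.
by move=> j m m1 mj jN; rewrite -(eqP h) entry_right_target.
Qed.

End RightMoves.

(** * Predecessors under right moves *)

Section Predecessor.
Variable N : nat.
Implicit Types (s : scheme N) (k l i : nat).

Let left_entry s k l i (j m : nat) : int :=
  entry s j m - if (k <= j <= l)%N && (m == i) then 1 else 0.

(** To undo a right move of index i whose last pushed level is l, lower by
    1 the maximal run of entries equal to entry s l i that ends at level l.
    The hypotheses say that the lowered array interlaces with what lies
    above: on level l + 1, or, for l = N, within the top row. *)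
Lemma right_predecessor s l i : (1 <= i)%N -> (i <= l)%N -> (l <= N)%N ->
  ((l < N)%N -> entry s l.+1 i.+1 < entry s l i) ->
  (l = N -> (i < l)%N -> entry s l i.+1 < entry s l i) ->
  exists k s', [/\ (i <= k)%N && (k <= l)%N, ~~ right_blocked s' k i,
    right_target s' k i = s & right_reach s' k i = l].
Proof.
move=> i1 il lN hl hN.
pose P k := (i <= k)%N && (k <= l)%N &&
  all (fun j => entry s j i == entry s l i) (index_iota k l.+1).
have exP : exists k, P k.
  exists l; rewrite /P il leqnn; apply/allP => j; rewrite mem_index_iota => h.
  by have -> : j = l by lia.
case: (ex_minnP exP) => k /andP[/andP[ik kl] /allP hall] kmin.
have hj j : (k <= j)%N -> (j <= l)%N -> entry s j i = entry s l i.
  by move=> kj jl; apply/eqP; apply: hall; rewrite mem_index_iota kj ltnS.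
have hk : (i < k)%N -> entry s k.-1 i < entry s l i.
  move=> ik'; rewrite lt_neqAle entry_col_mono ?andbT//; [|lia|lia].
  apply/eqP => e; have : P k.-1.
    rewrite /P; apply/andP; split; first by lia.
    apply/allP => j; rewrite mem_index_iota => /andP[kj jl].
    have [jk|jk] := leqP k j; first by rewrite hj.
    by rewrite (_ : j = k.-1) ?e//; lia.
  by move/kmin; lia.
have he : interlacing N (left_entry s k l i).
  move=> j m m1 mj jN; rewrite /left_entry.
  have /andP[g1 g2] := entries_interlacing s m1 mj jN.
  apply/andP; split.
    case: (ifP ((k <= j <= l)%N && (m == i))) => [/andP[/andP[kj jl] /eqP mi]|_]; last first.
      by case: ifP => _; lia.
    rewrite ifF; last by apply/negbTE; rewrite negb_and; apply/orP; right; lia.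
    subst m; rewrite subr0 hj//.
    have [lN'|lN'] := ltnP l N.
      have := hl lN'; have := @entry_diag_mono N s i.+1 j.+1 0.
      have : entry s j.+1 i.+1 <= entry s l.+1 i.+1 by apply: entry_col_mono; lia.
      by lia.
    have lE : l = N by lia.
    have := hN lE; have : entry s j.+1 i.+1 <= entry s l i.+1 by apply: entry_col_mono; lia.
    by lia.
  case: (ifP ((k <= j.+1 <= l)%N && (m == i))) => [/andP[/andP[kj jl] /eqP mi]|_]; last first.
    by case: ifP => _; lia.
  case: ifP => [_|]; first by lia.
  rewrite mi eqxx andbT => /negbT h; subst m.
  have jE : j = k.-1 by lia.
  have := hk; rewrite -jE (hj j.+1)//; lia.
pose s' := mk_scheme s (left_entry s k l i).
have sE j m : (1 <= m)%N -> (m <= j)%N -> (j <= N)%N -> entry s' j m = left_entry s k l i j m.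
  by move=> m1 mj jN; apply: entry_mk_scheme.
have kN : (k <= N)%N by lia.
have s'run j : (k <= j)%N -> (j <= l)%N -> entry s' j i = entry s l i - 1.
  by move=> kj jl; rewrite sE//; [rewrite /left_entry hj// kj jl eqxx|lia|lia].
have reachE : right_reach s' k i = l.
  apply: right_reach_eq => //; first by move=> j kj jl; rewrite !s'run.
  move=> lN'; rewrite (s'run k)// sE//; last by lia.
  rewrite /left_entry ifF ?subr0; last by lia.
  have : entry s l i <= entry s l.+1 i by apply: entry_col_mono; lia.
  by lia.
have nb : ~~ right_blocked s' k i.
  rewrite /right_blocked; have [i2|//] := ltnP 1 i.
  rewrite /= (s'run k)// sE; [|lia|lia|lia].
  rewrite /left_entry ifF ?subr0; last by lia.
  have g1 : (1 <= i.-1)%N by lia.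
  have g2 : (i.-1 <= k.-1)%N by lia.
  have g3 : (k.-1 < N)%N by lia.
  have /andP[h _] := entries_interlacing s g1 g2 g3; move: h.
  have -> : i.-1.+1 = i by lia.
  have -> : k.-1.+1 = k by lia.
  rewrite (hj k)// => h; apply/eqP; lia.
exists k, s'; split => //; first by rewrite ik kl.
apply: scheme_ext => j m m1 mj jN.
rewrite entry_right_target//.
rewrite /right_entry reachE sE// /left_entry subrK//.
Qed.

(** The index and the last pushed level determine the move and its source:
    if two moves to the same scheme started at levels k1 < k2, then the
    levels k2 - 1 and k2 would both lie in the first run, so the target has
    equal entries there; but the second source has the target's entry at
    level k2 - 1 and one less at level k2, against monotonicity of its
    column. *)
Lemma right_target_inj s1 s2 k1 k2 i : (1 <= i)%N -> (i <= k1)%N -> (k1 <= N)%N ->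
  (i <= k2)%N -> (k2 <= N)%N -> ~~ right_blocked s1 k1 i -> ~~ right_blocked s2 k2 i ->
  right_target s1 k1 i = right_target s2 k2 i -> right_reach s1 k1 i = right_reach s2 k2 i ->
  k1 = k2 /\ s1 = s2.
Proof.
move=> i1 ik1 k1N ik2 k2N nb1 nb2 eqT eqL.
have eqe j m : (1 <= m)%N -> (m <= j)%N -> (j <= N)%N ->
    right_entry s1 k1 i j m = right_entry s2 k2 i j m.
  by move=> m1 mj jN; rewrite -entry_right_target// eqT entry_right_target.
have kk : k1 = k2.
  wlog : s1 s2 k1 k2 ik1 k1N ik2 k2N nb1 nb2 eqT eqL eqe / (k1 <= k2)%N.
    move=> W; have [h|h] := leqP k1 k2; first by apply: (W s1 s2).
    by apply/esym; apply: (W s2 s1); rewrite ?(ltnW h)//; move=> j m *; apply/esym; exact: eqe.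
  rewrite leq_eqVlt => /predU1P[//|k12]; exfalso.
  have [kL1 LN1 eqL1 _] := right_reachP s1 i k1N.
  have [kL2 LN2 eqL2 _] := right_reachP s2 i k2N.
  have e1 : right_entry s1 k1 i k2.-1 i = right_entry s2 k2 i k2.-1 i by apply: eqe; lia.
  have e2 : right_entry s1 k1 i k2 i = right_entry s2 k2 i k2 i by apply: eqe; lia.
  move: e1 e2; rewrite /right_entry eqxx !andbT -eqL.
  rewrite -eqL in kL2 eqL2 *.
  set L := right_reach s1 k1 i in kL1 LN1 eqL1 kL2 eqL2 *.
  rewrite ifT; last by lia.
  rewrite ifF; last by lia.
  rewrite ifT; last by lia.
  rewrite ifT; last by lia.
  have h1 : entry s1 k2 i = entry s1 k1 i by apply: eqL1; lia.
  have h2 : entry s1 k2.-1 i = entry s1 k1 i by apply: eqL1; lia.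
  have h3 : entry s2 k2.-1 i <= entry s2 k2 i by apply: entry_col_mono; lia.
  by rewrite /=; lia.
split=> //; subst k2; apply: scheme_ext => j m m1 mj jN.
have := eqe j m m1 mj jN; rewrite /right_entry eqL; lia.
Qed.

End Predecessor.

(** * Reflection and fibres *)

Section Reflection.
Variable N : nat.
Implicit Types (s : scheme N) (x : signature N) (k i : nat).

(** Negation reverses the order, so the indices of each row are reversed as
    well. *)
Definition reflect_scheme s : scheme N := mk_scheme s (fun k i => - entry s k (k.+1 - i)%N).

Definition reflect_sig x : signature N := mk_signature N (fun i => - part x (N.+1 - i)%N).

Lemma entry_reflect_scheme s k i : (1 <= i)%N -> (i <= k)%N -> (k <= N)%N ->
  entry (reflect_scheme s) k i = - entry s k (k.+1 - i)%N.
Proof.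
move=> i1 ik kN; apply: entry_mk_scheme => // j m m1 mj jN.
have h1 : (1 <= j.+1 - m)%N by lia.
have h2 : (j.+1 - m <= j)%N by lia.
have := entries_interlacing s h1 h2 jN.
rewrite !lerN2 andbC (_ : j.+2 - m = (j.+1 - m).+1)%N; last by lia.
by rewrite subSS.
Qed.

Lemma part_reflect_sig x i : (1 <= i)%N -> (i <= N)%N -> part (reflect_sig x) i = - part x (N.+1 - i)%N.
Proof.
move=> i1 iN; apply: part_mk_signature => // j j1 jN.
by rewrite lerN2; apply: part_mono; lia.
Qed.

Lemma reflect_schemeK : involutive reflect_scheme.
Proof.
move=> s; apply: scheme_ext => k i i1 ik kN.
rewrite !entry_reflect_scheme ?opprK//; [|lia|lia].
by congr (entry s k _); lia.
Qed.

Lemma reflect_sigK : involutive reflect_sig.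
Proof.
move=> x; apply: sig_ext => i /andP[i1 iN].
rewrite !part_reflect_sig ?opprK//; [|lia|lia].
by congr (part x _); lia.
Qed.

Lemma level_reflect_scheme s : level (reflect_scheme s) N = reflect_sig (level s N).
Proof. by apply: level_ext => i i1 iN; rewrite entry_reflect_scheme// part_reflect_sig. Qed.

Lemma left_blockedE s k i : (1 <= i)%N -> (i <= k)%N -> (k <= N)%N ->
  left_blocked s k i = right_blocked (reflect_scheme s) k (k.+1 - i)%N.
Proof.
move=> i1 ik kN; rewrite /left_blocked /right_blocked.
have [ik'|ik'] := ltnP i k; last by rewrite [X in _ = X && _](_ : _ = false)//; lia.
rewrite [X in _ = X && _](_ : _ = true)/=; last by lia.
rewrite !entry_reflect_scheme; [|lia..].
rewrite eqr_opp (_ : k.+1 - (k.+1 - i) = i)%N; last by lia.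
by rewrite (_ : k.-1.+1 - (k.+1 - i).-1 = i)%N//; lia.
Qed.

Lemma left_reachE s k i : (1 <= i)%N -> (i <= k)%N -> (k <= N)%N ->
  left_reach s k i = right_reach (reflect_scheme s) k (k.+1 - i)%N.
Proof.
move=> i1 ik kN; rewrite /left_reach /right_reach.
rewrite big_seq_cond [RHS]big_seq_cond; apply: eq_bigl => l.
rewrite mem_index_iota; case: (boolP ((k <= l)%N && _)) => //= /andP[kl lN].
apply: eq_in_all => j; rewrite mem_index_iota => /andP[kj jl].
rewrite !entry_reflect_scheme; [|lia..].
rewrite eqr_opp; congr (entry s _ _ == entry s _ _); lia.
Qed.

(** Left jumps push along diagonals, which reflection exchanges with
    columns. *)
Lemma left_moveE s k i s' : (1 <= i)%N -> (i <= k)%N -> (k <= N)%N ->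
  left_move s k i s' = ~~ right_blocked (reflect_scheme s) k (k.+1 - i)%N &&
    (reflect_scheme (right_target (reflect_scheme s) k (k.+1 - i)%N) == s').
Proof.
move=> i1 ik kN.
have i'1 : (1 <= k.+1 - i)%N by lia.
have i'k : (k.+1 - i <= k)%N by lia.
have k1 : (1 <= k)%N by lia.
rewrite (can2_eq reflect_schemeK reflect_schemeK) -right_moveE// /left_move left_blockedE//.
apply/andP/(right_moveP _ _ _ k1) => -[nb h]; split => //.
  move=> j m m1 mj jN.
  have hj : j \in iota 1 N by rewrite mem_iota; lia.
  have hm : (j.+1 - m)%N \in iota 1 j by rewrite mem_iota; lia.
  have := eqP (allP (allP h j hj) _ hm).
  rewrite /right_entry !entry_reflect_scheme// left_reachE// => ->.
  rewrite opprB addrC; congr (_ + _); case: ifP => h1; case: ifP => h2 //; lia.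
apply/allP => j; rewrite mem_iota => hj; apply/allP => m; rewrite mem_iota => hm.
have := h j (j.+1 - m)%N; rewrite /right_entry !entry_reflect_scheme; [|lia..].
rewrite (_ : j.+1 - (j.+1 - m) = m)%N; last by lia.
rewrite left_reachE// => h'; apply/eqP.
have {}h' : - entry s' j m = - entry s j m + (if (k <= j <= right_reach (reflect_scheme s) k (k.+1 - i))%N && ((j.+1 - m)%N == (k.+1 - i)%N) then 1 else 0).
  by apply: h'; lia.
apply: oppr_inj; rewrite h' opprB addrC; congr (_ + _).
by case: ifP => h1; case: ifP => h2 //; lia.
Qed.

End Reflection.

Section Fibres.
Variable N : nat.
Implicit Types (s : scheme N) (x : signature N).

(** Interlacing confines all entries between the extreme parts of the top
    row. *)
Lemma finite_fibre x : finite_set [set s : scheme N | level s N = x].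
Proof.
apply: (@sub_finite_set _ _ [set s : scheme N | forall k i, (1 <= i)%N -> (i <= k)%N -> (k <= N)%N ->
    (`|entry s k i| <= \max_(1 <= j < N.+1) absz (part x j))%N]); last exact: finite_schemes.
move=> s /= sx k i i1 ik kN.
have b j : (1 <= j)%N -> (j <= N)%N -> (`|part x j| <= \max_(1 <= j < N.+1) absz (part x j))%N.
  by move=> j1 jN; apply: (@leq_bigmax_seq _ _ _ (fun j => absz (part x j))); rewrite ?mem_index_iota ?j1 ?ltnS.
have h1 : entry s k i <= part x i by rewrite -sx; apply: entry_col_mono.
have h2 : part x (i + (N - k)) <= entry s k i.
  have := @entry_diag_mono N s i k (N - k); rewrite subnKC// /entry sx; apply; lia.
have := b i; have := b (i + (N - k))%N; lia.
Qed.

Definition fibre x : seq (scheme N) := fset_set [set s : scheme N | level s N = x].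

Lemma mem_fibre x s : (s \in fibre x) = (level s N == x).
Proof.
rewrite /fibre in_fset_set; last exact: finite_fibre.
by apply/idP/eqP => [/set_mem//|h]; exact/mem_set.
Qed.

Lemma fibre_uniq x : uniq (fibre x).
Proof. exact: fset_uniq. Qed.

Lemma sum_fibre_reflect (W : nmodType) x (f : scheme N -> W) :
  \sum_(s <- fibre (reflect_sig x)) f s = \sum_(s <- fibre x) f (reflect_scheme s).
Proof.
symmetry; apply: (sum_bij (h := @reflect_scheme N)) => [||s|s s'|s].
- exact: fibre_uniq.
- exact: fibre_uniq.
- by rewrite !mem_fibre level_reflect_scheme => /eqP-> _.
- by move=> _ _ _ _; exact: (can_inj (@reflect_schemeK N)).
- rewrite mem_fibre => /eqP sx _; exists (reflect_scheme s); rewrite reflect_schemeK; split => //.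
  by rewrite mem_fibre level_reflect_scheme sx reflect_sigK.
Qed.

End Fibres.

(** * Balance of right moves over a fibre *)

Definition triangle N : seq (nat * nat) :=
  [seq (k, i) | k <- index_iota 1 N.+1, i <- index_iota 1 k.+1].

Lemma mem_triangle N k i : ((k, i) \in triangle N) = [&& (1 <= i)%N, (i <= k)%N & (k <= N)%N].
Proof.
apply/allpairsPdep/and3P => [[k' [i' [hk hi [-> ->]]]]|[i1 ik kN]].
  by move: hk hi; rewrite !mem_index_iota; split; lia.
by exists k, i; rewrite !mem_index_iota; split => //; lia.
Qed.

Lemma triangle_uniq N : uniq (triangle N).
Proof.
apply: allpairs_uniq_dep => [|k _|]; rewrite ?iota_uniq//.
by move=> [a b] [c d] _ _ /= [-> ->].
Qed.

Lemma sum_triangle (W : nmodType) N (F : nat * nat -> W) :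
  \sum_(p <- triangle N) F p = \sum_(1 <= k < N.+1) \sum_(1 <= i < k.+1) F (k, i).
Proof. by rewrite big_allpairs_dep. Qed.

Lemma sum_rev1 (W : nmodType) k (F : nat -> W) :
  \sum_(1 <= i < k.+1) F i = \sum_(1 <= i < k.+1) F (k.+1 - i)%N.
Proof. by rewrite big_nat_rev; apply: eq_big_nat => i hi; congr F; lia. Qed.

Lemma sum_triangle_rev (W : nmodType) N (G : nat * nat -> W) :
  \sum_(p <- triangle N) G p = \sum_(1 <= k < N.+1) \sum_(1 <= i < k.+1) G (k, (k.+1 - i)%N).
Proof. by rewrite sum_triangle; apply: eq_bigr => k _; exact: (sum_rev1 k (fun i => G (k, i))). Qed.

Section Flux.
Variables (R : realType) (N : nat) (rho : int -> R).
Implicit Types (s : scheme N) (x : signature N).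

Definition right_jump_rate s (p : nat * nat) : R :=
  if right_blocked s p.1 p.2 then 0 else rho (entry s p.1 p.2 - p.2%:Z + 1).

Definition raise x i : signature N := mk_signature N (fun j => part x j + if j == i then 1 else 0).

Definition raisable x i : bool := (i == 1)%N || (part x i < part x i.-1).

Lemma part_raise x i j : raisable x i -> (1 <= i)%N -> (i <= N)%N -> (1 <= j)%N -> (j <= N)%N ->
  part (raise x i) j = part x j + if j == i then 1 else 0.
Proof.
move=> ok i1 iN j1 jN; apply: part_mk_signature => // m m1 mN.
have h : part x m.+1 <= part x m by apply: part_mono.
case: (eqVneq m.+1 i) => [mi|_]; last by case: ifP => _; lia.
rewrite ifF; last by lia.
by move: ok; rewrite /raisable -mi/= => /orP[|]; [lia|move=> h'; lia].
Qed.

Let dest x (p : nat * nat) := if (p.1 < N)%N then x else raise x p.2.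

Let reachable x s (p : nat * nat) :=
  if (p.1 < N)%N then entry s p.1.+1 p.2.+1 < entry s p.1 p.2 else raisable x p.2.

(** The double sum over schemes of the fibre and moves is reindexed by the
    scheme at which the move arrives and by the last pushed level and
    index. Moves with last pushed level N raise the top row, the others
    stay in the fibre; [reachable] says when a predecessor exists. The jump
    starts from a value lower by 1, hence the rate at the target has the
    argument shifted by 1. *)
Lemma right_inflow (f : scheme N -> R) x :
  \sum_(s <- fibre x) \sum_(p <- triangle N) right_jump_rate s p * f (right_target s p.1 p.2) =
  \sum_(p <- triangle N) \sum_(s <- fibre (dest x p))
     (if reachable x s p then rho (entry s p.1 p.2 - p.2%:Z) * f s else 0).
Proof.
pose A := [seq (s, p) | s <- fibre x, p <- triangle N].
pose B := [seq (p, s) | p <- triangle N, s <- fibre (dest x p)].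
transitivity (\sum_(a <- A | ~~ right_blocked a.1 a.2.1 a.2.2)
    rho (entry a.1 a.2.1 a.2.2 - a.2.2%:Z + 1) * f (right_target a.1 a.2.1 a.2.2)).
  rewrite [RHS]big_mkcond /A [RHS]big_allpairs; apply: eq_bigr => s _; apply: eq_bigr => p _ /=.
  by rewrite /right_jump_rate if_neg; case: ifP; rewrite ?mul0r.
transitivity (\sum_(b <- B | reachable x b.2 b.1)
    rho (entry b.2 b.1.1 b.1.2 - b.1.2%:Z) * f b.2); last first.
  by rewrite [LHS]big_mkcond /B [LHS]big_allpairs_dep; apply: eq_bigr => p _; apply: eq_bigr => s _.
apply: (@sum_bij _ _ _ _ _ _ _
  (fun a => ((right_reach a.1 a.2.1 a.2.2, a.2.2), right_target a.1 a.2.1 a.2.2))).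
- by apply: allpairs_uniq; rewrite ?fibre_uniq ?triangle_uniq// => -[a b] [c d] _ _ /= [-> ->].
- apply: allpairs_uniq_dep => [|p _|]; rewrite ?fibre_uniq ?triangle_uniq//.
  by move=> [a b] [c d] _ _ /= [-> ->].
- move=> [s [k i]] /allpairsP[[s' [k' i']] [/= hs + [-> -> ->]]] {s k i}.
  rename s' into s, k' into k, i' into i; move=> + nb; rewrite mem_triangle => /and3P[i1 ik kN].
  move: hs; rewrite mem_fibre => /eqP sx.
  have [kL LN eqL neqL] := right_reachP s i kN.
  set L := right_reach s k i in kL LN eqL neqL *.
  have tE j m : (1 <= m)%N -> (m <= j)%N -> (j <= N)%N ->
      entry (right_target s k i) j m = entry s j m + if (k <= j <= L)%N && (m == i) then 1 else 0.
    by move=> m1 mj jN; rewrite entry_right_target.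
  have eN j : entry s N j = part x j by rewrite /entry sx.
  have ok : L = N -> raisable x i.
    move=> LE; rewrite /raisable; case: (ltnP 1 i) => [i2|i2]; last by apply/orP; left; lia.
    apply/orP; right; move: nb; rewrite /right_blocked/= i2/= => /eqP nb.
    have h1 : entry s N i = entry s k i by apply: eqL; lia.
    have g1 : (1 <= i.-1)%N by lia.
    have g2 : (i.-1 <= k.-1)%N by lia.
    have g3 : (k.-1 < N)%N by lia.
    have /andP[+ _] := entries_interlacing s g1 g2 g3.
    have -> : i.-1.+1 = i by lia.
    have -> : k.-1.+1 = k by lia.
    have h2 : entry s k.-1 i.-1 <= entry s N i.-1 by apply: entry_col_mono; lia.
    by move: h1 h2; rewrite !eN => h1 h2 h3; lia.
  split.
  + apply/allpairsPdep; exists (L, i), (right_target s k i); split => //.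
      by rewrite mem_triangle; apply/and3P; split => //; lia.
    rewrite mem_fibre /dest/=; apply/eqP; apply: level_ext => j j1 jN.
    have [LN'|NL] := ltnP L N.
      by rewrite tE// eN ifF ?addr0//; lia.
    have LE : L = N by lia.
    rewrite tE// eN part_raise//; [|exact: ok|lia].
    by congr (_ + _); case: ifP => h; case: ifP => h'; lia.
  + rewrite /reachable/=; case: ltnP => [LN'|NL]; last by apply: ok; lia.
    rewrite !tE//; [|lia..].
    have h1 : (1 <= i)%N by [].
    have h2 : (i <= L)%N by lia.
    have /andP[g _] := entries_interlacing s h1 h2 LN'.
    rewrite ifF; last by lia.
    by rewrite ifT; [|lia]; lia.
  + rewrite /= tE//; [|lia].
    rewrite ifT; last by lia.
    rewrite (eqL L)//; congr (rho _ * _); lia.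
- move=> [s1 [k1 i1]] [s2 [k2 i2]] /allpairsP[[s [k i]] [/= _ + [-> -> ->]]].
  rewrite mem_triangle => /and3P[a1 a2 a3] /allpairsP[[s' [k' i']] [/= _ + [-> -> ->]]].
  rewrite mem_triangle => /and3P[b1 b2 b3] nb1 nb2 [eL ei eT]; subst i'.
  by have [-> ->] := right_target_inj a1 a2 a3 b2 b3 nb1 nb2 eT eL.
- move=> [[l i] s] /allpairsPdep[[l' i'] [s' [+ + [-> -> ->]]]] {l i s}.
  rename s' into s, l' into l, i' into i; rewrite mem_triangle => /and3P[i1 il lN].
  rewrite mem_fibre /dest /reachable/= => /eqP hs hc.
  have := @right_predecessor N s l i i1 il lN.
  have hN j : l = N -> (1 <= j)%N -> (j <= N)%N ->
      entry s l j = part x j + if j == i then 1 else 0.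
    move=> lE j1 jN; move: hs hc; rewrite ifF; last by lia.
    rewrite ifF; last by lia.
    move=> hs ok; rewrite -part_raise//; last by lia.
    by rewrite -hs /entry lE.
  case=> [lN'||k [s' [/andP[ik kl] nb sE LE]]].
  + by move: hc; rewrite lN'.
  + move=> lE il'; rewrite !hN//; [|lia..].
    rewrite ifF; last by lia.
    rewrite eqxx; have : part x i.+1 <= part x i by apply: part_mono; lia.
    by lia.
  exists (s', (k, i)); split => //=; last by rewrite sE LE.
  apply/allpairsP; exists (s', (k, i)); split => //=; last by rewrite mem_triangle; lia.
  rewrite mem_fibre; apply/eqP; apply: level_ext => j j1 jN.
  have := @entry_right_target N s' k i N j i1 ik (leq_trans kl lN) nb j1 jN (leqnn _).
  rewrite sE /right_entry LE.
  have [lN'|lN'] := ltnP l N.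
    rewrite ifF ?addr0; last by lia.
    by move<-; move: hs; rewrite lN' /entry => ->.
  have lE : l = N by lia.
  have e1 := hN j lE j1 jN.
  have e2 : entry s l j = entry s N j by rewrite lE.
  by rewrite -e2 e1 (leq_trans kl lN) => /addIr.
Qed.

(** All incoming rates at levels below N minus all outgoing rates, as if
    nothing were ever blocked. *)
Definition potential s : R :=
  \sum_(1 <= l < N) \sum_(1 <= i < l.+1) rho (entry s l i - i%:Z) -
  \sum_(1 <= k < N.+1) \sum_(1 <= i < k.+1) rho (entry s k i - i%:Z + 1).

(** Rate of the top row in direction i, before the factor that conditions
    the coordinates to remain ordered. *)
Definition right_exit x i : R :=
  if raisable x i then rho (part x i - i%:Z + 1) else 0.

(** The entry (l, i) has no incoming move exactly when it equals the entry
    (l + 1, i + 1), and then it blocks the jump of that entry. Both missing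
    rates are rho at the same point, since the shift of the index by 1
    compensates the unit jump. *)
Let blocked_cancel s : (1 <= N)%N ->
  \sum_(1 <= l < N) \sum_(1 <= i < l.+1)
    (if entry s l.+1 i.+1 < entry s l i then rho (entry s l i - i%:Z) else 0) -
  \sum_(p <- triangle N) right_jump_rate s p = potential s.
Proof.
move=> N1; pose G k i := if right_blocked s k i then rho (entry s k i - i%:Z + 1) else 0.
have G1 k : G k 1%N = 0 by rewrite /G /right_blocked.
have hB : \sum_(1 <= k < N.+1) \sum_(1 <= i < k.+1) rho (entry s k i - i%:Z + 1) -
    \sum_(p <- triangle N) right_jump_rate s p =
    \sum_(1 <= l < N) \sum_(1 <= i < l.+1) G l.+1 i.+1.
  transitivity (\sum_(1 <= k < N.+1) \sum_(1 <= i < k.+1) G k i).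
    rewrite sum_triangle -sumrB; apply: eq_bigr => k _; rewrite -sumrB; apply: eq_bigr => i _.
    by rewrite /right_jump_rate /G/=; case: ifP; rewrite ?subr0 ?subrr.
  rewrite big_ltn// big_nat1 G1 add0r big_add1/=; apply: eq_bigr => k _.
  by rewrite big_ltn// G1 add0r big_add1.
have hA : \sum_(1 <= l < N) \sum_(1 <= i < l.+1) rho (entry s l i - i%:Z) -
    \sum_(1 <= l < N) \sum_(1 <= i < l.+1)
    (if entry s l.+1 i.+1 < entry s l i then rho (entry s l i - i%:Z) else 0) =
    \sum_(1 <= l < N) \sum_(1 <= i < l.+1) G l.+1 i.+1.
  rewrite -sumrB; apply: eq_big_nat => l /andP[l1 lN]; rewrite -sumrB.
  apply: eq_big_nat => i /andP[i1 il]; rewrite /G /right_blocked/=.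
  have /andP[h _] := @entries_interlacing N s l i i1 il lN.
  rewrite ltnS i1 /=; case: ltP => h'; case: eqP => h''; rewrite ?subrr ?subr0//; [lia| |lia].
  by rewrite h''; congr rho; lia.
rewrite /potential; apply/eqP; rewrite subr_eq -subr_eq0.
by rewrite (_ : _ - _ = 0)//; move: hA; rewrite -hB; lra.
Qed.

(** The constraints disappear from the bulk by blocked_cancel; only raising
    the top row is still conditioned. *)
Lemma right_flux (f : scheme N -> R) x : (1 <= N)%N ->
  \sum_(s <- fibre x) \sum_(p <- triangle N)
     right_jump_rate s p * (f (right_target s p.1 p.2) - f s) =
  \sum_(1 <= i < N.+1) right_exit x i * (\sum_(s <- fibre (raise x i)) f s) +
  \sum_(s <- fibre x) potential s * f s.
Proof.
move=> N1; transitivity (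
  \sum_(s <- fibre x) \sum_(p <- triangle N) right_jump_rate s p * f (right_target s p.1 p.2) -
  \sum_(s <- fibre x) (\sum_(p <- triangle N) right_jump_rate s p) * f s).
  rewrite -sumrB; apply: eq_bigr => s _; rewrite mulr_suml -sumrB.
  by apply: eq_bigr => p _; rewrite mulrBr.
rewrite right_inflow sum_triangle big_nat_recr//=.
rewrite [X in _ + _ = _ + X](_ : _ = \sum_(1 <= l < N) \sum_(1 <= i < l.+1)
   \sum_(s <- fibre x) (if entry s l.+1 i.+1 < entry s l i then rho (entry s l i - i%:Z) else 0) * f s
   - \sum_(s <- fibre x) (\sum_(p <- triangle N) right_jump_rate s p) * f s); last first.
  under eq_bigr do rewrite -blocked_cancel// mulrBl.
  rewrite sumrB; congr (_ - _).
  under eq_bigr do rewrite mulr_suml; rewrite exchange_big/=; apply: eq_bigr => l _.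
  by under eq_bigr do rewrite mulr_suml; rewrite exchange_big.
rewrite [RHS]addrA; congr (_ - _); rewrite addrC; congr (_ + _).
  apply: eq_big_nat => i /andP[i1 iN]; rewrite /dest /reachable/= ltnn /right_exit mulr_sumr.
  rewrite big_seq [RHS]big_seq; apply: eq_bigr => s; rewrite mem_fibre => /eqP sx.
  case: ifP => [ok|]; last by rewrite mul0r.
  by rewrite /entry sx part_raise// eqxx; congr (rho _ * _); lia.
apply: eq_big_nat => l /andP[l1 lN]; apply: eq_bigr => i _; rewrite /dest /reachable/= lN.
by apply: eq_bigr => s _; case: ifP => //; rewrite mul0r.
Qed.

End Flux.

(** * Dimensions and rates on signatures *)

Section Dimension.
Variable R : realType.

Definition vandermonde (g : nat -> R) n : R :=
  \prod_(1 <= i < n.+1) \prod_(i.+1 <= j < n.+1) (g i - g j).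

(** Moving the node k affects just the factors that contain it; both orders
    of the pair give the same quotient because numerator and denominator
    change sign together. *)
Lemma vandermonde_step (g : nat -> R) n (k : nat) (h : R) : (1 <= k)%N -> (k <= n)%N ->
  (forall i j, (1 <= i)%N -> (i <= n)%N -> (1 <= j)%N -> (j <= n)%N -> i <> j -> g i != g j) ->
  vandermonde (fun j => g j + if j == k then h else 0) n =
  vandermonde g n * \prod_(1 <= j < n.+1 | j != k) ((g k + h - g j) / (g k - g j)).
Proof.
move=> k1 kn ginj; pose t j := (g k + h - g j) / (g k - g j).
pose c a b := if a == k then t b else if b == k then t a else 1.
have -> : \prod_(1 <= j < n.+1 | j != k) t j =
    \prod_(1 <= a < n.+1) \prod_(a.+1 <= b < n.+1) c a b.
  have nn : (1 <= n.+1)%N by [].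
  rewrite [RHS](@big_cat_nat _ _ _ k)//=; last by lia.
  rewrite [X in _ = _ * X]big_ltn//.
  have -> : \prod_(1 <= a < k) \prod_(a.+1 <= b < n.+1) c a b = \prod_(1 <= a < k) t a.
    apply: eq_big_nat => a /andP[a1 ak].
    rewrite (bigD1_seq k) ?iota_uniq//=; last by rewrite mem_index_iota; lia.
    rewrite /c eqxx ifF; last by lia.
    by rewrite big1 ?mulr1// => b bk; rewrite ifF ?(negPf bk)//; lia.
  have -> : \prod_(k.+1 <= b < n.+1) c k b = \prod_(k.+1 <= b < n.+1) t b.
    by apply: eq_bigr => b _; rewrite /c eqxx.
  have -> : \prod_(k.+1 <= a < n.+1) \prod_(a.+1 <= b < n.+1) c a b = 1.
    rewrite big_nat big1// => a /andP[ka _]; rewrite big_nat big1// => b /andP[ab _].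
    by rewrite /c ifF ?ifF//; lia.
  rewrite mulr1 (@big_cat_nat _ _ _ k)//=; last by lia.
  rewrite [X in _ * X = _]big_ltn_cond// eqxx /=.
  congr (_ * _); rewrite big_nat_cond [RHS]big_nat; apply: eq_bigl => j; lia.
rewrite /vandermonde -big_split/=; apply: eq_big_nat => a /andP[a1 an].
rewrite -big_split/=; apply: eq_big_nat => b /andP[ab bn].
have gab : g a - g b != 0 by rewrite subr_eq0; apply: ginj; lia.
rewrite /c /t; case: (eqVneq a k) => [ak|ak].
  subst a; rewrite ifF; last by lia.
  by field.
case: (eqVneq b k) => [bk|bk]; last by rewrite !addr0 mulr1.
have gba : g b - g a != 0 by rewrite subr_eq0 eq_sym -subr_eq0.
by subst b; field.
Qed.

Definition shifted_part k (x : signature k) (i : nat) : R := (part x i - i%:Z)%:~R.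

Lemma DimE k (x : signature k) : Dim R x = vandermonde (shifted_part x) k / \prod_(1 <= i < k) (i`!)%:R.
Proof.
rewrite /Dim /vandermonde; congr (_ / _); apply: eq_bigr => i _; apply: eq_bigr => j _.
by rewrite /shifted_part -rmorphB/=; congr (_%:~R); lia.
Qed.

Lemma shifted_part_lt k (x : signature k) i j : (1 <= i)%N -> (i < j)%N -> (j <= k)%N -> shifted_part x j < shifted_part x i.
Proof.
move=> i1 ij jk; rewrite /shifted_part ltr_int.
have : part x j <= part x i by apply: part_mono => //; lia.
by lia.
Qed.

Lemma shifted_part_neq k (x : signature k) i j :
  (1 <= i)%N -> (i <= k)%N -> (1 <= j)%N -> (j <= k)%N -> i <> j -> shifted_part x i != shifted_part x j.
Proof.
move=> i1 ik j1 jk ij; have [h|h] := leqP i j.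
  by rewrite gt_eqF// shifted_part_lt//; lia.
by rewrite lt_eqF// shifted_part_lt//; lia.
Qed.

Lemma Dim_gt0 k (x : signature k) : 0 < Dim R x.
Proof.
rewrite DimE divr_gt0//; last first.
  by rewrite big_nat; apply: prodr_gt0 => i _; rewrite ltr0n fact_gt0.
rewrite /vandermonde big_nat; apply: prodr_gt0 => i /andP[i1 ik].
rewrite big_nat; apply: prodr_gt0 => j /andP[ij jk].
by rewrite subr_gt0 shifted_part_lt.
Qed.

Lemma Dim_neq0 k (x : signature k) : Dim R x != 0.
Proof. by rewrite gt_eqF// Dim_gt0. Qed.

Lemma Dim1 (x : signature 1) : Dim R x = 1.
Proof. by rewrite DimE /vandermonde big_nat1 !big_geq// divr1. Qed.

(** Each link has the dimension of the lower row over that of the upper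
    row, so the product telescopes down to the first row, which has
    dimension 1. *)
Lemma central_liftE N (mu : signature N -> R) (s : scheme N) : (1 <= N)%N ->
  central_lift mu s = mu (level s N) / Dim R (level s N).
Proof.
move=> N1; rewrite /central_lift; congr (_ * _).
suff : forall n, (1 <= n)%N -> (n <= N)%N ->
    \prod_(1 <= k < n) Link R (level s k.+1) (level s k) = (Dim R (level s n))^-1.
  by apply.
elim=> // -[_ _ _|n IH _ nN].
  by rewrite big_geq// Dim1 invr1.
rewrite big_nat_recr//= IH//; last by lia.
have nN' : (n.+1 < N)%N by lia.
have il : interlace (level s n.+1) (level s n.+2).
  apply/forallP => i; have i1 : (1 <= i.+1)%N by [].
  have in1 : (i.+1 <= n.+1)%N by [].
  exact: entries_interlacing i1 in1 nN'.
by rewrite /Link il mulrA mulVf ?mul1r// Dim_neq0.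
Qed.

End Dimension.

Section SignatureMoves.
Variables (R : realType) (N : nat) (rho : int -> R).
Implicit Types (x y : signature N).

(** The transform of independent jumps of the coordinates by their
    eigenfunction Dim, which is the form that the fibre sums produce. *)
Definition right_sig_rate x i : R := right_exit rho x i * Dim R (raise x i) / Dim R x.

Definition lower x i : signature N := reflect_sig (raise (reflect_sig x) (N.+1 - i)%N).

Definition left_sig_rate x i : R :=
  right_exit rho (reflect_sig x) (N.+1 - i)%N * Dim R (lower x i) / Dim R x.

Lemma Dim_shift x y i (h : int) : (1 <= i)%N -> (i <= N)%N ->
  (forall j, (1 <= j)%N -> (j <= N)%N -> part y j = part x j + if j == i then h else 0) ->
  Dim R y / Dim R x =
  \prod_(1 <= j < N.+1 | j != i) ((shifted_part R x i + h%:~R - shifted_part R x j) / (shifted_part R x i - shifted_part R x j)).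
Proof.
move=> i1 iN yE; rewrite !DimE.
have vx : vandermonde (shifted_part R x) N != 0.
  by have := Dim_neq0 R x; rewrite DimE mulf_eq0 negb_or => /andP[].
have c0 : \prod_(1 <= i < N) (i`!)%:R != 0 :> R.
  by rewrite gt_eqF// big_nat; apply: prodr_gt0 => j _; rewrite ltr0n fact_gt0.
rewrite invfM invrK mulrACA mulVf// mulr1.
apply: (mulIf vx); rewrite divfK// mulrC -vandermonde_step//; last by move=> *; exact: shifted_part_neq.
rewrite /vandermonde; apply: eq_big_nat => a /andP[a1 aN]; apply: eq_big_nat => b /andP[b1 bN].
have hE j : (1 <= j)%N -> (j <= N)%N -> shifted_part R y j = shifted_part R x j + if j == i then h%:~R else 0.
  move=> j1 jN; rewrite /shifted_part yE//; case: ifP => _; rewrite ?addr0//.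
  by rewrite -rmorphD/=; congr (_%:~R); lia.
by rewrite !hE//; lia.
Qed.

(** When the move is illegal, two shifted parts would collide and a factor
    of the product vanishes, so the closed formula also holds there. This
    lets sums over legal moves run over all indices. *)
Lemma right_sig_rateE x i : (1 <= i)%N -> (i <= N)%N ->
  right_sig_rate x i = rho (part x i - i%:Z + 1) *
   \prod_(1 <= j < N.+1 | j != i) ((shifted_part R x i + 1 - shifted_part R x j) / (shifted_part R x i - shifted_part R x j)).
Proof.
move=> i1 iN; rewrite /right_sig_rate /right_exit.
case: ifPn => [ok|nok].
  rewrite -mulrA; congr (_ * _); apply: (@Dim_shift x (raise x i) i 1) => // j j1 jN.
  by rewrite part_raise.
rewrite !mul0r; move: nok; rewrite /raisable negb_or => /andP[i_neq1 nlt].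
rewrite big_mkcond (bigD1_seq i.-1) ?iota_uniq//=; last by rewrite mem_index_iota; lia.
rewrite ifT; last by lia.
rewrite (_ : shifted_part R x i + 1 - shifted_part R x i.-1 = 0) ?mul0r ?mulr0//; apply/eqP; rewrite subr_eq0; apply/eqP.
have : part x i <= part x i.-1 by apply: part_mono => //; lia.
move: nlt; rewrite -leNgt /shifted_part => h1 h2.
have -> : part x i.-1 = part x i by lia.
by rewrite -[1 in LHS](rmorph1 (intmul (1 : R))) -rmorphD/=; congr (_%:~R); lia.
Qed.

Lemma raisable_reflect_sig x i : (1 <= i)%N -> (i <= N)%N ->
  raisable (reflect_sig x) (N.+1 - i)%N = (i == N) || (part x i.+1 < part x i).
Proof.
move=> i1 iN; rewrite /raisable.
have [->|iN'] := eqVneq i N; first by rewrite (_ : (N.+1 - N == 1)%N)//; lia.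
rewrite (_ : (N.+1 - i == 1)%N = false)/=; last by lia.
rewrite !part_reflect_sig; [|lia..].
rewrite ltrN2 (_ : (N.+1 - (N.+1 - i) = i)%N); last by lia.
by rewrite (_ : (N.+1 - (N.+1 - i).-1 = i.+1)%N)//; lia.
Qed.

Lemma part_lower x i j : raisable (reflect_sig x) (N.+1 - i)%N -> (1 <= i)%N -> (i <= N)%N ->
  (1 <= j)%N -> (j <= N)%N -> part (lower x i) j = part x j + if j == i then -1 else 0.
Proof.
move=> ok i1 iN j1 jN; rewrite /lower part_reflect_sig// part_raise//; [|lia..].
rewrite part_reflect_sig; [|lia..].
rewrite opprD opprK (_ : (N.+1 - (N.+1 - j) = j)%N); last by lia.
by congr (_ + _); case: ifP => h; case: ifP => h'; lia.
Qed.

Lemma left_sig_rateE x i : (1 <= i)%N -> (i <= N)%N ->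
  left_sig_rate x i = rho (- part x i - N%:Z + i%:Z) *
   \prod_(1 <= j < N.+1 | j != i) ((shifted_part R x i - 1 - shifted_part R x j) / (shifted_part R x i - shifted_part R x j)).
Proof.
move=> i1 iN; rewrite /left_sig_rate /right_exit.
case: ifPn => [ok|].
  rewrite -mulrA; congr (_ * _).
    rewrite part_reflect_sig; [|lia..].
    rewrite (_ : (N.+1 - (N.+1 - i) = i)%N); last by lia.
    by congr rho; lia.
  rewrite (@Dim_shift x (lower x i) i (-1) i1 iN (fun j j1 jN => part_lower ok i1 iN j1 jN)).
  by apply: eq_bigr => j _; rewrite rmorphN1.
rewrite raisable_reflect_sig// !mul0r negb_or => /andP[i_neq1 nlt].
rewrite big_mkcond (bigD1_seq i.+1) ?iota_uniq//=; last by rewrite mem_index_iota; lia.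
rewrite ifT; last by lia.
rewrite (_ : shifted_part R x i - 1 - shifted_part R x i.+1 = 0) ?mul0r ?mulr0//; apply/eqP; rewrite subr_eq0; apply/eqP.
have : part x i.+1 <= part x i by apply: part_mono => //; lia.
move: nlt; rewrite -leNgt /shifted_part => h1 h2.
have -> : part x i.+1 = part x i by lia.
by rewrite -[1 in LHS](rmorph1 (intmul (1 : R))) -rmorphB/=; congr (_%:~R); lia.
Qed.

End SignatureMoves.

(** * Divided differences *)

Section DividedDifferences.
Variable R : numFieldType.

(** The top coefficient of a product, for bounds on the sizes that need not
    be sharp. *)
Lemma coefM_top (p q : {poly R}) a b : (size p <= a.+1)%N -> (size q <= b.+1)%N ->
  (p * q)`_(a + b) = p`_a * q`_b.
Proof.
move=> pa qb; rewrite coefM (bigD1 (Ordinal (leq_addr b a : (a < (a + b).+1)%N)))//=.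
rewrite addKn big1 ?addr0// => j ja.
have [jla|] := ltnP j a; last first.
  rewrite leq_eqVlt => /predU1P[e|aj]; last by rewrite nth_default ?mul0r// (leq_trans pa).
  by case/eqP: ja; apply: val_inj; exact/esym.
by rewrite [q`_ _]nth_default ?mulr0// (leq_trans qb)//; lia.
Qed.

Lemma deriv_prod_XsubC (I : Type) (s : seq I) (P : pred I) (x : I -> R) (y : R) :
  (forall i, P i -> y != x i) ->
  (\prod_(i <- s | P i) ('X - (x i)%:P))^`().[y] =
  (\prod_(i <- s | P i) (y - x i)) * \sum_(i <- s | P i) (y - x i)^-1.
Proof.
move=> yx; elim: s => [|i s IH]; first by rewrite !big_nil derivC horner0 mulr0.
rewrite !big_cons; case: ifPn => // Pi.
rewrite derivM derivXsubC mul1r !hornerE IH horner_prod.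
under eq_bigr do rewrite hornerXsubC.
have h : y - x i != 0 by rewrite subr_eq0 yx.
by field.
Qed.

Section Nodes.
Variables (n : nat) (x : 'I_n -> R).
Hypothesis x_inj : injective x.

Let p := \prod_(j < n) ('X - (x j)%:P).
Let pi i := \prod_(j < n | j != i) ('X - (x j)%:P).
Let w i := \prod_(j < n | j != i) (x i - x j).

Let wE i : (pi i).[x i] = w i.
Proof. by rewrite /pi horner_prod; apply: eq_bigr => j _; rewrite hornerXsubC. Qed.

Let w_neq0 i : w i != 0.
Proof.
apply/prodf_neq0 => j ji; rewrite subr_eq0; apply: contra_neq ji => /x_inj ->//.
Qed.

Let pE i : p = ('X - (x i)%:P) * pi i.
Proof. by rewrite /p (bigD1 i). Qed.

Let size_p : size p = n.+1.
Proof. by rewrite /p size_prod_XsubC /index_enum -enumT size_enum_ord. Qed.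

Let p_monic : p \is monic.
Proof. exact: monic_prod_XsubC. Qed.

Let pi_monic i : pi i \is monic.
Proof. exact: monic_prod_XsubC. Qed.

Let size_pi i : size (pi i) = n.
Proof.
have := size_p; rewrite (pE i) size_monicM ?monicXsubC ?monic_neq0//.
by rewrite size_XsubC => -[].
Qed.

(** Comparison of top coefficients in the Lagrange interpolation formula. *)
Lemma lagrange_top (q : {poly R}) : (size q <= n)%N ->
  \sum_i q.[x i] / w i = q`_n.-1.
Proof.
move=> qn; pose L := \sum_i (q.[x i] / w i) *: pi i.
have -> : q = L.
  apply/eqP; rewrite -subr_eq0; apply/eqP.
  apply: (@roots_geq_poly_eq0 _ _ (codom x)).
  - apply/allP => _ /codomP[i ->]; rewrite rootE hornerD hornerN /L horner_sum.
    rewrite (bigD1 i)//= big1 ?addr0 => [|j ji].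
      by rewrite hornerZ wE divfK// subrr.
    rewrite hornerZ /pi horner_prod (bigD1 i) 1?eq_sym//= hornerXsubC subrr mul0r.
    by rewrite mulr0.
  - exact/injectiveP.
  - rewrite size_codom card_ord (leq_trans (size_polyD _ _))// size_polyN geq_max qn/=.
    apply: (leq_trans (size_sum _ _ _)); apply/bigmax_leqP => i _.
    by rewrite (leq_trans (size_scale_leq _ _))// size_pi.
rewrite coef_sum; apply: eq_bigr => i _.
rewrite coefZ -[in n.-1](size_pi i) -[_`_ _]/(lead_coef _) (monicP (pi_monic i)) mulr1.
rewrite /L horner_sum (bigD1 i)//= big1 ?addr0 => [|j ji].
  by rewrite hornerZ wE divfK.
rewrite hornerZ /pi horner_prod (bigD1 i) 1?eq_sym//= hornerXsubC subrr mul0r.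
by rewrite mulr0.
Qed.

Let d k i := p^`N(k).[x i].

Let prod_shift h i : h != 0 ->
  \prod_(j < n | j != i) (x i + h - x j) = \sum_(k < n) d k.+1 i * h ^+ k.
Proof.
move=> h0; apply: (mulfI h0).
have -> : h * \prod_(j < n | j != i) (x i + h - x j) = p.[x i + h].
  rewrite (pE i) hornerM hornerXsubC addrAC subrr add0r /pi horner_prod; congr (_ * _).
  by apply: eq_bigr => j _; rewrite hornerXsubC.
rewrite nderiv_taylor; last exact: mulrC.
rewrite size_p big_ord_recl nderivn0 mulr1 (pE i) hornerM hornerXsubC subrr mul0r add0r.
rewrite -(pE i) mulr_sumr; apply: eq_bigr => k _; rewrite /= /d exprS; ring.
Qed.

Let d1 i : d 1 i = w i.
Proof. by rewrite /d nderivn1 (pE i) derivM derivXsubC mul1r !hornerE subrr mul0r addr0 wE. Qed.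

Let d2 i : d 2 i = w i * \sum_(j < n | j != i) (x i - x j)^-1.
Proof.
rewrite -deriv_prod_XsubC => [|j ji]; last by apply: contra_neq ji => /x_inj ->.
have h0 : p^`()^`() = (pi i)^`() + ((pi i)^`() + ('X - (x i)%:P) * (pi i)^`()^`()).
  by rewrite (pE i) derivM derivXsubC mul1r derivD derivM derivXsubC mul1r.
have := congr1 (fun q => q.[x i]) (nderivn_def 2 p).
rewrite derivnS derivn1 h0 hornerMn !hornerD hornerM hornerXsubC subrr mul0r addr0 -/(d 2 i).
rewrite -mulr2n => h; apply/esym/(pmulrnI _ h); exact: isT.
Qed.

Let dE k i : (n < k)%N -> d k i = 0.
Proof.
move=> nk; rewrite /d (_ : p^`N(k) = 0) ?horner0//; apply/polyP => j.
by rewrite coef_nderivn coef0 nth_default ?mul0rn// size_p; lia.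
Qed.

(** Up to the factor 1 / h, the product of x_i + h - x_j over j <> i is the
    value at x_i + h of p, the monic polynomial with roots x_j. Its Taylor
    expansion at x_i gives a sum over k of Lagrange sums of C_k times the
    k+1-st divided derivative of p, where C_k is A + B or A - B by the
    parity of k. The terms k = 0 and k = 1 are computed directly. By
    lagrange_top the others see only coefficients of degree n - 1, and
    since C_k has degree at most 2 or 3 only k = 2 and k = 3 contribute. *)
Lemma divdiff_shift (A B : {poly R}) : (0 < n)%N ->
  (size (A + B)%R <= 3)%N -> (size (A - B)%R <= 4)%N ->
  \sum_i (A.[x i] * \prod_(j < n | j != i) ((x i + 1 - x j) / (x i - x j)) +
          B.[x i] * \prod_(j < n | j != i) ((x i - 1 - x j) / (x i - x j))) =
  \sum_i (A + B).[x i] + \sum_i (A - B).[x i] * (\sum_(j < n | j != i) (x i - x j)^-1)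
  + (A + B)`_2 *+ 'C(n, 3) + (A - B)`_3 *+ 'C(n, 4).
Proof.
move=> n0 sAB sBA.
pose C k := if odd k then A - B else A + B.
have CE k y : (C k).[y] = A.[y] + B.[y] * (-1) ^+ k.
  by rewrite /C -signr_odd; case: odd; rewrite !hornerE ?expr1 ?expr0; ring.
pose e k := \sum_i (C k).[x i] * d k.+1 i / w i.
(* The range is extended by zero terms so that it contains k = 0, ..., 3
   even for small n. *)
transitivity (\sum_(0 <= k < n + 4) e k).
  rewrite /e exchange_big/=; apply: eq_bigr => i _.
  rewrite !prodf_div -/(w i) !prod_shift ?oppr_eq0 ?oner_eq0//.
  have tail : \sum_(n <= k < n + 4) (C k).[x i] * d k.+1 i / w i = 0.
    by rewrite big_nat big1// => k /andP[nk _]; rewrite dE ?ltnS// mulr0 mul0r.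
  rewrite (@big_cat_nat _ _ _ n) ?leq_addr//= tail addr0.
  rewrite !mulrA -mulrDl !mulr_sumr -big_split/= big_mkord mulr_suml.
  by apply: eq_bigr => k _; rewrite CE expr1n; ring.
have size_dp k : (size p^`N(k.+1) <= n - k)%N.
  apply/leq_sizeP => j hj; rewrite coef_nderivn nth_default ?mul0rn// size_p; lia.
have eE k c : (size (C k) <= c.+1)%N -> (c <= k)%N ->
    e k = if c == k then (C k)`_c *+ 'C(n, k.+1) else 0.
  move=> sC ck; have [kn|nk] := ltnP k n; last first.
    rewrite bin_small// mulr0n if_same /e big1// => i _; rewrite dE//.
    by rewrite mulr0 mul0r.
  have sM : (size (C k * p^`N(k.+1))%R <= c + (n - k))%N.
    apply: (leq_trans (size_polyMleq _ _)); rewrite -subn1 leq_subLR add1n -addSn.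
    exact: leq_add.
  rewrite /e; under eq_bigr do rewrite /d -hornerM.
  rewrite lagrange_top; last by rewrite (leq_trans sM)//; lia.
  have [ckE|ck'] := eqVneq c k; last by rewrite nth_default// (leq_trans sM)//; lia.
  have {1}-> : n.-1 = (c + (n.-1 - c))%N by lia.
  rewrite coefM_top//; last by rewrite (leq_trans (size_dp k))//; lia.
  have kE : (k.+1 + (n.-1 - c) = n)%N by lia.
  rewrite coef_nderivn kE mulrnAr.
  by have := p_monic; rewrite monicE lead_coefE size_p => /eqP->; rewrite mulr1.
rewrite addnC big_ltn// big_ltn// big_ltn// big_ltn//.
rewrite (eE 2 2)// (eE 3 3)//= [X in _ + (_ + X)](_ : _ = (A + B)`_2 *+ 'C(n, 3) + (A - B)`_3 *+ 'C(n, 4)).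
  have -> : e 0%N = \sum_i (A + B).[x i].
    by apply: eq_bigr => i _; rewrite d1 mulfK ?w_neq0.
  have -> : e 1%N = \sum_i (A - B).[x i] * (\sum_(j < n | j != i) (x i - x j)^-1).
    by apply: eq_bigr => i _; rewrite d2 mulrCA mulrAC divff ?w_neq0// mul1r.
  by rewrite !addrA.
rewrite big_nat big1 ?addr0// => k /andP[k4 _].
case: (boolP (odd k)) => ok.
  by rewrite (eE k 3); [rewrite ifF//; lia|rewrite /C ok|lia].
by rewrite (eE k 2); [rewrite ifF//; lia|rewrite /C (negPf ok)|lia].
Qed.

End Nodes.
End DividedDifferences.

(** * Exit rate and drift on signatures *)

Section ExitRates.
Variable R : realType.

(** The sign convention fits (y - z) (y - z') with a = z + z' and b = z z'. *)
Definition quad (a b : R) (y : int) : R := y%:~R ^+ 2 - a * y%:~R + b.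

Lemma sum_ord1 (W : nmodType) n (F : nat -> W) :
  \sum_(1 <= i < n.+1) F i = \sum_(i < n) F i.+1.
Proof. by rewrite big_add1 big_mkord. Qed.

(** Exchanging i and j turns each quotient into a difference quotient,
    which has no singularity at coinciding nodes when g is a polynomial. *)
Lemma sum_pairs_sym n (x : 'I_n -> R) (g : R -> R) :
  \sum_i g (x i) * (\sum_(j < n | j != i) (x i - x j)^-1) =
  2^-1 * \sum_i \sum_(j < n | j != i) (g (x i) - g (x j)) / (x i - x j).
Proof.
pose S := \sum_i \sum_(j < n | j != i) g (x i) / (x i - x j).
have -> : \sum_i g (x i) * (\sum_(j < n | j != i) (x i - x j)^-1) = S.
  by apply: eq_bigr => i _; rewrite mulr_sumr.
have SE : S = - \sum_i \sum_(j < n | j != i) g (x j) / (x i - x j).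
  rewrite /S (exchange_big_dep xpredT)//= -sumrN; apply: eq_bigr => j _.
  rewrite -sumrN; apply: eq_big => [i|i _]; first by rewrite eq_sym.
  by rewrite -mulrN -invrN opprB.
have -> : \sum_i \sum_(j < n | j != i) (g (x i) - g (x j)) / (x i - x j) = S + S.
  rewrite {2}SE -sumrB; apply: eq_bigr => i _; rewrite -sumrB.
  by apply: eq_bigr => j _; rewrite mulrBl.
by field.
Qed.

Lemma horner_quadratic_le (p : {poly R}) : (size p <= 3)%N ->
  exists2 K, 0 <= K & forall y, p.[y] <= K * (1 + y ^+ 2).
Proof.
move=> sp; exists (`|p`_0| + `|p`_1| + `|p`_2|); first by rewrite !addr_ge0.
move=> y; rewrite (horner_coef_wide _ sp) !big_ord_recr big_ord0/= add0r expr0 expr1 mulr1.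
have y2 : 0 <= y ^+ 2 by exact: sqr_ge0.
have hy : `|y| <= 1 + y ^+ 2.
  by rewrite ler_norml; apply/andP; split; nra.
rewrite !mulrDl; apply: lerD; first apply: lerD.
- by rewrite (le_trans (ler_norm _))// ler_peMr// lerDl.
- by rewrite (le_trans (ler_norm _))// normrM ler_wpM2l.
- by rewrite (le_trans (ler_norm _))// normrM ler_wpM2l// ger0_norm// lerDr.
Qed.

Lemma horner_cubic_slope_le (p : {poly R}) : (size p <= 4)%N ->
  exists2 K, 0 <= K & forall y z, y != z ->
    (p.[y] - p.[z]) / (y - z) <= K * (1 + y ^+ 2 + z ^+ 2).
Proof.
move=> sp; exists (`|p`_1| + `|p`_2| * 2 + `|p`_3| * 2); first by rewrite !addr_ge0.
move=> y z yz; have yz0 : y - z != 0 by rewrite subr_eq0.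
rewrite !(horner_coef_wide _ sp) !big_ord_recr !big_ord0/= !add0r !expr0 !expr1 !mulr1.
set p0 := p`_0; set p1 := p`_1; set p2 := p`_2; set p3 := p`_3.
rewrite (_ : _ / _ = p1 + p2 * (y + z) + p3 * (y ^+ 2 + y * z + z ^+ 2)); last by field.
have y2 : 0 <= y ^+ 2 by exact: sqr_ge0.
have z2 : 0 <= z ^+ 2 by exact: sqr_ge0.
have h2 : `|y + z| <= 2 * (1 + y ^+ 2 + z ^+ 2).
  by rewrite ler_norml; apply/andP; split; nra.
have h3 : `|y ^+ 2 + y * z + z ^+ 2| <= 2 * (1 + y ^+ 2 + z ^+ 2).
  by rewrite ler_norml; apply/andP; split; nra.
rewrite !mulrDl -!mulrA; apply: lerD; first apply: lerD.
- by rewrite (le_trans (ler_norm _))// ler_peMr// -addrA lerDl addr_ge0.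
- by rewrite (le_trans (ler_norm _))// normrM ler_wpM2l.
- by rewrite (le_trans (ler_norm _))// normrM ler_wpM2l.
Qed.

Section Quadratic.
Variables (N : nat) (a b a' b' : R).
Local Notation rho := (quad a b).
Local Notation rho' := (quad a' b').
Implicit Types (s : scheme N) (x : signature N).

(** For monic quadratic polynomials, the incoming and outgoing rates of an
    entry of level l differ by a quantity that does not depend on the
    entry. *)
Definition rate_excess : R :=
  \sum_(1 <= l < N) \sum_(1 <= i < l.+1) (2 * l%:R + a + a').

(** Total jump rate of the top row if its coordinates moved independently. *)
Definition free_rate x : R :=
  \sum_(1 <= i < N.+1) (rho (part x i - i%:Z + 1) + rho' (- part x i - N%:Z + i%:Z)).

(** In the difference of incoming and outgoing rates at an entry x of level
    l, the right jumps contribute a linear function of x and the left jumps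
    the opposite one, so only constants remain below the top row. *)
Lemma potential_sum s : (1 <= N)%N ->
  potential rho s + potential rho' (reflect_scheme s) = rate_excess - free_rate (level s N).
Proof.
move=> N1; rewrite /potential.
have -> : \sum_(1 <= l < N) \sum_(1 <= i < l.+1) rho' (entry (reflect_scheme s) l i - i%:Z) =
    \sum_(1 <= l < N) \sum_(1 <= i < l.+1) rho' (- entry s l i - l%:Z - 1 + i%:Z).
  apply: eq_big_nat => l /andP[l1 lN]; rewrite [RHS]sum_rev1; apply: eq_big_nat => i /andP[i1 il].
  by rewrite entry_reflect_scheme//; [congr rho'; lia|lia].
have -> : \sum_(1 <= k < N.+1) \sum_(1 <= i < k.+1) rho' (entry (reflect_scheme s) k i - i%:Z + 1) =
    \sum_(1 <= k < N.+1) \sum_(1 <= i < k.+1) rho' (- entry s k i - k%:Z + i%:Z).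
  apply: eq_big_nat => l /andP[l1 lN]; rewrite [RHS]sum_rev1; apply: eq_big_nat => i /andP[i1 il].
  by rewrite entry_reflect_scheme//; congr rho'; lia.
rewrite /free_rate big_split/= !(@big_nat_recr _ _ _ N 1)//=.
have -> : rate_excess = 
  \sum_(1 <= l < N) \sum_(1 <= i < l.+1) rho (entry s l i - i%:Z) -
  \sum_(1 <= l < N) \sum_(1 <= i < l.+1) rho (entry s l i - i%:Z + 1) +
  (\sum_(1 <= l < N) \sum_(1 <= i < l.+1) rho' (- entry s l i - l%:Z - 1 + i%:Z) -
  \sum_(1 <= l < N) \sum_(1 <= i < l.+1) rho' (- entry s l i - l%:Z + i%:Z)).
  rewrite -!sumrB -big_split; apply: eq_bigr => l _; rewrite -!sumrB -big_split.
  apply: eq_bigr => i _ /=; rewrite /quad !(rmorphD, rmorphN)/= rmorph1 -!pmulrn; ring.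
rewrite /entry; ring.
Qed.

Let A : {poly R} := ('X + 1) ^+ 2 - a%:P * ('X + 1) + b%:P.
Let B : {poly R} := ('X + N%:R%:P) ^+ 2 + a'%:P * ('X + N%:R%:P) + b'%:P.

Let AE x i : rho (part x i - i%:Z + 1) = A.[shifted_part R x i].
Proof. by rewrite /A /quad /shifted_part !hornerE rmorphD/= rmorph1. Qed.

Let BE x i : rho' (- part x i - N%:Z + i%:Z) = B.[shifted_part R x i].
Proof.
by rewrite /B /quad /shifted_part !hornerE !(rmorphD, rmorphN)/= -!pmulrn; ring.
Qed.

Let c1 : R := 2 - a - N%:R * 2 - a'.
Let c0 : R := 1 - a + b - N%:R ^+ 2 - a' * N%:R - b'.

Let ABE : A - B = c1%:P * 'X + c0%:P.
Proof. by rewrite /A /B /c1 /c0 !(rmorphD, rmorphN, rmorphM, rmorphXn)/= ; ring. Qed.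

Let ABhorner y : (A - B).[y] = c1 * y + c0.
Proof. by rewrite ABE hornerD hornerM !hornerC hornerX. Qed.

Let d1 : R := 2 - a + N%:R * 2 + a'.
Let d0 : R := 1 - a + b + N%:R ^+ 2 + a' * N%:R + b'.

Let A_BE : A + B = 2%:P * 'X^2 + d1%:P * 'X + d0%:P.
Proof. by rewrite /A /B /d1 /d0 !(rmorphD, rmorphN, rmorphM, rmorphXn)/=; ring. Qed.

Let nodes x (i : 'I_N) : R := shifted_part R x i.+1.

Let nodes_inj x : injective (nodes x).
Proof.
move=> i j; rewrite /nodes => /eqP; apply: contraTeq => ij.
by apply: shifted_part_neq => // -[] /val_inj; exact/eqP.
Qed.

Lemma sig_rate_divdiff x (u v : R -> R) :
  \sum_(1 <= i < N.+1) (right_sig_rate rho x i * u (shifted_part R x i) + left_sig_rate rho' x i * v (shifted_part R x i)) =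
  \sum_i (A.[nodes x i] * u (nodes x i) *
    \prod_(j < N | j != i) ((nodes x i + 1 - nodes x j) / (nodes x i - nodes x j)) +
   B.[nodes x i] * v (nodes x i) *
    \prod_(j < N | j != i) ((nodes x i - 1 - nodes x j) / (nodes x i - nodes x j))).
Proof.
rewrite sum_ord1; apply: eq_bigr => i _.
rewrite right_sig_rateE// left_sig_rateE// AE BE !big_add1 !big_mkord.
by congr (_ + _); rewrite mulrAC.
Qed.

(** With polynomial rates the exit rate is a Lagrange sum, given by
    divdiff_shift. Since A - B is linear, its difference quotients are
    constant, and the remaining constants add up to rate_excess. *)
Lemma exit_rate x : (1 <= N)%N ->
  \sum_(1 <= i < N.+1) (right_sig_rate rho x i + left_sig_rate rho' x i) =
  free_rate x - rate_excess.
Proof.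
move=> N1; have := sig_rate_divdiff x (fun=> 1) (fun=> 1).
under eq_bigr do rewrite !mulr1.
under [in X in _ = X -> _]eq_bigr do rewrite !mulr1.
have sAB : (size (A + B)%R <= 3)%N.
  rewrite A_BE; apply/leq_sizeP => j j3; rewrite !coefE.
  by do !case: eqP; rewrite ?mulr0 ?addr0//; lia.
have sBA : (size (A - B)%R <= 2)%N.
  rewrite ABE; apply/leq_sizeP => j j3; rewrite !coefE.
  by do !case: eqP; rewrite ?mulr0 ?addr0//; lia.
move=> ->; rewrite divdiff_shift//; last by rewrite (leq_trans sBA).
rewrite (_ : (A + B)`_2 = 2); last first.
  by rewrite A_BE !coefE/=; ring.
rewrite [X in _ + X](_ : _ = 0) ?addr0; last by rewrite nth_default ?mul0rn// (leq_trans sBA).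
rewrite (sum_pairs_sym _ (fun y => (A - B).[y])).
have -> : \sum_i \sum_(j < N | j != i)
    ((A - B).[nodes x i] - (A - B).[nodes x j]) / (nodes x i - nodes x j) =
    \sum_(i < N) \sum_(j < N | j != i) c1.
  apply: eq_bigr => i _; apply: eq_bigr => j ji; rewrite !ABhorner.
  have h : nodes x i - nodes x j != 0.
    by rewrite subr_eq0; apply: contra_neq ji => /nodes_inj ->.
  by rewrite opprD addrACA subrr addr0 -mulrBr mulfK.
have -> : \sum_i (A + B).[nodes x i] = free_rate x.
  by rewrite /free_rate sum_ord1; apply: eq_bigr => i _; rewrite AE BE hornerD.
rewrite -addrA; congr (_ + _).
have -> : \sum_(i < N) \sum_(j < N | j != i) c1 = c1 * (N%:R * N.-1%:R).
  under eq_bigr do rewrite sumr_const cardC1 card_ord.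
  by rewrite sumr_const card_ord -[LHS]mulr_natr -[X in X * _ = _]mulr_natr -mulrA; congr (_ * _); exact: mulrC.
rewrite /rate_excess /c1.
under eq_bigr do rewrite sumr_const_nat subSS subn0.
have key (n : nat) : \sum_(1 <= l < n.+1) (2 * l%:R + a + a') *+ l =
   n%:R * n.+1%:R * n%:R - ('C(n.+1, 3))%:R *+ 2 + (a + a') * (n.+1%:R * n%:R) / 2
   :> R.
  elim: n => [|n IH]; first by rewrite big_geq// bin_small//; field.
  rewrite big_nat_recr//= IH -[X in _ + X = _]mulr_natr [in RHS]binS natrD.
  have -> : 'C(n.+1, 2)%:R = n.+1%:R * n%:R / 2 :> R.
    elim: {IH} n => [|n IH]; first by rewrite bin_small//; field.
    by rewrite binS bin1 natrD IH -!natr1; field.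
  by rewrite -!natr1; field.
have [n NE] : exists n, N = n.+1 by exists N.-1; lia.
have {}key := key n; move: key; rewrite -NE => ->; rewrite NE /= -!natr1.
by field.
Qed.

Definition sig_norm x : R := 1 + \sum_(1 <= i < N.+1) shifted_part R x i ^+ 2.

(** The rates of right and left jumps have the same leading term, so their
    difference A - B is linear. The increments 2 l + 1 and 1 - 2 l are
    opposite up to a constant, and hence divdiff_shift applies with a
    polynomial of degree 2 and a cubic one, whose difference quotients are
    again quadratic. *)
Lemma sig_drift_le : (1 <= N)%N -> exists c, forall x,
  \sum_(1 <= i < N.+1) (right_sig_rate rho x i * (2 * shifted_part R x i + 1) +
                        left_sig_rate rho' x i * (1 - 2 * shifted_part R x i)) <= c * sig_norm x.
Proof.
move=> N1; pose U : {poly R} := 2%:P * 'X + 1; pose W : {poly R} := 1 - 2%:P * 'X.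
have UE y : U.[y] = 2 * y + 1 by rewrite /U hornerD hornerM !hornerC hornerX.
have WE y : W.[y] = 1 - 2 * y by rewrite /W hornerD hornerN hornerM !hornerC hornerX.
have sU : (size U <= 2)%N.
  apply/leq_sizeP => j j3; rewrite /U !coefE.
  by do !case: eqP; rewrite ?mulr0 ?addr0//; lia.
have s2X : (size (2%:P * 'X : {poly R})%R <= 2)%N.
  apply/leq_sizeP => j j3; rewrite !coefE.
  by do !case: eqP; rewrite ?mulr0 ?addr0//; lia.
have sAB : (size (A + B)%R <= 3)%N.
  rewrite A_BE; apply/leq_sizeP => j j3; rewrite !coefE.
  by do !case: eqP; rewrite ?mulr0 ?addr0//; lia.
have sBA : (size (A - B)%R <= 2)%N.
  rewrite ABE; apply/leq_sizeP => j j3; rewrite !coefE.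
  by do !case: eqP; rewrite ?mulr0 ?addr0//; lia.
pose P := A * U + B * W; pose D := A * U - B * W.
have PE : P = (A - B) * (2%:P * 'X) + (A + B) by rewrite /P /U /W; ring.
have DE : D = (A + B) * (2%:P * 'X) + (A - B) by rewrite /D /U /W; ring.
have sP : (size P <= 3)%N.
  rewrite PE (leq_trans (size_polyD _ _))// geq_max sAB andbT.
  by rewrite (leq_trans (size_polyMleq _ _))//; lia.
have sD : (size D <= 4)%N.
  rewrite DE (leq_trans (size_polyD _ _))// geq_max (leq_trans sBA)// andbT.
  by rewrite (leq_trans (size_polyMleq _ _))//; lia.
have [K K0 hK] := horner_quadratic_le sP.
have [L L0 hL] := horner_cubic_slope_le sD.
pose C := P`_2 *+ 'C(N, 3) + D`_3 *+ 'C(N, 4).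
exists (K * (N%:R + 1) + L * (N%:R ^+ 2 + 2 * N%:R) + `|C|) => x.
have := sig_rate_divdiff x (fun y => 2 * y + 1) (fun y => 1 - 2 * y).
rewrite /= => ->.
apply: (@le_trans _ _ (\sum_i ((A * U).[nodes x i] *
    \prod_(j < N | j != i) ((nodes x i + 1 - nodes x j) / (nodes x i - nodes x j)) +
   (B * W).[nodes x i] *
    \prod_(j < N | j != i) ((nodes x i - 1 - nodes x j) / (nodes x i - nodes x j))))).
  by apply: ler_sum => i _; rewrite !hornerM UE WE.
rewrite divdiff_shift// -/P -/D -addrA -/C (sum_pairs_sym _ (fun y => D.[y])).
pose S := \sum_(i < N) nodes x i ^+ 2.
have S0 : 0 <= S by apply: sumr_ge0 => i _; exact: sqr_ge0.
have nE : sig_norm x = 1 + S by rewrite /sig_norm sum_ord1.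
have h1 : \sum_i P.[nodes x i] <= K * (N%:R + S).
  apply: (le_trans (ler_sum _ (fun i _ => hK (nodes x i)))).
  by rewrite -mulr_sumr big_split/= sumr_const card_ord.
have h2 : \sum_i \sum_(j < N | j != i) (D.[nodes x i] - D.[nodes x j]) / (nodes x i - nodes x j)
    <= L * (N%:R ^+ 2 + 2 * N%:R * S).
  apply: (@le_trans _ _ (\sum_(i < N) \sum_(j < N) L * (1 + nodes x i ^+ 2 + nodes x j ^+ 2))).
    apply: ler_sum => i _; rewrite big_mkcond/=; apply: ler_sum => j _.
    case: ifP => [ji|_]; last by rewrite mulr_ge0// !addr_ge0// sqr_ge0.
    by apply: hL; apply: contraTneq ji => /nodes_inj ->; rewrite eqxx.
  rewrite le_eqVlt; apply/orP; left; apply/eqP.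
  under eq_bigr do rewrite -mulr_sumr big_split/= sumr_const card_ord -/S.
  rewrite -mulr_sumr big_split/= sumr_const card_ord sumrMnl big_split/= sumr_const card_ord -/S.
  by ring.
have hC : C <= `|C| := ler_norm C.
have hC0 : 0 <= `|C| by [].
have N0 : 0 <= N%:R :> R by [].
rewrite nE.
have h3 : K * (N%:R + S) <= K * (N%:R + 1) * (1 + S).
  rewrite -[leRHS]mulrA ler_wpM2l// mulrDr mulr1 mulrDl mul1r.
  have q1 : 0 <= N%:R * S by rewrite mulr_ge0.
  by lra.
have h4 : L * (N%:R ^+ 2 + 2 * N%:R * S) <= L * (N%:R ^+ 2 + 2 * N%:R) * (1 + S).
  rewrite -[leRHS]mulrA ler_wpM2l// mulrDr mulr1 mulrDl.
  have q1 : 0 <= N%:R ^+ 2 * S by rewrite mulr_ge0.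
  by lra.
have h5 : 0 <= `|C| * S by rewrite mulr_ge0.
have h6 : 0 <= L * (N%:R ^+ 2 + 2 * N%:R * S).
  by rewrite mulr_ge0// addr_ge0 ?mulr_ge0.
rewrite [leRHS]mulrDl [X in _ <= X + _]mulrDl.
apply: lerD; last by rewrite (le_trans hC)// ler_peMr// lerDl.
apply: lerD; first exact: le_trans h1 h3.
apply: le_trans h4; rewrite ler_pdivrMl//; apply: (le_trans h2).
by rewrite ler_peMl// ler1n.
Qed.

End Quadratic.
End ExitRates.

(** * Growth of even powers under unit steps *)

Section PowerGrowth.
Variable R : realType.
Implicit Types (x y h A B : R) (q : nat).

Lemma step_norm_le y h : 1 <= y -> h ^+ 2 <= 6 * y -> `|h| <= 3 * y.
Proof.
move=> y1 hh; rewrite -(ler_pXn2r (_ : (0 < 2)%N)) ?nnegrE// ?real_normK ?num_real//.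
  by nra.
by rewrite mulr_ge0//; lra.
Qed.

(** First-order expansion of a power at y, for steps h of the order of the
    square root of y, as produced by a unit step of x in y = 1 + x^2: then
    h^2 is at most of order y, and the second-order term h^2 y^(q-1) is of
    order y^q. *)
Lemma power_step q : exists2 C : R, 0 <= C & forall y h, 1 <= y -> h ^+ 2 <= 6 * y ->
  `|(y + h) ^+ q.+1 - y ^+ q.+1 - q.+1%:R * h * y ^+ q| <= C * y ^+ q.
Proof.
elim: q => [|q [C C0 IH]].
  exists 0 => // y h _ _; rewrite !expr1 expr0 mulr1 mul1r mul0r.
  by rewrite (_ : _ - _ - _ = 0) ?normr0//; ring.
exists (6 * q.+1%:R + 4 * C); first by rewrite addr_ge0 ?mulr_ge0.
move=> y h y1 hh; have h3 := step_norm_le y1 hh.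
have y0 : 0 <= y by lra.
have yh : `|y + h| <= 4 * y.
  by rewrite (le_trans (ler_normD _ _))// (ger0_norm y0); lra.
set E := (y + h) ^+ q.+1 - y ^+ q.+1 - q.+1%:R * h * y ^+ q.
rewrite (_ : _ - _ - _ = q.+1%:R * (h ^+ 2 * y ^+ q) + (y + h) * E); last first.
  by rewrite /E -[q.+2%:R]natr1 !exprS; ring.
rewrite (le_trans (ler_normD _ _))// [leRHS]mulrDl; apply: lerD.
  have yq0 : 0 <= y ^+ q by exact: exprn_ge0.
  have hq : 0 <= q.+1%:R * (h ^+ 2 * y ^+ q) by rewrite mulr_ge0// mulr_ge0// sqr_ge0.
  rewrite ger0_norm// (_ : 6 * _ * _ = q.+1%:R * (6 * y * y ^+ q)); last by rewrite exprS; ring.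
  by rewrite ler_wpM2l// ler_wpM2r.
rewrite normrM exprS mulrACA; apply: ler_pM => //; exact: IH.
Qed.

Definition height q x : R := (1 + x ^+ 2) ^+ q.

Lemma height_ge1 q x : 1 <= height q x.
Proof. by apply: exprn_ege1; rewrite lerDl sqr_ge0. Qed.

Lemma heightN q x : height q (- x) = height q x.
Proof. by rewrite /height sqrrN. Qed.

Lemma height_mono q q' x : (q <= q')%N -> height q x <= height q' x.
Proof. by move=> qq; apply: ler_weXn2l => //; rewrite lerDl sqr_ge0. Qed.

(** If A and B are of order 1 + x^2 and their drift on 1 + x^2 cancels to
    the same order, then the drift on a power is of the order of that
    power. Without the cancellation, one more factor 1 + x^2 is lost. *)
Lemma height_drift q (M : R) : 0 <= M -> exists2 C, 0 <= C & forall x A B,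
  0 <= A -> 0 <= B -> A <= M * height 1 x -> B <= M * height 1 x ->
  [/\ A * (2 * x + 1) + B * (1 - 2 * x) <= M * height 1 x ->
        A * (height q.+1 (x + 1) - height q.+1 x) +
        B * (height q.+1 (x - 1) - height q.+1 x) <= C * height q.+1 x,
      A * (height q.+1 (x + 1) - height q.+1 x) <= C * height q.+2 x
    & B * (height q.+1 (x - 1) - height q.+1 x) <= C * height q.+2 x].
Proof.
move=> M0; have [C C0 hC] := power_step q.
exists (M * (3 * q.+1%:R + 2 * C)); first by rewrite mulr_ge0// addr_ge0// mulr_ge0.
move=> x A B A0 B0; rewrite {1 2}/height expr1 => AM BM.
have x20 : 0 <= x ^+ 2 by exact: sqr_ge0.
rewrite /height; set y := 1 + x ^+ 2 in AM BM *.
have y1 : 1 <= y by rewrite lerDl.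
have y0 : 0 <= y by lra.
have yp : y + (2 * x + 1) = 1 + (x + 1) ^+ 2 by rewrite /y; ring.
have ym : y + (1 - 2 * x) = 1 + (x - 1) ^+ 2 by rewrite /y; ring.
have hp2 : (2 * x + 1) ^+ 2 <= 6 * y by rewrite /y; nra.
have hm2 : (1 - 2 * x) ^+ 2 <= 6 * y by rewrite /y; nra.
have := hC y _ y1 hp2; have := hC y _ y1 hm2; rewrite yp ym.
set yq := y ^+ q; have yq0 : 0 <= yq by exact: exprn_ge0.
rewrite !ler_norml => /andP[_ em] /andP[_ ep].
have hp := step_norm_le y1 hp2; have hm := step_norm_le y1 hm2.
have ySS : y ^+ q.+2 = y * (y * yq) by rewrite !exprS.
have yS : y ^+ q.+1 = y * yq by rewrite exprS.
have n0 : 0 <= q.+1%:R :> R by [].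
move: hp hm; rewrite !ler_norml => /andP[_ hp] /andP[_ hm].
set dp := (1 + (x + 1) ^+ 2) ^+ q.+1 - y ^+ q.+1 in ep *.
set dm := (1 + (x - 1) ^+ 2) ^+ q.+1 - y ^+ q.+1 in em *.
rewrite ySS yS.
have crude Z d h : 0 <= Z -> Z <= M * y -> h <= 3 * y ->
    d - q.+1%:R * h * yq <= C * yq -> Z * d <= M * (3 * q.+1%:R + 2 * C) * (y * (y * yq)).
  move=> Z0 ZM h3 hd.
  have d1 : d <= (3 * q.+1%:R + 2 * C) * (y * yq).
    have t1 : q.+1%:R * h * yq <= q.+1%:R * (3 * y) * yq by rewrite ler_wpM2r// ler_wpM2l.
    have t2 : C * yq <= C * (y * yq) by rewrite ler_wpM2l// ler_peMl.
    have t3 : 0 <= C * (y * yq) by rewrite !mulr_ge0.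
    lra.
  have d2 : 0 <= (3 * q.+1%:R + 2 * C) * (y * yq) by rewrite !mulr_ge0// addr_ge0// mulr_ge0.
  rewrite (le_trans (ler_wpM2l Z0 d1))// (le_trans (ler_wpM2r d2 ZM))//.
  by rewrite le_eqVlt; apply/orP; left; apply/eqP; ring.
split=> [AB||]; [|exact: crude ep|exact: crude em].
have a1 : A * dp <= A * (q.+1%:R * (2 * x + 1) * yq + C * yq) by rewrite ler_wpM2l//; lra.
have b1 : B * dm <= B * (q.+1%:R * (1 - 2 * x) * yq + C * yq) by rewrite ler_wpM2l//; lra.
have c1 : q.+1%:R * yq * (A * (2 * x + 1) + B * (1 - 2 * x)) <= q.+1%:R * yq * (M * y).
  by rewrite ler_wpM2l// mulr_ge0.
have c2 : C * yq * A <= C * yq * (M * y) by rewrite ler_wpM2l// mulr_ge0.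
have c3 : C * yq * B <= C * yq * (M * y) by rewrite ler_wpM2l// mulr_ge0.
have c4 : 0 <= q.+1%:R * yq * (M * y) by rewrite !mulr_ge0.
rewrite (le_trans (lerD a1 b1))//; lra.
Qed.

Lemma height_drift_unif n (M : R) : 0 <= M -> exists2 C, 0 <= C & forall q x A B, (q < n)%N ->
  0 <= A -> 0 <= B -> A <= M * height 1 x -> B <= M * height 1 x ->
  [/\ A * (2 * x + 1) + B * (1 - 2 * x) <= M * height 1 x ->
        A * (height q.+1 (x + 1) - height q.+1 x) +
        B * (height q.+1 (x - 1) - height q.+1 x) <= C * height q.+1 x,
      A * (height q.+1 (x + 1) - height q.+1 x) <= C * height q.+2 x
    & B * (height q.+1 (x - 1) - height q.+1 x) <= C * height q.+2 x].
Proof.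
move=> M0; elim: n => [|n [C C0 IH]]; first by exists 0.
have [D D0 hD] := height_drift n M0.
exists (C + D); first exact: addr_ge0.
move=> q x A B; rewrite ltnS leq_eqVlt => /predU1P[->|qn] A0 B0 AM BM.
  have [h1 h2 h3] := hD x A B A0 B0 AM BM.
  split=> [/h1 h||]; apply: le_trans; [exact: h| |exact: h2| |exact: h3|];
    by rewrite ler_wpM2r ?lerDr// (le_trans ler01) ?height_ge1.
have [h1 h2 h3] := IH q x A B qn A0 B0 AM BM.
split=> [/h1 h||]; apply: le_trans; [exact: h| |exact: h2| |exact: h3|];
  by rewrite ler_wpM2r ?lerDl// (le_trans ler01) ?height_ge1.
Qed.

(** The cubic terms in x cancel in the drift, as both rates are monic. The
    constant M is uniform in the position (k, i), since the shifts of the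
    argument are bounded by n. *)
Lemma quad_rates_le (a b a' b' : R) n : exists2 M : R, 0 <= M &
  forall (x : int) i k, (i <= n)%N -> (k <= n)%N ->
  [/\ quad a b (x - i%:Z + 1) <= M * height 1 x%:~R,
      quad a' b' (- x - k%:Z + i%:Z) <= M * height 1 x%:~R
    & quad a b (x - i%:Z + 1) * (2 * x%:~R + 1) + quad a' b' (- x - k%:Z + i%:Z) * (1 - 2 * x%:~R)
      <= M * height 1 x%:~R].
Proof.
pose al := 2 * (n%:R + 1) + `|a| + `|a'|.
pose be := (n%:R + 1) ^+ 2 + (`|a| + `|a'|) * (n%:R + 1) + `|b| + `|b'|.
have n0 : 0 <= n%:R :> R by [].
have al0 : 0 <= al by rewrite !addr_ge0// mulr_ge0// addr_ge0.
have be0 : 0 <= be by rewrite !addr_ge0// ?exprn_ge0 ?mulr_ge0 ?addr_ge0.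
exists (6 * (1 + al + be)); first by rewrite mulr_ge0// !addr_ge0.
move=> z i k iN kN; rewrite /height expr1; set x : R := z%:~R.
have iR : i%:R <= n%:R :> R by rewrite ler_nat.
have kR : k%:R <= n%:R :> R by rewrite ler_nat.
have i0 : 0 <= i%:R :> R by [].
have k0 : 0 <= k%:R :> R by [].
pose u := 1 - i%:R : R; pose v := k%:R - i%:R : R.
have uN : `|u| <= n%:R + 1 by rewrite ler_norml /u; apply/andP; split; lra.
have vN : `|v| <= n%:R + 1 by rewrite ler_norml /v; apply/andP; split; lra.
have -> : quad a b (z - i%:Z + 1) = x ^+ 2 + (2 * u - a) * x + (u ^+ 2 - a * u + b).
  by rewrite /quad !(rmorphD, rmorphN)/= rmorph1 -!pmulrn /u -/x; ring.
have -> : quad a' b' (- z - k%:Z + i%:Z) = x ^+ 2 + (2 * v + a') * x + (v ^+ 2 + a' * v + b').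
  by rewrite /quad !(rmorphD, rmorphN)/= -!pmulrn /v -/x; ring.
have cst w c d : `|w| <= n%:R + 1 -> `|c| <= `|a| + `|a'| -> `|d| <= `|b| + `|b'| ->
    `|2 * w + c| <= al /\ `|w ^+ 2 + c * w + d| <= be.
  move=> hw hc hd; split.
    rewrite (le_trans (ler_normD _ _))// normrM (ger0_norm (_ : 0 <= 2 :> R))// /al -addrA.
    by rewrite lerD// ler_wpM2l.
  rewrite (le_trans (ler_normD _ _))// /be -addrA lerD//.
  rewrite (le_trans (ler_normD _ _))// lerD//.
    by rewrite normrX lerXn2r ?nnegrE// addr_ge0.
  by rewrite normrM ler_pM.
have hma : `|- a| <= `|a| + `|a'| by rewrite normrN lerDl.
have ha' : `|a'| <= `|a| + `|a'| by rewrite lerDr.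
have hb : `|b| <= `|b| + `|b'| by rewrite lerDl.
have hb' : `|b'| <= `|b| + `|b'| by rewrite lerDr.
have [p1 q1] := cst u (- a) b uN hma hb.
have [p2 q2] := cst v a' b' vN ha' hb'.
rewrite mulNr in q1; rewrite {cst}.
set p := 2 * u - a in p1 *; set q := u ^+ 2 - a * u + b in q1 *.
set p' := 2 * v + a' in p2 *; set q' := v ^+ 2 + a' * v + b' in q2 *.
have x2 : 0 <= x ^+ 2 by exact: sqr_ge0.
have hx : `|x| <= 1 + x ^+ 2 by rewrite ler_norml; apply/andP; split; nra.
have lin c d : `|c| <= d -> c * x <= d * (1 + x ^+ 2).
  by move=> cd; rewrite (le_trans (ler_norm _))// normrM ler_pM.
have px := lin _ _ p1; have px' := lin _ _ p2.
have qx : `|q - q'| <= be + be by rewrite (le_trans (ler_normB _ _))// lerD.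
have qqx := lin _ _ qx.
have pp : (p - p') * x ^+ 2 <= (al + al) * x ^+ 2.
  rewrite ler_wpM2r// (le_trans (ler_norm _))// (le_trans (ler_normB _ _))// lerD//.
have q1' := le_trans (ler_norm _) q1; have q2' := le_trans (ler_norm _) q2.
have be1 : 0 <= be * x ^+ 2 by rewrite mulr_ge0.
have al1 : 0 <= al * x ^+ 2 by rewrite mulr_ge0.
have E1 : (x ^+ 2 + p * x + q) * (2 * x + 1) + (x ^+ 2 + p' * x + q') * (1 - 2 * x) =
  2 * ((p - p') * x ^+ 2) + 2 * ((q - q') * x) + (x ^+ 2 + p * x + q) + (x ^+ 2 + p' * x + q').
  by ring.
split; [lra|lra|rewrite E1; lra].
Qed.

End PowerGrowth.

(** * Drift on schemes *)

Section SchemeDrift.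
Variables (R : realType) (N : nat) (a b a' b' : R).
Hypothesis N1 : (1 <= N)%N.
Local Notation rho := (quad a b).
Local Notation rho' := (quad a' b').
Hypothesis rho_ge0 : forall y, 0 <= rho y.
Hypothesis rho'_ge0 : forall y, 0 <= rho' y.
Implicit Types (s : scheme N).

(** The exponent decreases with the level: a term on level k that lost a
    factor 1 + x^2 is then bounded by the term of an entry with the same
    value on a lower level. *)
Definition scheme_norm s : R :=
  \sum_(1 <= k < N.+1) \sum_(1 <= i < k.+1) height (N - k).+1 (entry s k i)%:~R.

Let h0 q (x : R) : 0 <= height q x. Proof. exact: le_trans (height_ge1 q x). Qed.

Lemma height_le_norm s k i q : (1 <= i)%N -> (i <= k)%N -> (k <= N)%N -> (q <= (N - k).+1)%N ->
  height q (entry s k i)%:~R <= scheme_norm s :> R.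
Proof.
move=> i1 ik kN qk; apply: (le_trans (height_mono _ qk)).
rewrite /scheme_norm (bigD1_seq k) ?iota_uniq//=; last by rewrite mem_index_iota; lia.
rewrite (bigD1_seq i) ?iota_uniq//=; last by rewrite mem_index_iota; lia.
rewrite -addrA lerDl addr_ge0//; first by apply: sumr_ge0 => *; exact: h0.
by apply: sumr_ge0 => *; apply: sumr_ge0 => *; exact: h0.
Qed.

Lemma scheme_norm_ge1 s : 1 <= scheme_norm s.
Proof. by apply: le_trans (height_le_norm s (leqnn 1) (leqnn 1) N1 (leq0n _)); rewrite /height expr0. Qed.

Lemma scheme_norm_reflect s : scheme_norm (reflect_scheme s) = scheme_norm s.
Proof.
apply: eq_big_nat => k /andP[k1 kN]; rewrite [RHS]sum_rev1; apply: eq_big_nat => i /andP[i1 ik].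
by rewrite entry_reflect_scheme// rmorphN/= heightN.
Qed.

Let jump k (x : R) : R := height (N - k).+1 (x + 1) - height (N - k).+1 x.

Lemma right_norm_jump s k i : (1 <= i)%N -> (i <= k)%N -> (k <= N)%N -> ~~ right_blocked s k i ->
  scheme_norm (right_target s k i) - scheme_norm s =
  \sum_(1 <= j < N.+1) if (k <= j <= right_reach s k i)%N then jump j (entry s k i)%:~R else 0.
Proof.
move=> i1 ik kN nb; have [kL LN eqL neqL] := right_reachP s i kN.
rewrite /scheme_norm -sumrB; apply: eq_big_nat => j /andP[j1 jN]; rewrite -sumrB.
case: ifPn => [/andP[kj jL]|nkj].
  rewrite (bigD1_seq i) ?iota_uniq//=; last by rewrite mem_index_iota; lia.
  rewrite entry_right_target//; last by lia.
  rewrite /right_entry kj jL eqxx/= rmorphD/= rmorph1 eqL// -/(jump j _).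
  rewrite big_seq_cond big1 ?addr0// => m; rewrite mem_index_iota => /andP[/andP[m1 mj] mi].
  rewrite entry_right_target//.
  by rewrite /right_entry (negPf mi) andbF addr0 subrr.
rewrite big_nat big1// => m /andP[m1 mj]; rewrite entry_right_target//.
by rewrite /right_entry (negPf nkj)/= addr0 subrr.
Qed.

(** A right jump at (k, i) also raises equal entries on the levels above.
    Each of these levels costs C times the norm, because its exponent is
    smaller than that of level k. *)
Lemma right_drift_le f C s k i : 0 <= C -> (forall y, 0 <= f y) ->
  (1 <= i)%N -> (i <= k)%N -> (k <= N)%N ->
  (forall j, (k < j)%N -> (j <= N)%N ->
     right_jump_rate f s (k, i) * jump j (entry s k i)%:~R <= C * scheme_norm s) ->
  right_jump_rate f s (k, i) * (scheme_norm (right_target s k i) - scheme_norm s) <=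
  right_jump_rate f s (k, i) * jump k (entry s k i)%:~R + N%:R * (C * scheme_norm s).
Proof.
move=> C0 f0 i1 ik kN hC.
have n0 : 0 <= C * scheme_norm s by rewrite mulr_ge0// (le_trans ler01)// scheme_norm_ge1.
have [bl|nb] := boolP (right_blocked s k i).
  by rewrite /right_jump_rate/= bl !mul0r add0r mulr_ge0.
have [kL LN eqL neqL] := right_reachP s i kN.
rewrite right_norm_jump// (bigD1_seq k) ?iota_uniq//=; last by rewrite mem_index_iota; lia.
rewrite leqnn kL mulrDr lerD2l mulr_sumr.
apply: (@le_trans _ _ (\sum_(1 <= j < N.+1) C * scheme_norm s)); last first.
  by rewrite sumr_const_nat subn1 mulr_natl.
rewrite big_mkcond big_nat [leRHS]big_nat; apply: ler_sum => j /andP[j1 jN].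
case: ifP => // jk; case: ifPn => [/andP[kj jL]|_]; last by rewrite mulr0.
by apply: hC; lia.
Qed.

(** For each entry, if neither jump is blocked, the left and right drifts
    cancel to the order of its own term. If one is blocked, the other costs
    an extra factor 1 + x^2, but the blocking entry has the same value and
    lies one level below, where the exponent is larger by 1. Pushed entries
    are handled by right_drift_le. *)
Lemma scheme_drift_le : exists c, forall s,
  \sum_(p <- triangle N) right_jump_rate rho s p * (scheme_norm (right_target s p.1 p.2) - scheme_norm s) +
  \sum_(p <- triangle N) right_jump_rate rho' (reflect_scheme s) p *
     (scheme_norm (reflect_scheme (right_target (reflect_scheme s) p.1 p.2)) - scheme_norm s) <= c * scheme_norm s.
Proof.
have [M M0 hM] := quad_rates_le a b a' b' N.
have [C C0 hC] := height_drift_unif N.+1 M0.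
pose K := C + (N%:R * C + N%:R * C).
(* Each entry costs C for its own term, and N times C for the pushes in
   either direction. *)
exists (\sum_(p <- triangle N) K) => s; set V := scheme_norm s.
have V1 : 1 <= V by exact: scheme_norm_ge1.
have V0 : 0 <= V by exact: le_trans V1.
under [X in _ + X]eq_bigr do rewrite scheme_norm_reflect -[V](scheme_norm_reflect s).
have xE k i : (1 <= i)%N -> (i <= k)%N -> (k <= N)%N ->
  (entry (reflect_scheme s) k (k.+1 - i)%N)%:~R = - (entry s k i)%:~R :> R.
  move=> i1 ik kN; rewrite entry_reflect_scheme; [|lia..].
  by rewrite rmorphN/= (_ : (k.+1 - (k.+1 - i) = i)%N)//; lia.
have rE k i : (1 <= i)%N -> (i <= k)%N -> (k <= N)%N ->
  right_jump_rate rho' (reflect_scheme s) (k, (k.+1 - i)%N) =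
  if left_blocked s k i then 0 else rho' (- entry s k i - k%:Z + i%:Z).
  move=> i1 ik kN; rewrite /right_jump_rate/= left_blockedE// entry_reflect_scheme; [|lia..].
  by case: ifP => // _; congr rho'; rewrite (_ : (k.+1 - (k.+1 - i) = i)%N); lia.
rewrite [X in _ + X]sum_triangle_rev !sum_triangle.
rewrite mulr_suml -big_split/= big_nat [leRHS]big_nat; apply: ler_sum => k /andP[k1 kN].
rewrite mulr_suml -big_split/= big_nat [leRHS]big_nat; apply: ler_sum => i /andP[i1 ik].
have {}kN : (k <= N)%N by lia.
have {}ik : (i <= k)%N by lia.
set x : R := (entry s k i)%:~R.
have [A1 B1 AB] := hM (entry s k i) i k (leq_trans ik kN) kN.
set A := rho _ in A1 AB; set B := rho' _ in B1 AB; rewrite -/x in A1 B1 AB.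
have A0 : 0 <= A := rho_ge0 _.
have B0 : 0 <= B := rho'_ge0 _.
have leV q k' i' : (1 <= i')%N -> (i' <= k')%N -> (k' <= N)%N -> (q <= (N - k').+1)%N ->
    C * height q (entry s k' i')%:~R <= C * V.
  by move=> *; rewrite ler_wpM2l//; exact: height_le_norm.
have CV : 0 <= C * V by rewrite mulr_ge0.
have heightB q : height q (- x + 1) = height q (x - 1).
  by rewrite -heightN opprD opprK.
have jr j : (k < j)%N -> (j <= N)%N -> A * jump j x <= C * V.
  move=> kj jN; have [_ h _] := hC (N - j)%N x A B (leq_ltn_trans (leq_subr j N) (ltnSn N)) A0 B0 A1 B1.
  have hq : ((N - j).+2 <= (N - k).+1)%N by clear -kj jN; lia.
  exact: le_trans h (leV _ k i i1 ik kN hq).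
have jl j : (k < j)%N -> (j <= N)%N -> B * jump j (- x) <= C * V.
  move=> kj jN; have [_ _ h] := hC (N - j)%N x A B (leq_ltn_trans (leq_subr j N) (ltnSn N)) A0 B0 A1 B1.
  rewrite /jump heightN heightB.
  have hq : ((N - j).+2 <= (N - k).+1)%N by clear -kj jN; lia.
  exact: le_trans h (leV _ k i i1 ik kN hq).
have [own ownr ownl] := hC (N - k)%N x A B (leq_ltn_trans (leq_subr k N) (ltnSn N)) A0 B0 A1 B1.
have {}own := own AB.
have jlE : jump k (- x) = height (N - k).+1 (x - 1) - height (N - k).+1 x.
  by rewrite /jump heightN heightB.
apply: (@le_trans _ _ (
  (right_jump_rate rho s (k, i) * jump k x + N%:R * (C * V)) +
  (right_jump_rate rho' (reflect_scheme s) (k, (k.+1 - i)%N) * jump k (- x) + N%:R * (C * V)))).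
  apply: lerD.
    apply: (@right_drift_le rho C s k i C0 rho_ge0 i1 ik kN) => j kj jN.
    rewrite /right_jump_rate; case: ifP => _; first by rewrite mul0r.
    exact: jr.
  have i'1 : (1 <= k.+1 - i)%N by clear -ik; lia.
  have i'k : (k.+1 - i <= k)%N by clear -i1 ik; lia.
  have := @right_drift_le rho' C (reflect_scheme s) k (k.+1 - i) C0 rho'_ge0 i'1 i'k kN.
  rewrite xE// -/x scheme_norm_reflect -/V; apply => j kj jN.
  rewrite rE//; case: ifP => _; first by rewrite mul0r.
  exact: jl.
rewrite rE// /right_jump_rate/= -/A -/B /K.
suff : (if right_blocked s k i then 0 else A) * jump k x +
    (if left_blocked s k i then 0 else B) * jump k (- x) <= C * V.
  move=> h; rewrite addrACA (_ : (C + _) * V = C * V + (N%:R * (C * V) + N%:R * (C * V))).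
    by rewrite lerD2r.
  by ring.
have [rb|nrb] := boolP (right_blocked s k i).
  rewrite mul0r add0r; case: ifP => _; first by rewrite mul0r.
  move: rb; rewrite /right_blocked => /andP[i2 /eqP e].
  rewrite jlE; apply: (le_trans ownl); rewrite /x e.
  by apply: leV; clear -i2 ik kN; lia.
have [lb|nlb] := boolP (left_blocked s k i).
  move: lb; rewrite /left_blocked => /andP[i2 /eqP e].
  rewrite mul0r addr0; apply: (le_trans ownr); rewrite /x e.
  by apply: leV; clear -i1 i2 kN; lia.
by rewrite jlE; apply: (le_trans own); exact: leV.
Qed.

End SchemeDrift.

(** * Both rate matrices as moves *)

Section QuadraticRates.
Variable R : realType.
Implicit Types z w : R[i].

Definition par_sum z z' : R := complex.Re (z + z').
Definition par_prod z z' : R := complex.Re (z * z').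

Lemma Re_quad z z' (y : int) :
  complex.Re ((y%:~R - z) * (y%:~R - z')) = quad (par_sum z z') (par_prod z z') y.
Proof.
rewrite -(rmorph_int (real_complex R)); case: z => a b; case: z' => a' b'.
by rewrite /quad /par_sum /par_prod /=; ring.
Qed.

Lemma quad_ge0 z z' (y : int) :
  (forall k : int, 0 < (z + k%:~R) * (z' + k%:~R)) -> 0 <= quad (par_sum z z') (par_prod z z') y.
Proof.
move=> h; rewrite -Re_quad; have := h (- y).
rewrite rmorphN /= (_ : (z - _) * _ = (y%:~R - z) * (y%:~R - z')); last by ring.
by rewrite ltcE => /andP[_ /ltW].
Qed.

End QuadraticRates.

Section SchemeMoves.
Variables (R : realType) (N : nat) (z z' w w' : R[i]).
Local Notation rho := (quad (par_sum z z') (par_prod z z')).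
Local Notation rho' := (quad (par_sum w w') (par_prod w w')).
Implicit Types (s : scheme N) (x y : signature N).

(** The boolean is true for right moves. *)
Definition scheme_moves : seq (bool * (nat * nat)) := [seq (d, p) | d <- [:: true; false], p <- triangle N].

Definition scheme_rate s (m : bool * (nat * nat)) : R :=
  if m.1 then right_jump_rate rho s m.2 else right_jump_rate rho' (reflect_scheme s) m.2.

Definition scheme_target s (m : bool * (nat * nat)) : scheme N :=
  if m.1 then right_target s m.2.1 m.2.2 else reflect_scheme (right_target (reflect_scheme s) m.2.1 m.2.2).

Lemma sum_scheme_moves (W : nmodType) (F : bool * (nat * nat) -> W) :
  \sum_(m <- scheme_moves) F m = \sum_(p <- triangle N) F (true, p) + \sum_(p <- triangle N) F (false, p).
Proof. by rewrite /scheme_moves big_allpairs big_cons big_seq1. Qed.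

Lemma scheme_ratesE s s' :
  \sum_(1 <= k < N.+1) \sum_(1 <= i < k.+1)
      ((if right_move s k i s' then right_rate z z' s k i else 0) +
       (if left_move s k i s' then left_rate w w' s k i else 0)) =
  \sum_(m <- scheme_moves) (if scheme_target s m == s' then scheme_rate s m else 0).
Proof.
rewrite sum_scheme_moves sum_triangle sum_triangle_rev -big_split/=.
apply: eq_big_nat => k /andP[k1 kN]; rewrite -big_split; apply: eq_big_nat => i /andP[i1 ik].
rewrite /scheme_target /scheme_rate /right_jump_rate /=; congr (_ + _).
  rewrite right_moveE// /right_rate Re_quad.
  by case: right_blocked; case: eqP.
rewrite left_moveE// /left_rate entry_reflect_scheme//; [|lia..].
rewrite (_ : (k.+1 - (k.+1 - i) = i)%N); last by lia.
have -> : complex.Re (((entry s k i + k%:Z - i%:Z)%:~R + w) * ((entry s k i + k%:Z - i%:Z)%:~R + w')) =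
    rho' (- entry s k i - (k.+1 - i)%N%:Z + 1).
  rewrite -Re_quad; congr complex.Re.
  have -> : - entry s k i - (k.+1 - i)%N%:Z + 1 = - (entry s k i + k%:Z - i%:Z) by lia.
  by rewrite rmorphN; ring.
by case: right_blocked; case: eqP.
Qed.

Definition sig_moves : seq (bool * nat) := [seq (d, i) | d <- [:: true; false], i <- index_iota 1 N.+1].

Definition sig_rate x (m : bool * nat) : R :=
  if m.1 then right_sig_rate rho x m.2 else left_sig_rate rho' x m.2.

Definition sig_target x (m : bool * nat) : signature N :=
  if m.1 then raise x m.2 else lower x m.2.

Lemma sum_sig_moves (W : nmodType) (F : bool * nat -> W) :
  \sum_(m <- sig_moves) F m = \sum_(1 <= i < N.+1) (F (true, i) + F (false, i)).
Proof. by rewrite /sig_moves big_allpairs big_cons big_seq1 [RHS]big_split. Qed.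

Lemma plus_eP x i y :
  reflect (forall j, (1 <= j)%N -> (j <= N)%N -> part y j = part x j + if j == i then 1 else 0)
    (plus_e x i y).
Proof.
apply: (iffP allP) => h j.
  by move=> j1 jN; apply/eqP/h; rewrite mem_iota; lia.
by rewrite mem_iota => hj; apply/eqP/h; lia.
Qed.

Lemma plus_e_raise x i y : (1 <= i)%N -> (i <= N)%N -> plus_e x i y = raisable x i && (raise x i == y).
Proof.
move=> i1 iN; apply/plus_eP/andP => [h|[ok /eqP <-] j j1 jN]; last exact: part_raise.
have ok : raisable x i.
  rewrite /raisable; have [//|i_neq1] := eqVneq i 1%N; rewrite /=.
  have hp : part y i <= part y i.-1 by apply: part_mono => //; lia.
  have := h i i1 iN; rewrite eqxx; have := h i.-1; rewrite ifF; last by lia.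
  move=> /(_ _ _) h1 h2; have {}h1 : part y i.-1 = part x i.-1 + 0 by apply: h1; lia.
  by lia.
split=> //; apply/eqP/sig_ext => j /andP[j1 jN].
by rewrite part_raise// h.
Qed.

Lemma plus_e_lower x i y : (1 <= i)%N -> (i <= N)%N ->
  plus_e y i x = raisable (reflect_sig x) (N.+1 - i)%N && (lower x i == y).
Proof.
move=> i1 iN; have i'1 : (1 <= N.+1 - i)%N by lia.
have i'N : (N.+1 - i <= N)%N by lia.
rewrite /lower (can2_eq (@reflect_sigK N) (@reflect_sigK N)) -plus_e_raise//.
apply/plus_eP/plus_eP => h j j1 jN.
  rewrite !part_reflect_sig//; have -> : part x (N.+1 - j) = part y (N.+1 - j) + if (N.+1 - j)%N == i then 1 else 0.
    by apply: h; lia.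
  by rewrite opprD -addrA; case: eqP => h1; case: eqP => h2; lia.
have := h (N.+1 - j)%N; rewrite !part_reflect_sig; [|lia..].
rewrite (_ : (N.+1 - (N.+1 - j) = j)%N); last by lia.
move=> h'; have {}h' : - part y j = - part x j + (if (N.+1 - j)%N == (N.+1 - i)%N then 1 else 0).
  by apply: h'; lia.
by move: h'; case: eqP => h1; case: eqP => h2; lia.
Qed.

Lemma sig_ratesE x y :
  \sum_(1 <= i < N.+1)
      ((if plus_e x i y then up_rate z z' x i else 0) +
       (if plus_e y i x then down_rate w w' x i else 0)) =
  \sum_(m <- sig_moves) (if sig_target x m == y then sig_rate x m else 0).
Proof.
rewrite sum_sig_moves; apply: eq_big_nat => i /andP[i1 iN].
rewrite /sig_target /sig_rate /=.
have shifted_partE j k (h : int) : (lcoord x j + h - lcoord x k)%:~R = shifted_part R x j + h%:~R - shifted_part R x k :> R.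
  by rewrite /shifted_part /lcoord -rmorphD -rmorphB/=; congr (_%:~R); lia.
have shifted_partE0 j k : (lcoord x j - lcoord x k)%:~R = shifted_part R x j - shifted_part R x k :> R.
  by have := shifted_partE j k 0; rewrite !addr0.
congr (_ + _).
  rewrite plus_e_raise//; have [ok|nok] /= := boolP (raisable x i); last first.
    by rewrite /right_sig_rate /right_exit (negPf nok) !mul0r if_same.
  case: eqP => // _; rewrite right_sig_rateE// /up_rate Re_quad; congr (quad _ _ _ * _).
    by rewrite /lcoord; lia.
  by apply: eq_bigr => j _; rewrite shifted_partE shifted_partE0.
rewrite plus_e_lower//; have [ok|nok] /= := boolP (raisable (reflect_sig x) _); last first.
  by rewrite /left_sig_rate /right_exit (negPf nok) !mul0r if_same.
case: eqP => // _; rewrite left_sig_rateE// /down_rate; congr (_ * _).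
  rewrite -Re_quad; congr complex.Re.
  have -> : - part x i - N%:Z + i%:Z = - lcoord x i by rewrite /lcoord; lia.
  by rewrite rmorphN; ring.
by apply: eq_bigr => j _; rewrite (shifted_partE _ _ (-1)) rmorphN1 shifted_partE0.
Qed.

End SchemeMoves.

(** * The intertwining *)

Section Intertwining.
Variables (R : realType) (N : nat) (z z' w w' : R[i]).
Hypothesis hz : forall k : int, 0 < (z + k%:~R) * (z' + k%:~R).
Hypothesis hw : forall k : int, 0 < (w + k%:~R) * (w' + k%:~R).
Hypothesis N1 : (1 <= N)%N.
Local Notation rho := (quad (par_sum z z') (par_prod z z')).
Local Notation rho' := (quad (par_sum w w') (par_prod w w')).
Local Notation ms := (scheme_moves N).
Local Notation sr := (@scheme_rate R N z z' w w').
Local Notation gs := (@sig_rate R N z z' w w').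
Local Notation scheme_gen := (gen ms sr (@scheme_target N)).
Local Notation sig_gen := (gen (sig_moves N) gs (@sig_target N)).
Implicit Types (s : scheme N) (x y : signature N).

Let rho_ge0 (n : int) : 0 <= rho n. Proof. exact: quad_ge0. Qed.
Let rho'_ge0 (n : int) : 0 <= rho' n. Proof. exact: quad_ge0. Qed.

Lemma scheme_rate_ge0 s m : 0 <= sr s m.
Proof. by rewrite /scheme_rate /right_jump_rate; case: ifP => _; case: ifP. Qed.

Lemma sig_rate_ge0 x m : 0 <= gs x m.
Proof.
have h (f : int -> R) y i u v : (forall n, 0 <= f n) -> 0 <= right_exit f y i * Dim R u / Dim R v.
  move=> f0; apply: divr_ge0; last exact/ltW/Dim_gt0.
  apply: mulr_ge0; last exact/ltW/Dim_gt0.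
  by rewrite /right_exit; case: ifP => _ //; exact: f0.
by rewrite /sig_rate; case: ifP => _; exact: h.
Qed.

Lemma le_norm_bound (n : int) (M : R) : (n%:~R : R) ^+ 2 <= M -> 
  (`|n| <= Num.bound M)%N.
Proof.
move=> nM; have M0 : 0 <= M := le_trans (sqr_ge0 _) nM.
have hM := archi_boundP M0.
have : ((`|n| * `|n|)%N%:R : R) < (Num.bound M)%:R.
  apply: le_lt_trans hM; apply: le_trans nM.
  by rewrite natrM natr_absz -expr2 intr_norm real_normK ?num_real.
by rewrite ltr_nat => h; apply: leq_trans (ltnW h); case: absz => // m; rewrite leq_pmulr.
Qed.

Lemma scheme_norm_finite M : finite_set [set s | @scheme_norm R N s <= M].
Proof.
apply: sub_finite_set (finite_schemes N (Num.bound M)) => s /= sM k i i1 ik kN.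
apply: le_norm_bound => //; apply: le_trans sM.
have := @height_le_norm R N N1 s k i 1 i1 ik kN isT.
by rewrite /height expr1; apply: le_trans; rewrite lerDr.
Qed.

Lemma sig_norm_finite M : finite_set [set x | @sig_norm R N x <= M].
Proof.
apply: sub_finite_set (finite_signatures N (Num.bound M + N)) => x /= xM i i1 iN.
have : (`|part x i - i%:Z| <= Num.bound M)%N.
  apply: le_norm_bound => //; apply: le_trans xM.
  rewrite /sig_norm (bigD1_seq i) ?iota_uniq//=; last by rewrite mem_index_iota; lia.
  rewrite -/(shifted_part R x i) addrCA lerDl addr_ge0// sumr_ge0// => j _; exact: sqr_ge0.
by lia.
Qed.

Lemma sig_norm_ge1 x : 1 <= @sig_norm R N x.
Proof. by rewrite lerDl; apply: sumr_ge0 => i _; exact: sqr_ge0. Qed.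

Lemma scheme_gen_norm : exists c, forall s, scheme_gen (@scheme_norm R N) s <= c * @scheme_norm R N s.
Proof.
have [c hc] := scheme_drift_le N1 rho_ge0 rho'_ge0.
by exists c => s; rewrite /gen sum_scheme_moves; exact: hc.
Qed.

Lemma sig_gen_norm : exists c, forall x, sig_gen (@sig_norm R N) x <= c * @sig_norm R N x.
Proof.
have [c hc] := @sig_drift_le R N (par_sum z z') (par_prod z z') (par_sum w w') (par_prod w w') N1.
exists c => x; apply: le_trans (hc x); rewrite /gen sum_sig_moves.
rewrite le_eqVlt; apply/orP; left; apply/eqP; apply: eq_big_nat => i /andP[i1 iN].
have diff y (h : R) : h ^+ 2 = 1 ->
    (forall j, (1 <= j)%N -> (j <= N)%N -> shifted_part R y j = shifted_part R x j + if j == i then h else 0) ->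
    sig_norm R y - sig_norm R x = 2 * h * shifted_part R x i + 1.
  move=> h2 hy; rewrite /sig_norm opprD addrACA subrr add0r -sumrB.
  rewrite (eq_big_nat _ _ (F2 := fun j => if j == i then 2 * h * shifted_part R x i + 1 else 0)); last first.
    move=> j /andP[j1 jN]; rewrite hy//; case: eqP => [->|_]; last by rewrite addr0 subrr.
    by rewrite sqrrD h2; ring.
  rewrite (bigD1_seq i) ?iota_uniq//=; last by rewrite mem_index_iota; lia.
  by rewrite eqxx big1 ?addr0// => j /negPf ->.
rewrite /sig_rate /sig_target /=; congr (_ + _).
  have [ok|nok] := boolP (raisable x i); last first.
    by rewrite /right_sig_rate /right_exit (negPf nok) !mul0r.
  rewrite (diff (raise x i) 1) ?expr1n ?mulr1// => j j1 jN.
  rewrite /shifted_part part_raise//; case: eqP => _; rewrite ?addr0//.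
  by rewrite addrAC rmorphD/= rmorph1.
have [ok|nok] := boolP (raisable (reflect_sig x) (N.+1 - i)%N); last first.
  by rewrite /left_sig_rate /right_exit (negPf nok) !mul0r.
rewrite (diff (lower x i) (-1)) ?sqrrN ?expr1n// => [|j j1 jN].
  by congr (_ * _); ring.
rewrite /shifted_part part_lower//; case: eqP => _; rewrite ?addr0//.
by rewrite addrAC rmorphD/= rmorphN1.
Qed.

Definition fibre_mean (f : scheme N -> R) x : R := (\sum_(s <- fibre x) f s) / Dim R x.

(** Apply right_flux to the right moves and, after reflection, to the left
    moves. The potentials add up to a function of the top row, which is
    minus the exit rate on signatures, while the moves of the top row have
    the rates of the dynamics on signatures once they are divided by Dim. *)
Lemma fibre_mean_gen f x : fibre_mean (scheme_gen f) x = sig_gen (fibre_mean f) x.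
Proof.
apply: (mulIf (Dim_neq0 R x)); rewrite /fibre_mean divfK ?Dim_neq0//.
transitivity (\sum_(s <- fibre x) \sum_(p <- triangle N)
     right_jump_rate rho s p * (f (right_target s p.1 p.2) - f s) +
  \sum_(s <- fibre (reflect_sig x)) \sum_(p <- triangle N)
     right_jump_rate rho' s p * (f (reflect_scheme (right_target s p.1 p.2)) - f (reflect_scheme s))).
  rewrite sum_fibre_reflect -big_split; apply: eq_bigr => s _.
  by rewrite /gen sum_scheme_moves /=; congr (_ + _); apply: eq_bigr => p _; rewrite reflect_schemeK.
rewrite (right_flux rho f x N1) (right_flux rho' (fun s => f (reflect_scheme s)) (reflect_sig x) N1).
rewrite [X in _ + (_ + X)]sum_fibre_reflect addrACA.
have -> : \sum_(s <- fibre x) potential rho s * f s +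
  \sum_(s <- fibre x) potential rho' (reflect_scheme s) * f (reflect_scheme (reflect_scheme s)) =
  (rate_excess N (par_sum z z') (par_sum w w') -
   free_rate (par_sum z z') (par_prod z z') (par_sum w w') (par_prod w w') x) *
  \sum_(s <- fibre x) f s.
  rewrite mulr_sumr -big_split/= big_seq [RHS]big_seq; apply: eq_bigr => s.
  by rewrite mem_fibre reflect_schemeK -mulrDl => /eqP <-; rewrite potential_sum.
rewrite -opprB -exit_rate// mulNr.
have -> : \sum_(1 <= i < N.+1) right_exit rho' (reflect_sig x) i *
    (\sum_(s <- fibre (raise (reflect_sig x) i)) f (reflect_scheme s)) =
  \sum_(1 <= i < N.+1) right_exit rho' (reflect_sig x) (N.+1 - i)%N * (\sum_(s <- fibre (lower x i)) f s).
  rewrite big_nat_rev; apply: eq_big_nat => i /andP[i1 iN].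
  by rewrite /lower sum_fibre_reflect add1n subSS.
rewrite -big_split mulr_suml -sumrB /gen sum_sig_moves mulr_suml; apply: eq_bigr => i _.
rewrite /sig_rate /sig_target /right_sig_rate /left_sig_rate /=.
by field; rewrite !Dim_neq0.
Qed.

End Intertwining.

(** * The induced semigroup *)

Section Sums.
Variable R : realType.

Lemma esumZl (T : choiceType) (D : set T) (c : R) (f : T -> R) :
  0 <= c -> (forall x, 0 <= f x) ->
  \esum_(x in D) (c * f x)%:E = (c%:E * \esum_(x in D) (f x)%:E)%E.
Proof.
have le d (g : T -> R) : 0 <= d -> (forall x, 0 <= g x) ->
    (\esum_(x in D) (d * g x)%:E <= d%:E * \esum_(x in D) (g x)%:E)%E.
  move=> d0 g0; apply: ge_ereal_sup => _ [X [finX XD] <-].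
  rewrite fsbig_finite//= sumEFin -mulr_sumr EFinM lee_wpmul2l ?lee_fin//.
  by apply: esum_ge; exists X => //; rewrite fsbig_finite//= sumEFin.
move=> c0 f0; apply/eqP; rewrite eq_le le//=.
have [c00|cn0] := eqVneq c 0.
  by rewrite c00 mul0e esum_ge0// => x _; rewrite lee_fin mul0r.
have {cn0}c0 : 0 < c by rewrite lt_def cn0.
have -> : \esum_(x in D) (f x)%:E = \esum_(x in D) (c^-1 * (c * f x))%:E.
  by apply: eq_esum => x _; rewrite mulKf// gt_eqF.
apply: (@le_trans _ _ (c%:E * (c^-1%:E * \esum_(x in D) (c * f x)%:E))%E).
  apply: lee_wpmul2l; first by rewrite lee_fin ltW.
  apply: (le c^-1 (fun x => c * f x)); first by rewrite invr_ge0 ltW.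
  by move=> x; rewrite mulr_ge0// ltW.
by rewrite muleA -EFinM divff ?gt_eqF// mul1e.
Qed.

Lemma esum_swap (T1 T2 : choiceType) (a : T1 -> T2 -> \bar R) :
  (forall x y, (0 <= a x y)%E) ->
  \esum_(x in [set: T1]) \esum_(y in [set: T2]) a x y =
  \esum_(y in [set: T2]) \esum_(x in [set: T1]) a x y.
Proof.
move=> a0; rewrite !esum_esum//.
rewrite (reindex_esum ([set: T2] `*`` (fun=> [set: T1])) _ (fun p => (p.2, p.1)))//.
split=> [[i j] //|[i j] [i' j'] _ _ /= [-> ->] //|[i j] _ /=].
by exists (j, i).
Qed.

(** Summation by blocks, used for the partition of schemes into fibres. *)
Lemma esum_partition (T1 T2 : choiceType) (h : T2 -> T1) (a : T2 -> \bar R) :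
  (forall y, (0 <= a y)%E) ->
  \esum_(y in [set: T2]) a y = \esum_(x in [set: T1]) \esum_(y in [set y | h y = x]) a y.
Proof.
move=> a0; rewrite (@esum_esum _ _ _ _ _ (fun=> a))//.
rewrite (reindex_esum [set: T2] _ (fun y => (h y, y)))//.
split=> [y _ //|y y' _ _ /= [_ ->] //|[x y] [_ /= <-]].
by exists y.
Qed.

Variable T : countType.
Implicit Types (mu : T -> R) (p : T -> T -> R).

Lemma act_esum mu p b : prob_measure mu -> stochastic p ->
  (act mu p b)%:E = \esum_(a in [set: T]) (mu a * p a b)%:E.
Proof.
move=> [mu0 mu1] sp; rewrite /act fineK//.
have h0 : (0 <= \esum_(a in [set: T]) (mu a * p a b)%:E)%E.
  by apply: esum_ge0 => a _; rewrite lee_fin mulr_ge0//; case: (sp a).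
rewrite ge0_fin_numE//; apply: (@le_lt_trans _ _ 1%E); last by rewrite ltry.
rewrite -mu1; apply: le_esum => a _; rewrite lee_fin ler_piMr//.
by case/andP: (stochastic_le1 sp a b).
Qed.

Lemma act_prob_measure mu p : prob_measure mu -> stochastic p -> prob_measure (act mu p).
Proof.
move=> hmu sp; have [mu0 mu1] := hmu; split=> [b|].
  by rewrite -lee_fin act_esum//; apply: esum_ge0 => a _; rewrite lee_fin mulr_ge0//; case: (sp a).
under eq_esum do rewrite act_esum//.
rewrite esum_swap => [|b a]; last by rewrite lee_fin mulr_ge0//; case: (sp a).
rewrite -mu1; apply: eq_esum => a _; rewrite esumZl//; last by case: (sp a).
by case: (sp a) => _ ->; rewrite mule1.
Qed.

End Sums.

Section InducedSemigroup.
Variables (R : realType) (N : nat) (z z' w w' : R[i]).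
Hypothesis hz : forall k : int, 0 < (z + k%:~R) * (z' + k%:~R).
Hypothesis hw : forall k : int, 0 < (w + k%:~R) * (w' + k%:~R).
Hypothesis N1 : (1 <= N)%N.
Local Notation sr := (@scheme_rate R N z z' w w').
Local Notation gs := (@sig_rate R N z z' w w').
Local Notation scheme_gen := (gen (scheme_moves N) sr (@scheme_target N)).
Local Notation sig_gen := (gen (sig_moves N) gs (@sig_target N)).
Implicit Types (s : scheme N) (x y : signature N).

Let sr0 := scheme_rate_ge0 hz hw (N := N).
Let gs0 := sig_rate_ge0 hz hw (N := N).

Lemma fibre_mean_solves (u : R -> scheme N -> R) :
  solves (scheme_moves N) sr (@scheme_target N) u ->
  solves (sig_moves N) gs (@sig_target N) (fun t => fibre_mean (u t)).
Proof.
move=> hu t x t0; rewrite -fibre_mean_gen// /fibre_mean mulrC.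
under eq_fun do rewrite mulrC.
apply: has_derivZ; apply: has_deriv_sum => s _; exact: hu.
Qed.

Let dimV_ge0 x : 0 <= (Dim R x)^-1. Proof. by rewrite invr_ge0 ltW// Dim_gt0. Qed.

Lemma fibre_mean_le (f g : scheme N -> R) x : (forall s, f s <= g s) ->
  fibre_mean f x <= fibre_mean g x.
Proof. by move=> fg; apply: ler_wpM2r => //; apply: ler_sum => s _; exact: fg. Qed.

Lemma fibre_meanZ c (f : scheme N -> R) x : fibre_mean (fun s => c * f s) x = c * fibre_mean f x.
Proof. by rewrite /fibre_mean -mulr_sumr mulrA. Qed.

(** A Lyapunov function on signatures which is large compared to the fibre
    means of bounded functions: the summand with scheme_norm is there to
    absorb the cardinalities of the fibres. By the intertwining, the drift
    of this summand is the fibre mean of the drift of scheme_norm. *)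
Definition mean_norm x : R := sig_norm R x + fibre_mean (@scheme_norm R N) x.

Let fm_ge0 (f : scheme N -> R) x : (forall s, 0 <= f s) -> 0 <= fibre_mean f x.
Proof. by move=> f0; apply: mulr_ge0 => //; apply: sumr_ge0 => s _; exact: f0. Qed.

Let norm0 s : 0 <= @scheme_norm R N s.
Proof. exact: le_trans ler01 (scheme_norm_ge1 R N1 s). Qed.

Lemma mean_norm_ge1 x : 1 <= mean_norm x.
Proof. by rewrite (le_trans (sig_norm_ge1 R x))// lerDl fm_ge0. Qed.

Lemma mean_norm_gen : exists c, forall x, sig_gen mean_norm x <= c * mean_norm x.
Proof.
have [c1 h1] := sig_gen_norm z z' w w' N1.
have [c2 h2] := scheme_gen_norm hz hw N1.
exists (`|c1| + `|c2|) => x; rewrite /mean_norm genD -fibre_mean_gen// mulrDr.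
have s0 : 0 <= sig_norm R x := le_trans ler01 (sig_norm_ge1 R x).
have f0 : 0 <= fibre_mean (@scheme_norm R N) x by exact: fm_ge0.
apply: lerD.
  by rewrite (le_trans (h1 x))// ler_wpM2r// (le_trans (ler_norm _))// lerDl.
rewrite (le_trans (fibre_mean_le x h2))// fibre_meanZ ler_wpM2r//.
by rewrite (le_trans (ler_norm _))// lerDr.
Qed.

(** A fibre mean of functions with values in [0, 1] is at most that of 1,
    and scheme_norm is at least the square of any part of the top row, so
    it exceeds any multiple of 1 on all but finitely many fibres. This
    replaces the count of the schemes in a fibre by Dim. *)
Lemma mean_norm_dominates (C K : R) : 0 <= C ->
  finite_set [set x | mean_norm x <= K * (fibre_mean (fun=> 1) x + C)].
Proof.
move=> C0; apply: (@sub_finite_set _ _ ([set x | sig_norm R x <= `|K| * C] `|`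
  [set x : signature N | forall i, (1 <= i)%N -> (i <= N)%N -> (`|part x i| <= Num.bound `|K|)%N])); last first.
  by rewrite finite_setU; split; [exact: sig_norm_finite|exact: finite_signatures].
move=> x /= xK; have [h|h] := leP (sig_norm R x) (`|K| * C); [by left|right].
move=> i i1 iN; apply: (@le_norm_bound R); rewrite leNgt; apply/negP => Ki.
set g := fibre_mean (fun=> 1) x in xK.
have g0 : 0 <= g by apply: fm_ge0.
have hg : `|K| * g <= fibre_mean (@scheme_norm R N) x.
  rewrite -fibre_meanZ; apply: ler_wpM2r => //.
  rewrite big_seq [leRHS]big_seq; apply: ler_sum => s; rewrite mem_fibre => /eqP sx.
  rewrite mulr1 (le_trans _ (height_le_norm R N1 s i1 iN (leqnn N) (ltn0Sn _)))//.
  by rewrite /height expr1 /entry sx (le_trans (ltW Ki))// lerDr.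
have : K * (g + C) <= `|K| * g + `|K| * C.
  by rewrite -mulrDr ler_wpM2r ?ler_norm// addr_ge0.
by move: xK h; rewrite /mean_norm; lra.
Qed.

Variables (P : R -> scheme N -> scheme N -> R) (PN : R -> signature N -> signature N -> R).
Hypothesis hP : markov_semigroup_of (scheme_rates z z' w w' N) P.
Hypothesis hPN : markov_semigroup_of (signature_rates z z' w w' N) PN.

Let qs s s' : s != s' -> _ := fun _ => scheme_ratesE z z' w w' s s'.
Let qg x y : x != y -> _ := fun _ => sig_ratesE z z' w w' x y.

(** Both sides solve the backward equation on signatures, with the
    indicator of the top row of s over its dimension as initial value; the
    difference is dominated by mean_norm, so uniqueness applies. *)
Lemma fibre_mean_semigroup (t : R) s x : 0 <= t ->
  fibre_mean (fun s' => P t s' s) x = PN t x (level s N) / Dim R (level s N).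
Proof.
have [P01 P0 Ps] := moves_semigroupP sr0 qs hP.
have [PN01 PN0 PNs] := moves_semigroupP gs0 qg hPN.
have [c hc] := mean_norm_gen.
set top := level s N; set d := Dim R top.
have d0 : 0 <= d^-1 by rewrite invr_ge0 ltW// Dim_gt0.
move=> t0; rewrite mulrC.
apply: (@solves_uniq_dom _ _ _ _ _ _ gs0 mean_norm c mean_norm_ge1 hc
  (fun t x => fibre_mean (fun s' => P t s' s) x) (fun t x => d^-1 * PN t x top)
  (fun x => fibre_mean (fun=> 1) x + d^-1)) => //.
- by move=> K; exact: mean_norm_dominates.
- exact: fibre_mean_solves (Ps s).
- by apply: solvesZ; exact: PNs.
- move=> u y u0.
  have u1 : 0 <= fibre_mean (fun s' => P u s' s) y.
    by apply: fm_ge0 => s'; case/andP: (P01 u s' s u0).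
  have u2 : fibre_mean (fun s' => P u s' s) y <= fibre_mean (fun=> 1) y.
    by apply: fibre_mean_le => s'; case/andP: (P01 u s' s u0).
  have /andP[v1 v2] := PN01 u y top u0.
  have v3 : d^-1 * PN u y top <= d^-1 by rewrite ler_piMr.
  have v4 : 0 <= d^-1 * PN u y top by rewrite mulr_ge0.
  by rewrite ler_norml; apply/andP; split; lra.
- move=> y; rewrite PN0 /fibre_mean; under eq_bigr do rewrite P0.
  have [->|yt] := eqVneq y top.
    rewrite (bigD1_seq s) ?fibre_uniq//=; last by rewrite mem_fibre.
    rewrite eqxx big1 ?addr0; first by rewrite mulr1 mul1r.
    by move=> s' /negPf ->.
  rewrite mulr0 big_seq big1 ?mul0r// => s'; rewrite mem_fibre => /eqP sy.
  by case: eqP => // ss; case/eqP: yt; rewrite -sy ss.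
Qed.

(** Grouping the initial schemes by their top row x, the weight mu x / Dim
    x leaves a fibre mean, which fibre_mean_semigroup evaluates. *)
Lemma induced_central_lift (t : R) mu : 0 <= t -> prob_measure mu ->
  central_lift (act mu (PN t)) = act (central_lift mu) (P t).
Proof.
have [P01 P0 Ps] := moves_semigroupP sr0 qs hP.
have [PN01 PN0 PNs] := moves_semigroupP gs0 qg hPN.
move=> t0 hmu; apply/funext => s; rewrite central_liftE//.
have [mu0 mu1] := hmu; set top := level s N; set d := Dim R top.
have d0 : 0 <= d^-1 by rewrite invr_ge0 ltW// Dim_gt0.
rewrite -[LHS]/(fine (act mu (PN t) top / d)%:E) /act; congr fine.
rewrite mulrC EFinM -/(act mu (PN t) top) act_esum//; last exact: (hPN.2 t t0).
rewrite -esumZl//; last by move=> x; rewrite mulr_ge0//; case/andP: (PN01 t x top t0).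
rewrite (esum_partition (fun s' => level s' N)); last first.
  move=> s'; rewrite lee_fin central_liftE//; apply: mulr_ge0; first exact: mulr_ge0.
  by case/andP: (P01 t s' s t0).
apply: eq_esum => x _.
rewrite esum_fset; [|exact: finite_fibre|]; last first.
  move=> s' _; rewrite lee_fin central_liftE//; apply: mulr_ge0; first exact: mulr_ge0.
  by case/andP: (P01 t s' s t0).
rewrite fsbig_finite ?sumEFin; last exact: finite_fibre.
congr (_%:E); rewrite mulrCA [d^-1 * _]mulrC -fibre_mean_semigroup// /fibre_mean mulrA mulrAC mulr_sumr.
rewrite -/(fibre x) big_seq [RHS]big_seq; apply: eq_bigr => s'.
by rewrite mem_fibre => /eqP sx; rewrite central_liftE// sx.
Qed.

End InducedSemigroup.

Theorem corollary9p3 (R : realType) (z z' w w' : R[i])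
    (hz : forall k : int, 0 < (z + k%:~R) * (z' + k%:~R))
    (hw : forall k : int, 0 < (w + k%:~R) * (w' + k%:~R))
    (hsum : -1 < z + z' + w + w')
    (N : nat) (hN : (1 <= N)%N) :
  regular (scheme_rates z z' w w' N) /\
  forall P : R -> scheme N -> scheme N -> R,
    markov_semigroup_of (scheme_rates z z' w w' N) P ->
    central_semigroup P /\
    exists PN : R -> signature N -> signature N -> R,
      markov_semigroup_of (signature_rates z z' w w' N) PN /\
      induced_semigroup P PN.
Proof.
have [c hc] := scheme_gen_norm hz hw hN.
have [cN hcN] := sig_gen_norm z z' w w' hN.
split.
  apply: (moves_regular (scheme_rate_ge0 hz hw (N := N)) _ (scheme_norm_ge1 R hN) _ hc).
    by move=> s s' _; exact: scheme_ratesE.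
  exact: scheme_norm_finite.
move=> P hP.
have [PN hPN] : exists PN, markov_semigroup_of (signature_rates z z' w w' N) PN.
  apply: (moves_semigroup_exists (sig_rate_ge0 hz hw (N := N)) _ (@sig_norm_ge1 R N) _ hcN).
    by move=> x y _; exact: sig_ratesE.
  exact: sig_norm_finite.
have ind (t : R) mu : 0 <= t -> prob_measure mu ->
    prob_measure (act mu (PN t)) /\ central_lift (act mu (PN t)) = act (central_lift mu) (P t).
  move=> t0 hmu; split; last exact: (induced_central_lift hz hw hN hP hPN).
  exact: act_prob_measure hmu (hPN.2 t t0).
split; last by exists PN; split => // t t0 mu; exact: ind.
move=> t t0 M [M1 [mu hmu ME]]; split.
  exact: act_prob_measure M1 (hP.2 t t0).
have [h1 h2] := ind t mu t0 hmu.
by exists (act mu (PN t)) => //; rewrite h2 ME.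
Qed.
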